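(* Let $(M,\mathbf m)$ be a metric projective manifold of dimension $n\ge2$ with projective Weyl nullity (at every point), such that the function $B$ is smooth. Then there are canonical invariant linear differential operators $$E_{ab}:\mathcal E(1)\to\mathcal E_{(ab)}(1)\qquad\text{and}\qquad S_{abc}:\mathcal E(2)\to\mathcal E_{(abc)}(2),$$ which, in the scale of a metric $g\in\mathbf m$ (with Levi-Civita connection $\nabla$ and $B=B^g$), are given for sections $\sigma$ of $\mathcal E(1)$ and $\tau$ of $\mathcal E(2)$ by $$E_{ab}(\sigma)=\nabla_a\nabla_b\sigma+Bg_{ab}\sigma$$ and $$S_{abc}(\tau)=\nabla_{(a}\nabla_b\nabla_{c)}\tau+4Bg_{(ab}\nabla_{c)}\tau+2g_{(ab}(\nabla_{c)}B)\tau .$$ Here canonical and invariant means that the right-hand sides do not depend on the choice of $g\in\mathbf m$.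
   Context: Manifolds are smooth and connected; metrics are smooth, pseudo-Riemannian, of arbitrary signature; indices are abstract indices and round brackets denote symmetrisation. Two metrics are projectively equivalent if they have the same geodesics up to reparametrisation; a metric projective structure $\mathbf m$ on $M$ is an equivalence class of projectively equivalent metrics. For the Levi-Civita connection $\nabla$ of a metric $g$: $[\nabla_\ell,\nabla_k]v^j=R^j{}_{i\ell k}v^i$, $R_{jk}=R^a{}_{jak}$, $\mathsf P_{jk}=\frac1{n-1}R_{jk}$, $\mathsf P^i{}_j=g^{ik}\mathsf P_{kj}$. The projective Weyl tensor $W^i{}_{jk\ell}=R^i{}_{jk\ell}+\delta^i_\ell\mathsf P_{jk}-\delta^i_k\mathsf P_{j\ell}$ is the same for all metrics in $\mathbf m$. $(M,\mathbf m)$ has Weyl nullity if at every $x\in M$ there is a nonzero $v\in T_xM$ with $W^i{}_{jk\ell}v^j=0$. In that case each $g\in\mathbf m$ determines a function $B=B^g:M\to\mathbb R$ by $\mathsf P^i{}_jv^j=Bv^i$ for all $v$ in the nullity (the value does not depend on $v$). $\mathcal E(1)$ denotes the positive $(2n+2)$-nd root of the oriented line bundle $(\Lambda^nTM)^2$, $\mathcal E(w)$ its real powers, and $\mathcal E_{(ab)}(w)=S^2T^*M\otimes\mathcal E(w)$, $\mathcal E_{(abc)}(w)=S^3T^*M\otimes\mathcal E(w)$. Levi-Civita connections act on $\mathcal E(w)$ in the induced way. *)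

(* Defs.v *)
From HB Require Import structures.
From mathcomp Require Import all_boot all_order all_algebra.
From mathcomp Require Import all_classical all_reals all_analysis.

Set Implicit Arguments.
Unset Strict Implicit.
Unset Printing Implicit Defensive.

Import Order.TTheory GRing.Theory Num.Theory numFieldNormedType.Exports.

Local Open Scope classical_set_scope.
Local Open Scope ring_scope.

Section Coordinates.
Context {R : realType} {n : nat}.

Definition partial (i : 'I_n) (f : 'rV[R]_n -> R) : 'rV[R]_n -> R :=
  fun x => 'D_(delta_mx 0 i) f x.

Definition iter_partial (s : seq 'I_n) (f : 'rV[R]_n -> R) : 'rV[R]_n -> R :=
  foldr partial f s.

(* C^oo on an open set U: f and all its iterated partial derivatives are
   Frechet differentiable at every point of U. *)
Definition smooth_on (U : set 'rV[R]_n) (f : 'rV[R]_n -> R) : Prop :=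
  forall (s : seq 'I_n) x, U x -> differentiable (iter_partial s f) x.

Definition jacobian_mx (f : 'rV[R]_n -> 'rV[R]_n) (x : 'rV[R]_n) : 'M[R]_n :=
  \matrix_(i, j) partial j (fun y => f y 0 i) x.

(* Components, in one coordinate system, of a covariant tensor of rank k
   (possibly density valued); T x [tuple a; b] is T_{ab} at x. *)
Definition components (k : nat) := 'rV[R]_n -> k.-tuple 'I_n -> R.

Definition replace_index k (s : k.-tuple 'I_n) (p : 'I_k) (e : 'I_n) :
    k.-tuple 'I_n :=
  [tuple if q == p then e else tnth s q | q < k].

(* In the remainder of this section G is the component matrix (g_{ij}) of a
   metric in some coordinate system. *)

(* christoffel G x k i j is Gamma^k_{ij}, for the Levi-Civita connection. *)
Definition christoffel (G : 'rV[R]_n -> 'M[R]_n) (x : 'rV[R]_n)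
    (k i j : 'I_n) : R :=
  2^-1 * \sum_(l < n) invmx (G x) k l *
    (partial i (fun y => G y j l) x + partial j (fun y => G y i l) x
     - partial l (fun y => G y i j) x).

(* (nabla_a T)_{b...}, the new index a coming first, for T with values in E(w).
   The connection induced on Lambda^n TM acts on the component with respect to
   the coordinate frame by d_a + Gamma^d_{ad}; as E(w) is the power w/(2n+2) of
   (Lambda^n TM)^2, the connection on E(w) is d_a + w/(n+1) Gamma^d_{ad}. *)
Definition nabla (G : 'rV[R]_n -> 'M[R]_n) (w : R) (k : nat)
    (T : components k) : components k.+1 :=
  fun x s =>
    let a := thead s in
    let b : k.-tuple 'I_n := behead_tuple s in
    partial a (fun y => T y b) x
    + w / n.+1%:R * (\sum_(d < n) christoffel G x d a d) * T x b
    - \sum_(p < k) \sum_(e < n)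
        christoffel G x e a (tnth b p) * T x (replace_index b p e).

(* R^i_{jkl}, normalised by [nabla_k, nabla_l] v^i = R^i_{jkl} v^j. *)
Definition curvature (G : 'rV[R]_n -> 'M[R]_n) (x : 'rV[R]_n)
    (i j k l : 'I_n) : R :=
  partial k (fun y => christoffel G y i l j) x
  - partial l (fun y => christoffel G y i k j) x
  + \sum_(m < n) (christoffel G x i k m * christoffel G x m l j
                  - christoffel G x i l m * christoffel G x m k j).

Definition ricci (G : 'rV[R]_n -> 'M[R]_n) (x : 'rV[R]_n) (j k : 'I_n) : R :=
  \sum_(a < n) curvature G x a j a k.

Definition schouten (G : 'rV[R]_n -> 'M[R]_n) (x : 'rV[R]_n)
    (j k : 'I_n) : R :=
  (n%:R - 1)^-1 * ricci G x j k.

(* P^i_j *)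
Definition schouten_up (G : 'rV[R]_n -> 'M[R]_n) (x : 'rV[R]_n)
    (i j : 'I_n) : R :=
  \sum_(k < n) invmx (G x) i k * schouten G x k j.

(* W^i_{jkl} *)
Definition weyl (G : 'rV[R]_n -> 'M[R]_n) (x : 'rV[R]_n)
    (i j k l : 'I_n) : R :=
  curvature G x i j k l + (i == l)%:R * schouten G x j k
  - (i == k)%:R * schouten G x j l.

Definition in_nullity (G : 'rV[R]_n -> 'M[R]_n) (x v : 'rV[R]_n) : Prop :=
  forall i k l : 'I_n, \sum_(j < n) weyl G x i j k l * v 0 j = 0.

End Coordinates.

(* The total symmetrisation F_{(abc)}. *)
Definition sym3 (R : realType) (n : nat) (F : 'I_n -> 'I_n -> 'I_n -> R)
    (a b c : 'I_n) : R :=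
  6^-1 * (F a b c + F a c b + F b a c + F b c a + F c a b + F c b a).

(* A smooth connected n-manifold, given by a topological space and any (not
   necessarily maximal) smooth atlas.  chart_map c and chart_inv c are only
   meaningful on chart_dom c and on its image. *)
Record manifold (R : realType) (n : nat) := Manifold {
  carrier :> topologicalType;
  manifold_hausdorff : hausdorff_space carrier;
  manifold_second_countable : @second_countable carrier;
  manifold_connected : connected [set: carrier];
  chart : Type;
  chart_dom : chart -> set carrier;
  chart_map : chart -> carrier -> 'rV[R]_n;
  chart_inv : chart -> 'rV[R]_n -> carrier;
  chart_dom_open : forall c, open (chart_dom c);
  chart_cover : forall p, exists c, chart_dom c p;
  chart_mapK : forall c p, chart_dom c p -> chart_inv c (chart_map c p) = p;
  chart_image_open : forall c, open (chart_map c @` chart_dom c);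
  chart_map_continuous : forall c p,
    chart_dom c p -> {for p, continuous (chart_map c)};
  chart_inv_continuous : forall c x,
    (chart_map c @` chart_dom c) x -> {for x, continuous (chart_inv c)};
  chart_transition_smooth : forall c d (i : 'I_n),
    smooth_on (chart_map c @` (chart_dom c `&` chart_dom d))
      (fun x => chart_map d (chart_inv c x) 0 i) }.

Section Geometry.
Context {R : realType} {n : nat}.
Variable M : manifold R n.

Definition chart_image (c : chart M) : set 'rV[R]_n :=
  chart_map c @` chart_dom c.

Definition overlap (c d : chart M) : set 'rV[R]_n :=
  chart_map c @` (chart_dom c `&` chart_dom d).

Definition transition (c d : chart M) : 'rV[R]_n -> 'rV[R]_n :=
  fun x => chart_map d (chart_inv c x).

Definition smooth_function (f : M -> R) : Prop :=
  forall c : chart M, smooth_on (chart_image c) (fun x => f (chart_inv c x)).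

(* Smooth sections of S^k T^*M (x) E(w).  The coordinate frame of Lambda^n TM
   in the chart c is det J times the one in the chart d, J = d(x_d)/d(x_c);
   since E(w) is the w/(2n+2)-th power of (Lambda^n TM)^2, the component in c
   is (det J)^2 to the power -w/(2n+2) times the component in d.  The values of
   the components outside the image of a chart carry no information. *)
Record sym_tensor (k : nat) (w : R) := SymTensor {
  tensor_comp :> chart M -> @components R n k;
  tensor_smooth : forall c s, smooth_on (chart_image c) (fun x => tensor_comp c x s);
  tensor_sym : forall c x (s t : k.-tuple 'I_n),
    chart_image c x -> perm_eq s t -> tensor_comp c x s = tensor_comp c x t;
  tensor_transition : forall c d x (s : k.-tuple 'I_n), overlap c d x ->
    let J := jacobian_mx (transition c d) x in
    tensor_comp c x s =
      ((\det J) ^+ 2) `^ (- (w / (2 * n + 2)%N%:R)) *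
      \sum_(t : k.-tuple 'I_n)
        (\prod_(p < k) J (tnth t p) (tnth s p)) * tensor_comp d (transition c d x) t }.

Definition density (w : R) := sym_tensor 0 w.

Definition tensor_matrix (g : sym_tensor 2 0) (c : chart M) (x : 'rV[R]_n) :
    'M[R]_n :=
  \matrix_(i, j) g c x [tuple i; j].

Record metric := Metric {
  metric_tensor :> sym_tensor 2 0;
  metric_nondegenerate : forall c x,
    chart_image c x -> tensor_matrix metric_tensor c x \in unitmx }.

Definition metric_matrix (g : metric) (c : chart M) : 'rV[R]_n -> 'M[R]_n :=
  tensor_matrix g c.

(* gam : I -> M is an affinely parametrised geodesic of g, I being an open
   interval.  Solutions of the geodesic equation are automatically smooth. *)
Definition geodesic (g : metric) (I : set R) (gam : R -> M) : Prop :=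
  [/\ open I, is_interval I &
  forall t, I t -> {for t, continuous gam} /\
    forall c, chart_dom c (gam t) ->
    let u := fun (i : 'I_n) (s : R) => chart_map c (gam s) 0 i in
    forall k, [/\ derivable (u k) t 1, derivable (derive1 (u k)) t 1 &
      derive1 (derive1 (u k)) t
      + \sum_(i < n) \sum_(j < n)
          christoffel (metric_matrix g c) (chart_map c (gam t)) k i j
          * derive1 (u i) t * derive1 (u j) t = 0]].

Definition reparametrisation (J I : set R) (phi : R -> R) : Prop :=
  [/\ open J, is_interval J, phi @` J = I &
  forall t, J t ->
    derive1 phi t != 0 /\ forall k, derivable (derive1n k phi) t 1].

Definition geodesics_reparametrise (g h : metric) : Prop :=
  forall (I : set R) (gam : R -> M), geodesic g I gam ->
  exists (J : set R) (phi : R -> R),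
    reparametrisation J I phi /\ geodesic h J (gam \o phi).

Definition projectively_equivalent (g h : metric) : Prop :=
  geodesics_reparametrise g h /\ geodesics_reparametrise h g.

Definition metric_projective_structure (m : set metric) : Prop :=
  exists g0, m = [set g | projectively_equivalent g0 g].

Definition has_weyl_nullity (m : set metric) : Prop :=
  forall g, m g -> forall (p : M) (c : chart M), chart_dom c p ->
  exists v : 'rV[R]_n,
    v != 0 /\ in_nullity (metric_matrix g c) (chart_map c p) v.

(* B^g.  Under Weyl nullity exactly one b satisfies the condition, so the
   default value 0 of xget is irrelevant. *)
Definition nullity_eigenvalue (g : metric) : M -> R :=
  fun p => xget 0 [set b : R |
    forall (c : chart M), chart_dom c p ->
    forall v, in_nullity (metric_matrix g c) (chart_map c p) v ->
    forall i, \sum_(j < n)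
      schouten_up (metric_matrix g c) (chart_map c p) i j * v 0 j
      = b * v 0 i].

(* In every chart, D is a linear combination of iterated partial derivatives of
   order at most N, with smooth coefficients. *)
Definition linear_differential_operator (w w' : R) (k : nat)
    (D : density w -> sym_tensor k w') : Prop :=
  exists N : nat, forall c : chart M,
  exists A : forall j : nat, j.-tuple 'I_n -> k.-tuple 'I_n -> 'rV[R]_n -> R,
    (forall j s t, smooth_on (chart_image c) (A j s t)) /\
    forall (sigma : density w) x t, chart_image c x ->
      D sigma c x t =
      \sum_(j < N.+1) \sum_(s : j.-tuple 'I_n)
        A j s t x * iter_partial s (fun y => sigma c y [tuple]) x.

End Geometry.

(* Main.v *)
(* Geodesics exist in every direction through every point, so two metrics with
   the same unparametrised geodesics have Christoffel symbols differing by
   delta^k_i Y_j + delta^k_j Y_i; Y is closed because the traces of the Christoffel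
   symbols are.  Hence P changes by the symmetric tensor Phi_jl =
   nabla_j Y_l - Y_j Y_l and the Weyl tensor does not change.  For v in the
   nullity, the pair symmetry of the Riemann tensor shows that contracting v
   into a form index of the Weyl tensor gives (P - B g) times v, up to sign.  So
   P - B g is the same for all metrics of the class, that is
   Phi = B g - B' g'.  Given this, both formulas turn out to be invariant when
   nabla' is expanded in terms of nabla.  They define tensors because the
   Levi-Civita derivative commutes with pullback along transition maps. *)
Require Import Defs.
From HB Require Import structures.
From mathcomp Require Import all_boot all_order all_algebra.
From mathcomp Require Import all_classical all_reals all_analysis.
From mathcomp Require Import perm ring lra.

Set Implicit Arguments.
Unset Strict Implicit.
Unset Printing Implicit Defensive.

Import Order.TTheory GRing.Theory Num.Theory numFieldNormedType.Exports.

Local Open Scope classical_set_scope.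
Local Open Scope ring_scope.

(** * Partial derivatives and smooth functions *)

(** Weights and coefficients come from the projective change law. In weight 1 the first-order terms
    of [nabla' nabla' sigma] cancel and only [Phi sigma] is added. In weight 2 the second-order
    terms of the third derivative cancel; the coefficients 4 and 2 are those for which S annihilates
    the product of any two solutions of E = 0. The obstacle is that the hypothesis speaks of curves
    and the conclusion of tensors. A geodesic with prescribed initial velocity is built by Picard
    iteration in one chart; since [geodesic] asks for the equation in every chart, it must then be
    carried over by the transformation law of the Christoffel symbols. That law follows from the
    uniqueness of the symmetric metric connection, not from the defining formula. Each operator is
    built from a single metric of the class and then compared with the formulas of the other
    metrics. As components carry no information outside the image of a chart, functions are equal on
    open sets only, and derivatives are compared through such sets. *)

Section Differentiability.
Context {R : realType} {V W : normedModType R}.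
Implicit Types (f g : V -> W) (x : V).

(** The difference [g - f] vanishes near [x], so it is differentiable there with zero differential;
    adding [f] back gives the claim. *)
Lemma near_eq_differentiable f g x :
  {near x, f =1 g} -> differentiable f x -> differentiable g x.
Proof.
move=> fg df.
suff d0 : differentiable (g - f) x.
  by rewrite -[g](subrK f); apply: differentiableD.
have gf0 : g x - f x = 0 by rewrite (nbhs_singleton fg) subrr.
have small : (g - f) \o shift x = cst ((g - f) x) + cst 0 +o_ 0 id.
  apply/eqaddoP => e e0 /=.
  have fgx : \forall h \near (0 : V), f (h + x) = g (h + x).
    have := fg; rewrite (near_shift 0) /= => H.
    by apply: filterS H => h; rewrite /= subr0.
  near=> h; rewrite /= !fctE /= gf0 addr0 subr0 (near fgx h) // subrr normr0.
  by rewrite mulr_ge0 // ltW.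
apply/diff_locallyP.
have d0 : 'd (g - f) x = cst 0 :> (V -> W).
  by apply: (@diff_unique _ _ _ _ \0) => //; exact: cst_continuous.
by rewrite d0; split => //; exact: cst_continuous.
Unshelve. all: by end_near. Qed.

End Differentiability.

Section DifferentiableReal.
Context {R : realType} {V : normedModType R}.
Implicit Types (f g : V -> R) (x : V).

Lemma dfcst (a : R) x : differentiable (fun=> a) x.
Proof. exact: differentiable_cst. Qed.

Lemma dfD f g x : differentiable f x -> differentiable g x ->
  differentiable (fun y => f y + g y) x.
Proof. exact: differentiableD. Qed.

Lemma dfN f x : differentiable f x -> differentiable (fun y => - f y) x.
Proof. exact: differentiableN. Qed.

Lemma dfM f g x : differentiable f x -> differentiable g x ->
  differentiable (fun y => f y * g y) x.
Proof. exact: differentiableM. Qed.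

Lemma dfV f x : differentiable f x -> f x != 0 ->
  differentiable (fun y => (f y)^-1) x.
Proof. exact: differentiableV. Qed.

Lemma df_sum (I : Type) (r : seq I) (P : pred I) (F : I -> V -> R) x :
  (forall i, P i -> differentiable (F i) x) ->
  differentiable (fun y => \sum_(i <- r | P i) F i y) x.
Proof.
move=> dF; elim: r => [|i r IH].
  by under eq_fun do rewrite big_nil; exact: dfcst.
case: (boolP (P i)) => [Pi|/negbTE nPi]; last first.
  by under eq_fun do rewrite big_cons nPi.
under eq_fun do rewrite big_cons Pi.
by apply: dfD => //; exact: dF.
Qed.

Lemma df_prod (I : Type) (r : seq I) (P : pred I) (F : I -> V -> R) x :
  (forall i, P i -> differentiable (F i) x) ->
  differentiable (fun y => \prod_(i <- r | P i) F i y) x.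
Proof.
move=> dF; elim: r => [|i r IH].
  by under eq_fun do rewrite big_nil; exact: dfcst.
case: (boolP (P i)) => [Pi|/negbTE nPi]; last first.
  by under eq_fun do rewrite big_cons nPi.
under eq_fun do rewrite big_cons Pi.
by apply: dfM => //; exact: dF.
Qed.

End DifferentiableReal.

Section Partial.
Context {R : realType} {n : nat}.
Local Notation V := 'rV[R]_n.
Implicit Types (f g : V -> R) (x : V) (i : 'I_n).

Lemma partialE i f x : differentiable f x ->
  partial i f x = 'd f x (delta_mx 0 i).
Proof. exact: deriveE. Qed.

Lemma partial_cst i (a : R) x : partial i (fun=> a) x = 0.
Proof. exact: derive_cst. Qed.

Lemma partialD i f g x : differentiable f x -> differentiable g x ->
  partial i (fun y => f y + g y) x = partial i f x + partial i g x.
Proof. by move=> df dg; apply: deriveD; exact: diff_derivable. Qed.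

Lemma partialN i f x : differentiable f x ->
  partial i (fun y => - f y) x = - partial i f x.
Proof. by move=> df; apply: deriveN; exact: diff_derivable. Qed.

Lemma partialM i f g x : differentiable f x -> differentiable g x ->
  partial i (fun y => f y * g y) x = partial i f x * g x + f x * partial i g x.
Proof.
move=> df dg; rewrite /partial (deriveM (diff_derivable df) (diff_derivable dg)).
by rewrite addrC; congr (_ + _); rewrite mulrC.
Qed.

Lemma partialZ i f (a : R) x : differentiable f x ->
  partial i (fun y => a * f y) x = a * partial i f x.
Proof.
by move=> df; rewrite (partialM i (dfcst a x) df) partial_cst mul0r add0r.
Qed.

Lemma partialV i f x : differentiable f x -> f x != 0 ->
  partial i (fun y => (f y)^-1) x = - (f x)^-1 * (f x)^-1 * partial i f x.
Proof.
move=> df f0; rewrite /partial (deriveV f0 (diff_derivable df)).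
by rewrite [LHS]/GRing.scale /= -exprVn expr2 !mulNr.
Qed.

Lemma partial_sum i (I : Type) (r : seq I) (P : pred I) (F : I -> V -> R) x :
  (forall j, P j -> differentiable (F j) x) ->
  partial i (fun y => \sum_(j <- r | P j) F j y) x =
  \sum_(j <- r | P j) partial i (F j) x.
Proof.
move=> dF; elim: r => [|j r IH].
  by rewrite big_nil; under eq_fun do rewrite big_nil; exact: partial_cst.
rewrite big_cons; case: (boolP (P j)) => [Pj|/negbTE nPj]; last first.
  by under eq_fun do rewrite big_cons nPj.
under eq_fun do rewrite big_cons Pj.
by rewrite partialD ?IH//; [exact: dF|exact: df_sum].
Qed.

Lemma partial_near i f g x : {near x, f =1 g} -> partial i f x = partial i g x.
Proof. exact: near_eq_derive. Qed.

Lemma near_open (U : set V) f g x : open U -> (forall y, U y -> f y = g y) ->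
  U x -> {near x, f =1 g}.
Proof. by move=> oU fg Ux; apply: filterS (open_nbhs_nbhs (conj oU Ux)). Qed.

Lemma partial_open (U : set V) i f g x : open U ->
  (forall y, U y -> f y = g y) -> U x -> partial i f x = partial i g x.
Proof. by move=> oU fg Ux; apply: partial_near; exact: near_open fg Ux. Qed.

Lemma differentiable_open (U : set V) f g x : open U ->
  (forall y, U y -> f y = g y) -> U x -> differentiable f x -> differentiable g x.
Proof.
by move=> oU fg Ux; apply: near_eq_differentiable; exact: near_open fg Ux.
Qed.

Lemma row_sumE (v : V) : v = \sum_e v 0 e *: delta_mx 0 e.
Proof.
apply/rowP => j; rewrite summxE (bigD1 j) //= !mxE !eqxx mulr1.
by rewrite big1 ?addr0 // => e ej; rewrite !mxE eq_sym (negPf ej) andbF mulr0.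
Qed.

Lemma diff_row_sum f x (v : V) : differentiable f x ->
  'd f x v = \sum_e v 0 e * partial e f x.
Proof.
move=> df; rewrite {1}[v]row_sumE linear_sum; apply: eq_bigr => e _.
by rewrite linearZ partialE.
Qed.

Lemma differentiable_row (X : normedModType R) (phi : X -> V) (x : X) :
  (forall e, differentiable (fun y => phi y 0 e) x) -> differentiable phi x.
Proof.
move=> dphi.
have -> : phi = \sum_e (fun y => phi y 0 e *: delta_mx 0 e).
  by apply/funext => y; rewrite fct_sumE -row_sumE.
by apply: differentiable_sum => e; exact: differentiableZl.
Qed.

Lemma differentiable_coords (X : normedModType R) (phi : X -> V) (x : X) e :
  differentiable phi x -> differentiable (fun y => phi y 0 e) x.
Proof.
move=> dphi; apply: (@differentiable_comp _ _ _ _ phi (fun v : V => v 0 e)) => //.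
exact: differentiable_coord.
Qed.

Lemma diff_coords (X : normedModType R) (phi : X -> V) (x : X) e v :
  differentiable phi x -> 'd (fun y => phi y 0 e) x v = 'd phi x v 0 e.
Proof.
move=> dphi.
have := @diff_comp _ _ _ _ phi (fun v : V => v 0 e) x dphi (differentiable_coord _ _ _).
rewrite /comp /= => ->.
(* The coordinate functional is packaged as a linear map, so that it is its own differential. *)
have @h : {linear V -> R}.
  by exists (fun N : V => N 0 e); do 2![eexists]; do ?[constructor];
     rewrite ?mxE// => ? *; rewrite ?mxE//; move=> ?; rewrite !mxE.
have := @diff_lin _ _ _ h (phi x) (@coord_continuous _ _ _ _ _).
by rewrite /h /= => ->.
Qed.

Lemma differentiable_comp_row (phi : V -> V) f x :
  (forall e, differentiable (fun y => phi y 0 e) x) ->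
  differentiable f (phi x) -> differentiable (fun y => f (phi y)) x.
Proof.
move=> dphi df; apply: (@differentiable_comp _ _ _ _ phi f) => //.
exact: differentiable_row.
Qed.

Lemma partial_comp i (phi : V -> V) f x :
  (forall e, differentiable (fun y => phi y 0 e) x) ->
  differentiable f (phi x) ->
  partial i (fun y => f (phi y)) x =
  \sum_e partial i (fun y => phi y 0 e) x * partial e f (phi x).
Proof.
move=> dphi df; have dphi' := differentiable_row dphi.
rewrite partialE; last exact: differentiable_comp_row.
rewrite (@diff_comp _ _ _ _ phi f) //= diff_row_sum //.
by apply: eq_bigr => e _; rewrite [in RHS](partialE i (dphi e)) diff_coords.
Qed.

Lemma partial_comp1 i (f : V -> R) (h : R -> R) x :
  differentiable f x -> derivable h (f x) 1 ->
  partial i (fun y => h (f y)) x = 'D_1 h (f x) * partial i f x.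
Proof.
move=> df /derivable1_diffP dh.
rewrite partialE; last exact: (@differentiable_comp _ _ _ _ f h).
rewrite (@diff_comp _ _ _ _ f h) //= partialE // (deriveE _ dh).
by rewrite -[X in 'd h _ X]mulr1 [LHS]linearZ /= mulrC.
Qed.

End Partial.

(* [pd] and [chr] are copies of [partial] and [christoffel] that conversion
   cannot unfold; comparing two distinct partial derivatives by unfolding them
   down to limits does not terminate in practice. *)
Fact pd_subproof (R : realType) (n : nat) : {f | @partial R n = f}.
Proof. by exists (@partial R n). Qed.

Definition pd (R : realType) (n : nat) := sval (pd_subproof R n).
Arguments pd {R n}.

Lemma pdE (R : realType) (n : nat) : @partial R n = pd.
Proof. exact: svalP (pd_subproof R n). Qed.

Fact chr_subproof (R : realType) (n : nat) : {f | @christoffel R n = f}.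
Proof. by exists (@christoffel R n). Qed.

Definition chr (R : realType) (n : nat) := sval (chr_subproof R n).
Arguments chr {R n}.

Lemma chrE (R : realType) (n : nat) : @christoffel R n = chr.
Proof. exact: svalP (chr_subproof R n). Qed.

(** The curvature and, below, the Schouten tensor are sealed for the same reason as [pd] and
    [chr]. *)
Fact crv_subproof (R : realType) (n : nat) : {f | @curvature R n = f}.
Proof. by exists (@curvature R n). Qed.

Definition crv (R : realType) (n : nat) := sval (crv_subproof R n).
Arguments crv {R n}.

Lemma crvE (R : realType) (n : nat) : @curvature R n = crv.
Proof. exact: svalP (crv_subproof R n). Qed.

Fact sch_subproof (R : realType) (n : nat) : {f | @schouten R n = f}.
Proof. by exists (@schouten R n). Qed.

Definition sch (R : realType) (n : nat) := sval (sch_subproof R n).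
Arguments sch {R n}.

Lemma schE (R : realType) (n : nat) : @schouten R n = sch.
Proof. exact: svalP (sch_subproof R n). Qed.

(** * Mean value theorem along lines and second differences *)

Section Lines.
Context {R : realType} {n : nat}.
Local Notation V := 'rV[R]_n.
Implicit Types (f : V -> R) (x y v : V).

Lemma diff_scale f y (t : R) v : 'd f y (t *: v) = t * 'd f y v.
Proof. exact: linearZ. Qed.

Lemma is_derive_line f y v (s : R) : differentiable f (y + s *: v) ->
  is_derive s 1 (fun s : R => f (y + s *: v)) ('d f (y + s *: v) v).
Proof.
move=> df.
have lin : is_diff s (fun s : R => y + s *: v) (fun s => s *: v).
  have := is_diffD (is_diff_cst y s) (is_diff_scalel s v).
  by move=> H; apply: is_diff_eq H _; apply/funext => u; rewrite /= !fctE add0r.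
have dl : differentiable (fun s : R => y + s *: v) s by [].
have dc : differentiable (fun s : R => f (y + s *: v)) s.
  exact: (@differentiable_comp _ _ _ _ (fun s : R => y + s *: v) f).
apply: DeriveDef; first exact/derivable1_diffP.
rewrite (deriveE _ dc) (@diff_comp _ _ _ _ (fun s : R => y + s *: v) f) //=.
by rewrite (diff_val (is_diff_def := lin)) scale1r.
Qed.

Lemma mvt_line f y v :
  (forall s, 0 <= s <= 1 -> differentiable f (y + s *: v)) ->
  exists2 s, 0 < s < 1 & f (y + v) - f y = 'd f (y + s *: v) v.
Proof.
move=> df.
have [||s] := @MVT R (fun s : R => f (y + s *: v)) (fun s : R => 'd f (y + s *: v) v) _ _ (@ltr01 R).
- move=> s; rewrite in_itv /= => /andP[s0 s1]; apply: is_derive_line.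
  by apply: df; rewrite !ltW.
- apply: derivable_within_continuous => s; rewrite in_itv /= => s01.
  by have [] := is_derive_line (df s s01).
- rewrite in_itv /= => s01; rewrite scale1r scale0r addr0 subr0 mulr1 => E.
  by exists s.
Qed.

Lemma partial_shift i f (w x : V) :
  partial i (fun y => f (y + w)) x = partial i f (x + w).
Proof.
rewrite /partial /derive; by under eq_fun do rewrite /= -addrA.
Qed.

Lemma differentiable_shift f (w x : V) : differentiable f (x + w) ->
  differentiable (fun y => f (y + w)) x.
Proof.
by move=> df; apply: (@differentiable_comp _ _ _ _ (fun y : V => y + w) f).
Qed.

Lemma mvt_partial i f x (t : R) : 0 <= t ->
  (forall s : R, 0 <= s <= t -> differentiable f (x + s *: delta_mx 0 i)) ->
  exists2 s, 0 <= s <= t & f (x + t *: delta_mx 0 i) - f x =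
    t * partial i f (x + s *: delta_mx 0 i).
Proof.
move=> t0 df; have tt (s : R) : 0 <= s <= 1 -> 0 <= s * t <= t.
  case/andP => s0 s1; apply/andP; split; first by rewrite mulr_ge0.
  by rewrite ler_piMl.
have [s s01 E] : exists2 s, 0 < s < 1 & f (x + t *: delta_mx 0 i) - f x =
    'd f (x + s *: (t *: delta_mx 0 i)) (t *: delta_mx 0 i).
  by apply: mvt_line => s s01; rewrite scalerA; exact: df (tt _ s01).
have {}s01 : 0 <= s <= 1 by case/andP: s01 => ? ?; rewrite !ltW.
exists (s * t); first exact: tt.
rewrite scalerA in E; apply: etrans E _.
apply: etrans (diff_scale _ _ _ _) _; congr (_ * _).
exact: esym (partialE i (df _ (tt _ s01))).
Qed.

(** The mean value theorem is applied twice: along [i] to the increment of [f] in direction [j],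
    then along [j] to [partial i f]. The second difference is symmetric in [i] and [j], which is
    what makes mixed derivatives comparable. *)
Lemma second_difference f x i j (t : R) :
  (forall s u : R, 0 <= s <= t -> 0 <= u <= t ->
    let y := x + s *: delta_mx 0 i + u *: delta_mx 0 j in
    differentiable f y /\ differentiable (partial i f) y) ->
  0 < t ->
  exists s u, [/\ 0 <= s <= t, 0 <= u <= t &
    f (x + t *: delta_mx 0 i + t *: delta_mx 0 j) - f (x + t *: delta_mx 0 i)
    - (f (x + t *: delta_mx 0 j) - f x) =
    t ^+ 2 * partial j (partial i f) (x + s *: delta_mx 0 i + u *: delta_mx 0 j)].
Proof.
move=> df t0; set ei : V := delta_mx 0 i; set ej : V := delta_mx 0 j.
have t1 : 0 <= t <= t by rewrite lexx ltW.
have z1 : (0 : R) <= 0 <= t by rewrite lexx ltW.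
have df1 (s : R) : 0 <= s <= t -> differentiable f (x + s *: ei).
  by move=> s1; have [] := df s 0 s1 z1; rewrite scale0r addr0.
have df2 (s : R) : 0 <= s <= t ->
    differentiable (fun y => f (y + t *: ej)) (x + s *: ei).
  by move=> s1; apply: differentiable_shift; have [] := df s t s1 t1.
pose g y := f (y + t *: ej) - f y.
have [s st] : exists2 s, 0 <= s <= t & g (x + t *: ei) - g x =
    t * partial i g (x + s *: ei).
  by apply: mvt_partial => [|s s1]; [exact: ltW|apply: dfD; [exact: df2|apply: dfN; exact: df1]].
have -> : partial i g (x + s *: ei) =
    partial i f (x + s *: ei + t *: ej) - partial i f (x + s *: ei).
  rewrite -(partial_shift i f); have := df2 _ st; have := df1 _ st.
  by move=> d1 d2; rewrite /g partialD ?partialN //; exact: dfN.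
have [u ut ->] : exists2 u, 0 <= u <= t &
    partial i f (x + s *: ei + t *: ej) - partial i f (x + s *: ei) =
    t * partial j (partial i f) (x + s *: ei + u *: ej).
  by apply: mvt_partial => [|u u1]; [exact: ltW|have [] := df _ _ st u1].
by move=> E; exists s, u; split => //; rewrite -/(g (x + t *: ei)) -/(g x) E mulrA expr2.
Qed.

End Lines.

Opaque partial.

(** * Smooth functions on an open set: symmetry of second derivatives and closure properties *)

Section Smooth.
Context {R : realType} {n : nat}.
Local Notation V := 'rV[R]_n.
Variable U : set V.
Hypothesis oU : open U.
Implicit Types (f g : V -> R) (x : V) (i : 'I_n).

Lemma smooth_diff f x : smooth_on U f -> U x -> differentiable f x.
Proof. by move=> sf Ux; exact: (sf [::]). Qed.

Lemma smooth_partial f i : smooth_on U f -> smooth_on U (partial i f).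
Proof.
by move=> sf s x Ux; have := sf (rcons s i) x Ux; rewrite /iter_partial foldr_rcons.
Qed.

Lemma eq_dist_le (e a b c d : R) : c = d -> `|a - c| < e / 2 ->
  `|b - d| < e / 2 -> `|a - b| <= e.
Proof.
move=> <- ac bc; have -> : a - b = (a - c) - (b - c) by ring.
by apply: le_trans (ler_normB _ _) _; lra.
Qed.

(** On a small square one second difference equals [t ^+ 2] times either mixed derivative, each at
    some point of the square. Both mixed derivatives are continuous at [x], so their values at [x]
    differ by at most any given [e]. *)
Lemma partial_comm f i j x : smooth_on U f -> U x ->
  partial i (partial j f) x = partial j (partial i f) x.
Proof.
move=> sf Ux.
have c1 : {for x, continuous (partial i (partial j f))}.
  by apply: differentiable_continuous; exact: (sf [:: i; j]).
have c2 : {for x, continuous (partial j (partial i f))}.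
  by apply: differentiable_continuous; exact: (sf [:: j; i]).
apply/subr0_eq/eqP; rewrite -normr_le0; apply/ler_addgt0Pr => e e0; rewrite add0r.
have e2 : 0 < e / 2 by rewrite divr_gt0.
move/cvgrPdist_lt : c1 => /(_ _ e2) n1.
move/cvgrPdist_lt : c2 => /(_ _ e2) n2.
have n3 : \forall y \near x, U y by exact: open_nbhs_nbhs.
have [r r0 Br] : exists2 r : R, 0 < r & forall y, `|x - y| < r ->
   [/\ U y, `|partial i (partial j f) x - partial i (partial j f) y| < e / 2 &
     `|partial j (partial i f) x - partial j (partial i f) y| < e / 2].
  have n123 := filterI n3 (filterI n1 n2).
  case: ((nbhs_ballP _ _).1 (n123 _ _)) => r r0 Hr.
  exists r => [|y xy]; first exact: r0.
  have By : ball x r y by rewrite mx_norm_ball; exact: xy.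
  by have [h1 [h2 h3]] := Hr y By; split; [exact: h1|exact: h2|exact: h3].
(* Two steps of length at most [r / 4] stay within distance [r / 2], hence strictly inside the ball
   of radius [r]. *)
have close k l s u : 0 <= s <= r / 4 -> 0 <= u <= r / 4 ->
    `|x - (x + s *: delta_mx 0 k + u *: delta_mx 0 l)| < r.
  move=> /andP[s0 s1] /andP[u0 u1].
  rewrite -addrA opprD addrA subrr add0r normrN.
  have nd (m : 'I_n) : `|delta_mx 0 m : V| <= 1.
    rewrite [leLHS]/Num.Def.normr /= mx_normrE; apply: bigmax_le => // -[a b] _ /=.
    by rewrite mxE; case: (_ && _); rewrite ?normr1 ?normr0.
  apply: le_lt_trans (ler_normD _ _) _; rewrite !normrZ (ger0_norm s0) (ger0_norm u0).
  have : s * `|delta_mx 0 k : V| <= s * 1 by rewrite ler_wpM2l.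
  have : u * `|delta_mx 0 l : V| <= u * 1 by rewrite ler_wpM2l.
  by move: r0 s1 u1; lra.
have r4 : 0 < r / 4 by rewrite divr_gt0.
have smd k l s u : 0 <= s <= r / 4 -> 0 <= u <= r / 4 ->
    let y := x + s *: delta_mx 0 k + u *: delta_mx 0 l in
    differentiable f y /\ differentiable (partial k f) y.
  move=> s1 u1 /=; have [Uy _ _] := Br _ (close k l _ _ s1 u1).
  by split; [exact: (sf [::])|exact: (sf [:: k])].
have [s [u [s1 u1 E1]]] := second_difference (smd i j) r4.
have [u' [s' [u1' s1' E2]]] := second_difference (smd j i) r4.
have [_ _ B1] := Br _ (close i j _ _ s1 u1).
have [_ B2 _] := Br _ (close j i _ _ u1' s1').
have r2 : (r / 4) ^+ 2 != 0 by rewrite expf_neq0 // lt0r_neq0.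
have E : partial j (partial i f) (x + s *: delta_mx 0 i + u *: delta_mx 0 j) =
    partial i (partial j f) (x + u' *: delta_mx 0 j + s' *: delta_mx 0 i).
  apply: (mulfI r2); apply: etrans (esym E1) _; apply: etrans _ E2.
  by rewrite (addrAC x); ring.
exact: eq_dist_le (esym E) B2 B1.
Qed.

(** Coinduction principle for smoothness: a class of differentiable functions that is stable under
    partial derivatives, up to equality on [U], consists of smooth functions. It replaces Leibniz
    formulas for iterated derivatives. *)
Lemma smooth_coind (P : (V -> R) -> Prop) :
  (forall f x, P f -> U x -> differentiable f x) ->
  (forall f i, P f -> exists2 g, P g & forall x, U x -> partial i f x = g x) ->
  forall f, P f -> smooth_on U f.
Proof.
(* The last index of [s] is the one applied to [f] first, so the induction peels it off. *)
move=> Pd Pp f + s; elim/last_ind: s f => [|s i IH] f Pf x Ux; first exact: Pd.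
rewrite /iter_partial foldr_rcons; have [g Pg fg] := Pp _ i Pf.
have : forall y, U y -> iter_partial s g y = iter_partial s (partial i f) y.
  elim: s {IH} => [|k s IHs] y Uy /=; first by rewrite fg.
  exact: partial_open IHs Uy.
by move=> E; apply: (differentiable_open oU E Ux); exact: (IH _ Pg _ Ux).
Qed.

Lemma smooth_eq f g : (forall x, U x -> f x = g x) ->
  smooth_on U f -> smooth_on U g.
Proof.
move=> fg sf; apply: (smooth_coind
  (P := fun h => exists2 k, smooth_on U k & forall x, U x -> k x = h x)).
- by move=> h x [k sk kh] Ux; apply: (differentiable_open oU kh Ux); exact: (smooth_diff sk Ux).
- move=> h i [k sk kh]; exists (partial i k).
    by exists (partial i k) => //; exact: smooth_partial.
  by move=> x Ux; apply/esym; exact: partial_open kh Ux.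
- by exists f.
Qed.

(** The algebra generated by the smooth functions, with inverses, is stable under partial
    derivatives; it is the class to which [smooth_coind] is applied, and all closure properties
    follow at once. *)
Inductive smooth_alg : (V -> R) -> Prop :=
| Alg_base f : smooth_on U f -> smooth_alg f
| Alg_cst a : smooth_alg (fun=> a)
| Alg_add f g : smooth_alg f -> smooth_alg g -> smooth_alg (fun x => f x + g x)
| Alg_mul f g : smooth_alg f -> smooth_alg g -> smooth_alg (fun x => f x * g x)
| Alg_inv f : smooth_alg f -> (forall x, U x -> f x != 0) ->
    smooth_alg (fun x => (f x)^-1).

Lemma smooth_algP f : smooth_alg f -> smooth_on U f.
Proof.
have ad g x : smooth_alg g -> U x -> differentiable g x.
  move=> ag Ux; elim: ag => {g} [g /smooth_diff|a|g h _ + _|g h _ + _|g _ + g0].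
  - exact.
  - exact: dfcst.
  - exact: dfD.
  - exact: dfM.
  - by move=> dg; apply: dfV => //; exact: g0.
apply: smooth_coind; first by move=> g x; exact: ad.
move=> {}f i af.
elim: af => {f} [f sf|a|f g af [f' af' Ef] ag [g' ag' Eg]|
  f g af [f' af' Ef] ag [g' ag' Eg]|f af [f' af' Ef] f0].
- by exists (partial i f) => //; apply: Alg_base; exact: smooth_partial.
- exists (fun=> 0); first exact: Alg_cst.
  by move=> x _; exact: partial_cst.
- exists (fun x => f' x + g' x); first exact: Alg_add.
  by move=> x Ux; rewrite partialD ?Ef ?Eg //; exact: ad.
- exists (fun x => f' x * g x + f x * g' x).
    by apply: Alg_add; exact: Alg_mul.
  by move=> x Ux; rewrite partialM ?Ef ?Eg //; exact: ad.
(* The sign is a constant factor because the algebra has no constructor for the opposite. *)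
- exists (fun x => -1 * (f x)^-1 * (f x)^-1 * f' x).
    apply: Alg_mul => //; apply: Alg_mul; last exact: Alg_inv.
    by apply: Alg_mul; [exact: Alg_cst|exact: Alg_inv].
  by move=> x Ux; rewrite partialV ?Ef ?mulN1r//; [exact: ad|exact: f0].
Qed.

Lemma smooth_cst (a : R) : smooth_on U (fun=> a).
Proof. exact/smooth_algP/Alg_cst. Qed.

Lemma smoothD f g : smooth_on U f -> smooth_on U g ->
  smooth_on U (fun x => f x + g x).
Proof. by move=> sf sg; apply/smooth_algP/Alg_add; exact: Alg_base. Qed.

Lemma smoothM f g : smooth_on U f -> smooth_on U g ->
  smooth_on U (fun x => f x * g x).
Proof. by move=> sf sg; apply/smooth_algP/Alg_mul; exact: Alg_base. Qed.

Lemma smoothV f : smooth_on U f -> (forall x, U x -> f x != 0) ->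
  smooth_on U (fun x => (f x)^-1).
Proof. by move=> sf f0; apply/smooth_algP/Alg_inv => //; exact: Alg_base. Qed.

Lemma smoothN f : smooth_on U f -> smooth_on U (fun x => - f x).
Proof.
move=> sf; have := smoothM (smooth_cst (-1)) sf.
by under eq_fun do rewrite mulN1r.
Qed.

Lemma smoothB f g : smooth_on U f -> smooth_on U g ->
  smooth_on U (fun x => f x - g x).
Proof. by move=> sf sg; apply: smoothD => //; exact: smoothN. Qed.

Lemma smooth_sum (I : Type) (r : seq I) (P : pred I) (F : I -> V -> R) :
  (forall k, P k -> smooth_on U (F k)) ->
  smooth_on U (fun x => \sum_(i <- r | P i) F i x).
Proof.
move=> sF; elim: r => [|k r IH].
  by under eq_fun do rewrite big_nil; exact: smooth_cst.
case: (boolP (P k)) => [Pk|/negbTE nPk]; last first.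
  by under eq_fun do rewrite big_cons nPk.
by under eq_fun do rewrite big_cons Pk; apply: smoothD => //; exact: sF.
Qed.

Lemma smooth_prod (I : Type) (r : seq I) (P : pred I) (F : I -> V -> R) :
  (forall k, P k -> smooth_on U (F k)) ->
  smooth_on U (fun x => \prod_(i <- r | P i) F i x).
Proof.
move=> sF; elim: r => [|k r IH].
  by under eq_fun do rewrite big_nil; exact: smooth_cst.
case: (boolP (P k)) => [Pk|/negbTE nPk]; last first.
  by under eq_fun do rewrite big_cons nPk.
by under eq_fun do rewrite big_cons Pk; apply: smoothM => //; exact: sF.
Qed.

Lemma smooth_det k (A : V -> 'M[R]_k) :
  (forall a b, smooth_on U (fun x => A x a b)) -> smooth_on U (fun x => \det (A x)).
Proof.
move=> sA; apply: smooth_sum => s _; apply: smoothM; first exact: smooth_cst.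
by apply: smooth_prod => i _; exact: sA.
Qed.

(** Cramer's formula: the entries are cofactors divided by the determinant. *)
Lemma smooth_invmx k (A : V -> 'M[R]_k) a b :
  (forall a b, smooth_on U (fun x => A x a b)) ->
  (forall x, U x -> A x \in unitmx) ->
  smooth_on U (fun x => invmx (A x) a b).
Proof.
move=> sA uA.
apply: (@smooth_eq (fun x => (\det (A x))^-1 * cofactor (A x) b a)).
  by move=> x /uA ux; rewrite /invmx ux !mxE.
apply: smoothM; first apply: smoothV; first exact: smooth_det.
  by move=> x /uA; rewrite unitmxE unitfE.
rewrite /cofactor; apply: smoothM; first exact: smooth_cst.
apply: smooth_det => c d.
by have := sA (lift b c) (lift a d); apply: smooth_eq => x _; rewrite !mxE.
Qed.

End Smooth.

(** * Ordinary differential equations *)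

Section GeometricLimit.
Context {R : realType}.

Lemma halving_small (C e : R) : 0 < e -> exists k, C / 2 ^+ k < e.
Proof.
move=> e0; exists (Num.bound `|C / e|); set k := Num.bound _.
have Ck : C / e < k%:R.
  by apply: le_lt_trans (ler_norm _) (archi_boundP (normr_ge0 _)).
have k2 : (k%:R : R) <= 2 ^+ k by rewrite -natrX ler_nat ltnW // ltn_expl.
rewrite ltr_pdivrMr ?exprn_gt0 // mulrC -ltr_pdivrMr //.
exact: lt_le_trans Ck k2.
Qed.

Lemma le_halving (C x y : R) : (forall k, x <= y + C / 2 ^+ k) -> x <= y.
Proof.
move=> H; rewrite leNgt; apply/negP => yx.
have [|k] := @halving_small C (x - y); first by rewrite subr_gt0.
by have := H k; lra.
Qed.

(** The sequences [a k - 2 * C / 2 ^+ k] and [a k + 2 * C / 2 ^+ k] are nondecreasing and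
    nonincreasing and enclose a common limit, obtained as the supremum of the first one. *)
Lemma halving_limit (C : R) (a : nat -> R) :
  (forall k, `|a k.+1 - a k| <= C / 2 ^+ k) ->
  exists l, forall k, `|a k - l| <= 2 * C / 2 ^+ k.
Proof.
move=> aC; pose u k := a k - 2 * C / 2 ^+ k; pose v k := a k + 2 * C / 2 ^+ k.
have half k : 2 * C / 2 ^+ k.+1 = C / 2 ^+ k.
  by rewrite exprS invfM mulrACA mulfV // mul1r.
have C0 k : 0 <= C / 2 ^+ k by exact: le_trans (aC k).
have uS k : u k <= u k.+1.
  rewrite /u half -mulrA; have := aC k; move: (C0 k).
  by rewrite ler_norml; move: (C / _) => c c0 /andP[]; lra.
have vS k : v k.+1 <= v k.
  rewrite /v half -mulrA; have := aC k; move: (C0 k).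
  by rewrite ler_norml; move: (C / _) => c c0 /andP[]; lra.
have uD k m : u k <= u (k + m)%N.
  by elim: m => [|m IH]; rewrite ?addn0 // addnS; exact: le_trans IH _.
have vD k m : v (k + m)%N <= v k.
  by elim: m => [|m IH]; rewrite ?addn0 // addnS; exact: le_trans _ IH.
have uv k m : u k <= v m.
  apply: le_trans (uD k m) _; rewrite addnC; apply: le_trans _ (vD m k).
  by rewrite /u /v; have := C0 (m + k)%N; rewrite -!mulrA; move: (C / _) => c; lra.
have ub m : ubound (range u) (v m) by move=> _ [k _ <-]; exact: uv.
exists (sup (range u)) => k; rewrite ler_norml; apply/andP; split.
  have : sup (range u) <= v k by apply: ge_sup; [exists (u 0%N), 0%N|exact: ub].
  by rewrite /v; lra.
have : u k <= sup (range u).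
  by apply: ub_le_sup; [exists (v 0%N); exact: ub|exists k].
by rewrite /u; lra.
Qed.

End GeometricLimit.

Section Primitive.
Context {R : realType}.

(** The Lebesgue integral from [- b], shifted by a constant so as to vanish at 0. *)
Lemma exists_primitive (f : R -> R) (b : R) : 0 < b -> continuous f ->
  exists P : R -> R, P 0 = 0 /\ forall t : R, `|t| < b -> is_derive t 1 P (f t).
Proof.
move=> b0 cf; pose F y := parameterized_integral (@lebesgue_measure R) (- b) y f.
exists (fun t => F t - F 0); split; first by rewrite subrr.
move=> t; rewrite ltr_norml => /andP[bt tb].
have int : (@lebesgue_measure R).-integrable `[- b, b] (EFin \o f).
  apply: continuous_compact_integrable; first exact: segment_compact.
  by apply: continuous_subspaceT => x; exact: cf.
have [dF F'] := continuous_FTC1_closed tb int bt (cf t).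
have iF : is_derive t 1 F (f t) by rewrite -F' derive1E; exact: DeriveDef.
have := is_deriveB iF (is_derive_cst (F 0) t 1).
by rewrite subr0.
Qed.

End Primitive.

(** * Picard iteration for a globally Lipschitz vector field *)

Section Picard.
Context {R : realType} {K : finType}.
Variables (F : (K -> R) -> K -> R) (L : R) (y0 : K -> R).
Hypothesis L0 : 0 < L.
Hypothesis lipF : forall x y C, (forall j, `|x j - y j| <= C) ->
  forall i, `|F x i - F y i| <= L * C.

(** With this life time the integral operator contracts by the factor [L * T], that is 1/2. *)
Let T := (2 * L)^-1.

Let T0 : 0 < T. Proof. by rewrite invr_gt0 mulr_gt0. Qed.

(** Freezing the time outside [[-T, T]] makes all iterates continuous functions on the whole line
    with uniform bounds, so no function space over an interval is needed. *)
Let clamp (t : R) := Order.max (- T) (Order.min t T).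

Let clamp_le t : `|clamp t| <= T.
Proof.
rewrite ler_norml /clamp le_max lexx ge_max ge_min lexx orbT andbT /=.
by have := T0; lra.
Qed.

Let clampK t : `|t| <= T -> clamp t = t.
Proof.
rewrite ler_norml => /andP[t1 t2]; rewrite /clamp.
by rewrite (min_idPl t2) (max_idPr t1).
Qed.

Let clamp_continuous : continuous clamp.
Proof.
have -> : clamp = (cst (- T) : R -> R^o) \max ((id : R -> R^o) \min cst T) by [].
move=> t; apply: continuous_max; first exact: cst_continuous.
by apply: continuous_min; [exact: id|exact: cst_continuous].
Qed.

Definition coord_continuous_path (y : R -> K -> R) := forall i, continuous (y^~ i).

Lemma lipschitz_path_continuous y i : coord_continuous_path y ->
  continuous (fun s => F (y s) i).
Proof.
move=> cy s; apply/cvgrPdist_lt => e e0.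
have e1 : 0 < e / (2 * L) by rewrite divr_gt0 // mulr_gt0.
have H : \forall t \near s, forall j, `|y s j - y t j| < e / (2 * L).
  apply: (@filter_forall R K (fun j t => `|y s j - y t j| < e / (2 * L)) (nbhs s) _) => j.
  by move: (cy j s) => /cvgrPdist_lt; apply.
apply: filterS H => t H.
apply: le_lt_trans (lipF (fun j => ltW (H j)) i) _.
have -> : L * (e / (2 * L)) = e / 2 by field; rewrite gt_eqF.
by rewrite ltr_pdivrMr // ltr_pMr // ltr1n.
Qed.

(** A primitive chosen on the interval of radius [2 * T], twice the life time, so that it is
    derivable at the end points of [[-T, T]] too. The default is never taken for continuous [f]. *)
Let prim (f : R -> R) : R -> R :=
  xget (fun=> 0) [set P | P 0 = 0 /\ forall t : R, `|t| < 2 * T -> is_derive t 1 P (f t)].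

Let primP f : continuous f -> prim f 0 = 0 /\
  forall t : R, `|t| < 2 * T -> is_derive t 1 (prim f) (f t).
Proof.
move=> cf; rewrite /prim; case: xgetP => [P -> //|noP].
have [|P HP] := @exists_primitive R f (2 * T) _ cf; first by rewrite mulr_gt0.
by have := noP P HP.
Qed.

Let small_time t : `|clamp t| < 2 * T.
Proof. by apply: le_lt_trans (clamp_le t) _; have := T0; lra. Qed.

(** The mean value theorem plays the role of the estimate of an integral by its length times the
    supremum; the three cases are the signs of the clamped time. *)
Let mvt_bound (h f : R -> R) c t : h 0 = 0 ->
  (forall s : R, `|s| <= T -> is_derive s 1 h (f s)) ->
  (forall s, `|f s| <= c) -> `|h (clamp t)| <= c * T.
Proof.
move=> h0 dh fc; set a := clamp t; have aT : `|a| <= T := clamp_le t.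
have ch (I : interval R) : {in I, forall s, `|s| <= T} ->
    {within [set` I], continuous h}.
  by move=> IT; apply: derivable_within_continuous => s /IT /dh [].
have [s ->] : exists s, h a = f s * a.
  have [a0|a0|a0] := ltgtP a 0.
  - have st s : s \in `[a, 0] -> `|s| <= T.
      rewrite in_itv /= => /andP[s1 s2]; apply: le_trans aT.
      by rewrite (ler0_norm s2) (ltr0_norm a0) lerN2.
    have [s|s _] := @MVT R h f _ _ a0 _ (ch _ st).
      by move=> /subset_itv_oo_cc /st /dh.
    by rewrite h0 !sub0r mulrN => /oppr_inj ->; exists s.
  - have st s : s \in `[0, a] -> `|s| <= T.
      rewrite in_itv /= => /andP[s1 s2]; apply: le_trans aT.
      by rewrite (ger0_norm s1) (gtr0_norm a0).
    have [s|s _] := @MVT R h f _ _ a0 _ (ch _ st).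
      by move=> /subset_itv_oo_cc /st /dh.
    by rewrite h0 !subr0 => ->; exists s.
  - by exists 0; rewrite a0 h0 mulr0.
by rewrite normrM ler_pM.
Qed.

Let in_domain (s : R) : `|s| <= T -> `|s| < 2 * T.
Proof. by move=> sT; apply: le_lt_trans sT _; have := T0; lra. Qed.

Let prim_bound f g c t : continuous f -> continuous g ->
  (forall s, `|f s - g s| <= c) -> `|prim f (clamp t) - prim g (clamp t)| <= c * T.
Proof.
move=> /primP[f0 fP] /primP[g0 gP].
apply: (@mvt_bound (fun s => prim f s - prim g s) (fun s => f s - g s)).
  by rewrite f0 g0 subrr.
by move=> s /in_domain sT; apply: is_deriveB; [exact: fP|exact: gP].
Qed.

(** The integral operator of the initial value problem, whose fixed points solve it for times below
    [T]. *)
Let step (y : R -> K -> R) : R -> K -> R :=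
  fun t i => y0 i + prim (fun s => F (y s) i) (clamp t).

Let step_continuous y : coord_continuous_path y -> coord_continuous_path (step y).
Proof.
move=> cy i t; have [_ dP] := primP (@lipschitz_path_continuous _ i cy).
apply: cvgD; first exact: cvg_cst.
apply: (@continuous_comp _ _ _ clamp (prim _)); first exact: clamp_continuous.
have [/derivable1_diffP d _] := dP _ (small_time t).
exact: differentiable_continuous.
Qed.

Let step_contract y z C : coord_continuous_path y -> coord_continuous_path z ->
  (forall t i, `|y t i - z t i| <= C) -> forall t i, `|step y t i - step z t i| <= C / 2.
Proof.
move=> cy cz yz t i; rewrite /step opprD addrACA subrr add0r.
have -> : C / 2 = L * C * T.
  by rewrite /T; field; rewrite gt_eqF.
apply: prim_bound => [| |s]; try exact: lipschitz_path_continuous.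
by apply: lipF => j; exact: yz.
Qed.

Let iterates k := iter k step (fun _ => y0).

Let iterates_continuous k : coord_continuous_path (iterates k).
Proof.
elim: k => [|k IH]; last exact: step_continuous.
by move=> i; exact: cst_continuous.
Qed.

(** The iterates start from the constant path [y0] and their successive distances are halved, so
    they converge uniformly. The limit is continuous and is a fixed point of [step]; differentiating
    the fixed point equation where the clamp is inactive gives the differential equation. *)
Theorem picard : exists2 T : R, 0 < T & exists y : R -> K -> R,
  [/\ y 0 = y0, coord_continuous_path y &
      forall t : R, `|t| < T -> forall i, is_derive t 1 (y^~ i) (F (y t) i)].
Proof.
exists T => //.
(* The sum over all coordinates bounds the first step in each of them. *)
pose C := \sum_i `|F y0 i| * T.
have first t i : `|iterates 1 t i - iterates 0 t i| <= C.
  rewrite /= /step addrC addKr.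
  have cF : continuous (fun _ : R => F y0 i) by exact: cst_continuous.
  have [p0 dp] := primP cF.
  have H := @mvt_bound _ (fun=> F y0 i) `|F y0 i| t p0
    (fun s sT => dp s (in_domain sT)) (fun=> lexx _).
  apply: le_trans H _.
  rewrite /C (bigD1 i) //= lerDl sumr_ge0 // => j _.
  by rewrite mulr_ge0 // ltW.
have close k t i : `|iterates k.+1 t i - iterates k t i| <= C / 2 ^+ k.
  elim: k t i => [|k IH] t i; first by rewrite expr0 divr1.
  rewrite exprS invfM mulrCA mulrC.
  apply: (@step_contract (iterates k.+1) (iterates k)) IH t i.
    exact: (@iterates_continuous k.+1).
  exact: (@iterates_continuous k).
have lims t i : {l | forall k, `|iterates k t i - l| <= 2 * C / 2 ^+ k}.
  by apply/cid/halving_limit => k; exact: close.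
pose y t i := sval (lims t i).
have yP k t i : `|iterates k t i - y t i| <= 2 * C / 2 ^+ k := svalP (lims t i) k.
have cy : coord_continuous_path y.
  move=> i s; apply/cvgrPdist_lt => e e0.
  have e3 : 0 < e / 3 by rewrite divr_gt0.
  have [k ke] := halving_small (2 * C) e3.
  move: (@iterates_continuous k i s) => /cvgrPdist_lt /(_ _ e3).
  apply: filterS => t st.
  have := yP k s i; have := yP k t i; move: st ke.
  move: (iterates k s i) (iterates k t i) (y s i) (y t i) => a b a' b'.
  move: (2 * C / _) => c; rewrite !ltr_norml !ler_norml.
  move=> /andP[? ?] ? /andP[? ?] /andP[? ?].
  by apply/andP; split; lra.
(* Both sides are compared with the iterate of index [k.+1], which is [step] of the iterate of index
   [k]; each distance is at most half of [2 * C / 2 ^+ k]. *)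
have fixed t i : step y t i = y t i.
  apply/eqP; rewrite -subr_eq0 -normr_le0; apply: (@le_halving _ (2 * C)) => k.
  rewrite add0r.
  have := @step_contract y (iterates k) (2 * C / 2 ^+ k) cy (@iterates_continuous k).
  move=> /(_ _ t i) H.
  have {}H : `|step y t i - step (iterates k) t i| <= 2 * C / 2 ^+ k / 2.
    by apply: H => s j; rewrite distrC; exact: yP.
  have := yP k.+1 t i; rewrite [iterates k.+1]iterS -/(iterates k).
  rewrite exprS invfM mulrCA; move: H.
  move: (step y t i) (step (iterates k) t i) (y t i) (2 * C / _) => a b c d H1 H2.
  by rewrite -[a - c](subrKA b); apply: le_trans (ler_normD _ _) _; lra.
exists y; split => //.
- apply/funext => i; rewrite -fixed /step clampK ?normr0 ?ltW //.
  by rewrite (primP (@lipschitz_path_continuous _ i cy)).1 addr0.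
- move=> t tT i.
  have [_ dP] := primP (@lipschitz_path_continuous _ i cy).
  have tT2 : `|t| < 2 * T by apply: lt_trans tT _; have := T0; lra.
  have := is_deriveD (is_derive_cst (y0 i) t 1) (dP t tT2); rewrite add0r.
  apply: near_eq_is_derive.
  have tn : \forall s \near t, `|s| < T.
    by have := @norm_continuous R R t => /cvgr_lt; apply.
  by apply: filterS tn => s sT; rewrite -fixed /step clampK // ltW.
Qed.

End Picard.

(** * The Levi-Civita connection *)

Section DeterminantDerivative.
Context {R : realType} {n : nat}.
Local Notation V := 'rV[R]_n.

Lemma partial_prod (I : finType) a (F : I -> V -> R) x :
  (forall i, differentiable (F i) x) ->
  partial a (fun y => \prod_i F i y) x =
  \sum_i partial a (F i) x * \prod_(j | j != i) F j x.
Proof.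
move=> dF.
have H (r : seq I) : uniq r -> partial a (fun y => \prod_(i <- r) F i y) x =
    \sum_(i <- r) partial a (F i) x * \prod_(j <- r | j != i) F j x.
  elim: r => [_|i r IH /= /andP[ir ur]].
    by rewrite big_nil; under eq_fun do rewrite big_nil; exact: partial_cst.
  under eq_fun do rewrite big_cons.
  rewrite partialM //; last by apply: df_prod.
  rewrite IH // !big_cons eqxx /=; congr (_ * _ + _).
    rewrite [RHS]big_seq_cond [LHS]big_seq; apply: eq_bigl => j.
    by case: eqVneq => [->|_]; rewrite ?(negPf ir) ?andbT.
  rewrite mulr_sumr !big_seq; apply: eq_bigr => j jr.
  rewrite big_cons; case: eqVneq => [ij|_]; first by rewrite -ij (negPf ir) in jr.
  by rewrite mulrCA.
exact: H (index_enum_uniq I).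
Qed.

Lemma partial_det k (A : V -> 'M[R]_k) a x :
  (forall i j, differentiable (fun y => A y i j) x) ->
  partial a (fun y => \det (A y)) x =
  \sum_i \sum_j partial a (fun y => A y i j) x * cofactor (A x) i j.
Proof.
move=> dA.
(* The derivative is the sum of the determinants in which a single row has been differentiated; each
   is then expanded along that row. *)
pose B i := \matrix_(k', j)
  if k' == i then partial a (fun y => A y i j) x else A x k' j.
transitivity (\sum_i \det (B i)).
  rewrite /determinant partial_sum; last first.
    by move=> s _; apply: dfM; [exact: dfcst|apply: df_prod => i _; exact: dA].
  rewrite exchange_big /=; apply: eq_bigr => s _.
  rewrite partialZ; last by apply: df_prod => i _; exact: dA.
  rewrite (partial_prod a (F := fun i y => A y i (s i))) // mulr_sumr.
  apply: eq_bigr => i _; congr (_ * _); rewrite [RHS](bigD1 i) //= mxE eqxx.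
  congr (_ * _); apply: eq_bigr => j /negPf ji; by rewrite mxE ji.
apply: eq_bigr => i _; rewrite (expand_det_row _ i); apply: eq_bigr => j _.
rewrite mxE eqxx; congr (_ * _); rewrite /cofactor; congr (_ * \det _).
by apply/matrixP => c d; rewrite !mxE eq_sym (negPf (neq_lift _ _)).
Qed.

(** Jacobi's formula for the logarithmic derivative of a determinant. *)
Lemma partial_det_trace k (A : V -> 'M[R]_k) a x :
  (forall i j, differentiable (fun y => A y i j) x) -> A x \in unitmx ->
  partial a (fun y => \det (A y)) x =
  \det (A x) * \sum_i \sum_j partial a (fun y => A y i j) x * invmx (A x) j i.
Proof.
move=> dA uA; rewrite partial_det // mulr_sumr; apply: eq_bigr => i _.
rewrite mulr_sumr; apply: eq_bigr => j _.
rewrite /invmx uA !mxE [RHS]mulrCA mulVKf //.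
by move: uA; rewrite unitmxE unitfE.
Qed.

(** The squared determinant is positive, so its real power is differentiable, and Jacobi's formula
    gives the logarithmic derivative [2c tr (A^-1 dA)]. *)
Lemma partial_density_factor k (A : V -> 'M[R]_k) a c x :
  (forall i j, differentiable (fun y => A y i j) x) -> A x \in unitmx ->
  differentiable (fun y => ((\det (A y)) ^+ 2) `^ c) x /\
  partial a (fun y => ((\det (A y)) ^+ 2) `^ c) x =
  2 * c * (\sum_i \sum_j partial a (fun y => A y i j) x * invmx (A x) j i)
  * ((\det (A x)) ^+ 2) `^ c.
Proof.
move=> dA uA.
have d0 : \det (A x) != 0 by move: uA; rewrite unitmxE unitfE.
have d2 : 0 < (\det (A x)) ^+ 2 by rewrite exprn_even_gt0.
have dd : differentiable (fun y => \det (A y)) x.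
  apply: df_sum => s _; apply: dfM; first exact: dfcst.
  by apply: df_prod => i _; exact: dA.
have dd2 : differentiable (fun y => (\det (A y)) ^+ 2) x.
  by under eq_fun do rewrite expr2; exact: dfM.
have [dp pE] := is_derive1_powR c d2.
split.
  apply: (@differentiable_comp _ _ _ _ (fun y => (\det (A y)) ^+ 2) (fun b => b `^ c)) => //.
  exact/derivable1_diffP.
rewrite (partial_comp1 a dd2 dp) pE.
under [X in partial a X]eq_fun do rewrite expr2.
rewrite partialM // partial_det_trace //; set s := \sum_i _.
rewrite powRB; last by rewrite (gt_eqF d2) implybT.
rewrite powRr1; last exact: ltW.
by field.
Qed.

End DeterminantDerivative.

(** * Entrywise derivatives of matrix-valued functions *)

Section MatrixPartial.
Context {R : realType} {n : nat}.
Local Notation V := 'rV[R]_n.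

Definition dmx m k (a : 'I_n) (A : V -> 'M[R]_(m, k)) (x : V) : 'M[R]_(m, k) :=
  \matrix_(i, j) pd a (fun y => A y i j) x.

Definition mx_diff m k (A : V -> 'M[R]_(m, k)) x :=
  forall i j, differentiable (fun y => A y i j) x.

Lemma mx_diffM m k p (A : V -> 'M[R]_(m, k)) (B : V -> 'M[R]_(k, p)) x :
  mx_diff A x -> mx_diff B x -> mx_diff (fun y => A y *m B y) x.
Proof.
move=> dA dB i j; under eq_fun do rewrite mxE.
by apply: df_sum => l _; apply: dfM; [exact: dA|exact: dB].
Qed.

Lemma mx_diff_tr m k (A : V -> 'M[R]_(m, k)) x :
  mx_diff A x -> mx_diff (fun y => (A y)^T) x.
Proof. by move=> dA i j; under eq_fun do rewrite mxE; exact: dA. Qed.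

Lemma mx_diff_smooth (U : set V) m k (A : V -> 'M[R]_(m, k)) x :
  (forall i j, smooth_on U (fun y => A y i j)) -> U x -> mx_diff A x.
Proof. by move=> sA Ux i j; exact: smooth_diff Ux. Qed.

Lemma dmxM m k p a (A : V -> 'M[R]_(m, k)) (B : V -> 'M[R]_(k, p)) x :
  mx_diff A x -> mx_diff B x ->
  dmx a (fun y => A y *m B y) x = dmx a A x *m B x + A x *m dmx a B x.
Proof.
move=> dA dB; apply/matrixP => i j; rewrite !mxE -?pdE.
under [in LHS]eq_fun do rewrite mxE.
rewrite partial_sum; last by move=> l _; apply: dfM; [exact: dA|exact: dB].
rewrite -big_split; apply: eq_bigr => l _; rewrite !mxE -!pdE.
by rewrite partialM; [|exact: dA|exact: dB].
Qed.

Lemma dmxD m k a (A B : V -> 'M[R]_(m, k)) x :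
  mx_diff A x -> mx_diff B x ->
  dmx a (fun y => A y + B y) x = dmx a A x + dmx a B x.
Proof.
move=> dA dB; apply/matrixP => i j; rewrite !mxE -?pdE.
under [in LHS]eq_fun do rewrite mxE.
by rewrite partialD; [|exact: dA|exact: dB].
Qed.

Lemma dmx_tr m k a (A : V -> 'M[R]_(m, k)) x :
  dmx a (fun y => (A y)^T) x = (dmx a A x)^T.
Proof.
by apply/matrixP => i j; rewrite !mxE -!pdE; under [in LHS]eq_fun do rewrite mxE.
Qed.

Lemma dmx_open (U : set V) m k a (A B : V -> 'M[R]_(m, k)) x : open U ->
  (forall y, U y -> A y = B y) -> U x -> dmx a A x = dmx a B x.
Proof.
move=> oU AB Ux; apply/matrixP => i j; rewrite !mxE -?pdE.
by apply: (partial_open _ oU) Ux => y /AB ->.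
Qed.

Lemma dmx_comm (U : set V) m k a b (A : V -> 'M[R]_(m, k)) x : open U ->
  (forall i j, smooth_on U (fun y => A y i j)) -> U x ->
  dmx a (dmx b A) x = dmx b (dmx a A) x.
Proof.
move=> oU sA Ux; apply/matrixP => i j.
have E c d : dmx c (dmx d A) x i j = partial c (partial d (fun y => A y i j)) x.
  by rewrite mxE -!pdE; congr (partial c _ x); apply/funext => y; rewrite mxE -!pdE.
by rewrite (E a b) (E b a) (partial_comm oU _ _ (sA i j) Ux).
Qed.

End MatrixPartial.

(** * Metric compatibility and uniqueness of the Levi-Civita connection *)

Section LeviCivita.
Context {R : realType} {n : nat}.
Local Notation V := 'rV[R]_n.

Definition metric_on (U : set V) (G : V -> 'M[R]_n) : Prop :=
  [/\ forall i j, smooth_on U (fun y => G y i j),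
      forall x, U x -> G x \in unitmx & forall x, U x -> (G x)^T = G x].

(** The connection form in direction [k]. In this form compatibility, change of coordinates and
    curvature are matrix identities. *)
Definition connection_mx (G : V -> 'M[R]_n) (k : 'I_n) (x : V) : 'M[R]_n :=
  \matrix_(m, i) chr G x m k i.

Variables (U : set V) (G : V -> 'M[R]_n).
Hypotheses (oU : open U) (mG : metric_on U G).
Let sG : forall i j, smooth_on U (fun y => G y i j). Proof. by case: mG. Qed.
Let uG : forall x, U x -> G x \in unitmx. Proof. by case: mG. Qed.
Let symG : forall x, U x -> (G x)^T = G x. Proof. by case: mG. Qed.

Lemma metric_on_sym x i j : U x -> G x i j = G x j i.
Proof. by move=> /symG E; rewrite -[in LHS]E mxE. Qed.

Lemma partial_metric_sym k x i j : U x ->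
  partial k (fun y => G y i j) x = partial k (fun y => G y j i) x.
Proof. by apply: (partial_open k oU) => y Uy; exact: metric_on_sym. Qed.

Lemma christoffel_lower x k i j : U x ->
  \sum_m christoffel G x m k i * G x m j =
  2^-1 * (partial k (fun y => G y i j) x + partial i (fun y => G y k j) x
     - partial j (fun y => G y k i) x).
Proof.
move=> Ux; rewrite /christoffel.
set S := fun l => partial k (fun y => G y i l) x + partial i (fun y => G y k l) x
     - partial l (fun y => G y k i) x.
have inv l : \sum_m invmx (G x) m l * G x m j = (j == l)%:R.
  have /matrixP /(_ j l) := mulmxV (uG Ux); rewrite !mxE => <-.
  by apply: eq_bigr => m _; rewrite mulrC (metric_on_sym _ _ Ux).
under eq_bigr do rewrite -mulrA mulr_suml.
rewrite -mulr_sumr exchange_big /=; congr (_ * _).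
under eq_bigr => l _.
  under eq_bigr do rewrite mulrAC.
  rewrite -mulr_suml inv -/(S l).
  over.
rewrite (bigD1 j) //= eqxx mul1r big1 ?addr0 // => l /negPf lj.
by rewrite eq_sym lj mul0r.
Qed.

Lemma christoffel_sym x k i j : U x -> christoffel G x k i j = christoffel G x k j i.
Proof.
move=> Ux; rewrite /christoffel; congr (_ * _); apply: eq_bigr => l _.
by rewrite (partial_metric_sym l i j Ux) [X in X - _]addrC.
Qed.

Lemma metric_compatible k x : U x ->
  dmx k G x = (connection_mx G k x)^T *m G x + G x *m connection_mx G k x.
Proof.
move=> Ux; apply/matrixP => i j; rewrite !mxE -?pdE.
transitivity (\sum_m christoffel G x m k i * G x m j
              + \sum_m christoffel G x m k j * G x m i).
  rewrite !christoffel_lower // (partial_metric_sym k j i Ux) pdE.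
  by move: (pd _ _ _) (pd _ _ _) (pd _ _ _) => a b c; lra.
rewrite chrE; congr (_ + _); apply: eq_bigr => m _; rewrite !mxE //.
by rewrite mulrC (metric_on_sym _ _ Ux).
Qed.

(** Koszul's argument: symmetry and compatibility express the lowered coefficients through first
    derivatives of the metric, and the metric is invertible. Its use is to identify a candidate
    connection without any computation with Christoffel symbols. *)
Lemma connection_mx_unique x (A : 'I_n -> 'M[R]_n) : U x ->
  (forall k i m, A k m i = A i m k) ->
  (forall k, dmx k G x = (A k)^T *m G x + G x *m A k) ->
  forall k, A k = connection_mx G k x.
Proof.
move=> Ux symA compA k.
have low (i j : 'I_n) : \sum_m A k m i * G x m j = \sum_m christoffel G x m k i * G x m j.
  rewrite christoffel_lower //.
  pose L k i j := \sum_m A k m i * G x m j.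
  have LE a b c : partial a (fun y => G y b c) x = L a b c + L a c b.
    have /matrixP /(_ b c) := compA a; rewrite !mxE pdE => ->.
    congr (_ + _); apply: eq_bigr => m _; rewrite ?mxE //.
    by rewrite mulrC (metric_on_sym _ _ Ux).
  have Lsym a b c : L a b c = L b a c.
    by apply: eq_bigr => m _; rewrite symA.
  rewrite !LE -/(L k i j) (Lsym j k i) (Lsym j i k) (Lsym i k j).
  by lra.
have E : (A k)^T *m G x = (connection_mx G k x)^T *m G x.
  apply/matrixP => i j; rewrite !mxE -?pdE.
  transitivity (\sum_m A k m i * G x m j).
    by apply: eq_bigr => m _; rewrite mxE.
  rewrite low chrE; by apply: eq_bigr => m _; rewrite !mxE.
apply: trmx_inj; have fG : row_free (G x) by rewrite row_free_unit uG.
exact: (row_free_inj fG E).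
Qed.

Lemma smooth_christoffel k i j : smooth_on U (fun x => christoffel G x k i j).
Proof.
apply: smoothM => //; first exact: smooth_cst.
apply: smooth_sum => // l _; apply: smoothM => //; first exact: smooth_invmx.
by apply: smoothB => //; [apply: smoothD => //|]; apply: smooth_partial.
Qed.

Lemma smooth_connection_mx k i j : smooth_on U (fun x => connection_mx G k x i j).
Proof. by under eq_fun do rewrite mxE -chrE; exact: smooth_christoffel. Qed.

End LeviCivita.

(** * Christoffel symbols and covariant derivatives under a change of coordinates *)

Section Pullback.
Context {R : realType} {n : nat}.
Local Notation V := 'rV[R]_n.
Variables (U U' : set V) (phi : V -> V).
Hypotheses (oU : open U) (oU' : open U').
Hypothesis sphi : forall e, smooth_on U (fun x => phi x 0 e).
Hypothesis phiU : forall x, U x -> U' (phi x).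
Local Notation J := (jacobian_mx phi).
Hypothesis uJ : forall x, U x -> J x \in unitmx.

Lemma smooth_jacobian m j : smooth_on U (fun y => J y m j).
Proof. by under eq_fun do rewrite mxE; exact: smooth_partial (sphi m). Qed.

Lemma jacobian_diff x : U x -> mx_diff J x.
Proof. by move=> Ux m j; exact: smooth_diff (smooth_jacobian m j) Ux. Qed.

Lemma jacobian_diff_sym m i j x : U x -> dmx i J x m j = dmx j J x m i.
Proof.
move=> Ux; rewrite !mxE -!pdE.
have E k : (fun y => J y m k) = partial k (fun y => phi y 0 m).
  by apply/funext => y; rewrite mxE.
by rewrite (E i) (E j) (partial_comm oU _ _ (sphi m) Ux).
Qed.

Lemma pullback_differentiable (f : V -> R) x : U x -> differentiable f (phi x) ->
  differentiable (fun y => f (phi y)) x.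
Proof.
by move=> Ux; apply: differentiable_comp_row => e; exact: smooth_diff (sphi e) Ux.
Qed.

Lemma partial_pullback i (f : V -> R) x : U x -> differentiable f (phi x) ->
  partial i (fun y => f (phi y)) x = \sum_r J x r i * partial r f (phi x).
Proof.
move=> Ux df; rewrite partial_comp //; last by move=> e; exact: smooth_diff (sphi e) Ux.
by apply: eq_bigr => r _; rewrite mxE.
Qed.

Lemma dmx_pullback m k i (A : V -> 'M[R]_(m, k)) x : U x -> mx_diff A (phi x) ->
  dmx i (fun y => A (phi y)) x = \sum_r J x r i *: dmx r A (phi x).
Proof.
move=> Ux dA; apply/matrixP => a b; rewrite mxE summxE -pdE.
rewrite (partial_pullback i Ux (dA a b)); apply: eq_bigr => r _.
by rewrite !mxE -pdE.
Qed.

Variables G G' : V -> 'M[R]_n.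
Hypothesis mG : metric_on U G.
Hypothesis mG' : metric_on U' G'.
Hypothesis GE : forall x, U x -> G x = (J x)^T *m G' (phi x) *m J x.

(** The right-hand side multiplied by the inverse of [J] is a connection that is symmetric, because
    second derivatives of [phi] commute and the target Christoffel symbols are symmetric, and
    compatible with the pulled back metric. By uniqueness it is the Levi-Civita connection. *)
Lemma connection_pullback k x : U x ->
  J x *m connection_mx G k x =
  dmx k J x + \sum_r J x r k *: (connection_mx G' r (phi x) *m J x).
Proof.
move=> Ux; have Ux' := phiU Ux.
pose B k := dmx k J x + \sum_r J x r k *: (connection_mx G' r (phi x) *m J x).
pose A k := invmx (J x) *m B k.
have JA l : J x *m A l = B l by rewrite /A mulKVmx // uJ.
rewrite -(connection_mx_unique mG Ux (A := A)) ?JA //.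
- have Bsym l i m : B l m i = B i m l.
    rewrite /B [LHS]mxE [RHS]mxE (jacobian_diff_sym m l i Ux); congr (_ + _).
    rewrite !summxE.
    under eq_bigr => r _ do rewrite !mxE mulr_sumr.
    under [in RHS]eq_bigr => r _ do rewrite !mxE mulr_sumr.
    rewrite exchange_big /=; apply: eq_bigr => r _; apply: eq_bigr => s _.
    rewrite !mxE -chrE (christoffel_sym oU' mG' _ _ _ Ux') mulrCA.
    by rewrite [RHS]mulrCA; congr (_ * _); rewrite mulrC.
  move=> l i m; rewrite !mxE; apply: eq_bigr => j _; congr (_ * _); exact: Bsym.
- move=> l.
  have dJ := jacobian_diff Ux.
  have [sG' _ _] := mG'.
  have dG' : mx_diff G' (phi x) by exact: mx_diff_smooth sG' Ux'.
  have dG'p : mx_diff (fun y => G' (phi y)) x.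
    by move=> i j; exact: pullback_differentiable Ux (dG' i j).
  have dJt := mx_diff_tr dJ.
  have dJG := mx_diffM dJt dG'p.
  rewrite (dmx_open l oU GE Ux) (dmxM l dJG dJ) (dmxM l dJt dG'p) dmx_tr.
  rewrite dmx_pullback //.
  under eq_bigr do rewrite (metric_compatible oU' mG' _ Ux').
  set g := G' (phi x); rewrite GE // -/g.
  have -> : (A l)^T *m ((J x)^T *m g *m J x) = (J x *m A l)^T *m g *m J x.
    by rewrite (trmx_mul (J x) (A l)) !mulmxA.
  rewrite -(mulmxA _ (J x) (A l)) JA /B.
  set X := \sum_r J x r l *: (_ *m J x); set Y := \sum_r J x r l *: (_ + _).
  have XY : (J x)^T *m Y *m J x = X^T *m g *m J x + (J x)^T *m g *m X.
    rewrite /X /Y mulmx_sumr !mulmx_suml linear_sum !mulmx_suml mulmx_sumr.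
    rewrite -big_split; apply: eq_bigr => r _ /=.
    rewrite -!scalemxAr -!scalemxAl [X in X *m _ *m _]linearZ /= -!scalemxAl.
    rewrite -scalerDr; congr (_ *: _).
    by rewrite trmx_mul mulmxDr mulmxDl !mulmxA.
  rewrite linearD /= !mulmxDl !mulmxDr XY -!addrA; congr (_ + _).
  by congr (_ + _); rewrite addrC.
Qed.

Lemma christoffel_pullback m k i x : U x ->
  \sum_e J x m e * christoffel G x e k i =
  dmx k J x m i +
  \sum_r \sum_s christoffel G' (phi x) m r s * J x r k * J x s i.
Proof.
move=> Ux; have /matrixP /(_ m i) := connection_pullback k Ux.
rewrite chrE !mxE summxE => E.
transitivity (\sum_j J x m j * connection_mx G k x j i).
  by apply: eq_bigr => j _; rewrite [connection_mx _ _ _ _ _]mxE.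
rewrite E; congr (_ + _); apply: eq_bigr => r _.
rewrite !mxE mulr_sumr; apply: eq_bigr => s _; rewrite !mxE; ring.
Qed.

(** The trace of the previous law after multiplication by the inverse of [J]. Its inhomogeneous part
    is the logarithmic derivative of [det J], the term that the density factor produces when
    differentiated. *)
Lemma christoffel_trace_pullback a x : U x ->
  \sum_d christoffel G x d a d =
  \sum_i \sum_j partial a (fun y => J y i j) x * invmx (J x) j i
  + \sum_r J x r a * \sum_d christoffel G' (phi x) d r d.
Proof.
move=> Ux; rewrite chrE pdE.
have trE (H : V -> 'M[R]_n) y b : \sum_d chr H y d b d = \tr (connection_mx H b y).
  by apply: eq_bigr => d _; rewrite mxE.
rewrite trE -[connection_mx G a x](mulKmx (uJ Ux)) (connection_pullback _ Ux).
rewrite mulmxDr linearD /=; congr (_ + _).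
  rewrite mxtrace_mulC; apply: eq_bigr => i _; rewrite mxE.
  by apply: eq_bigr => j _; rewrite mxE.
rewrite mulmx_sumr linear_sum /=; apply: eq_bigr => r _.
by rewrite -scalemxAr linearZ /= mulmxA mxtrace_mulC mulmxA mulmxV ?uJ // mul1mx trE.
Qed.

Definition pulls_back (w : R) k (T T' : @components R n k) (x : V) : Prop :=
  forall s, T x s =
    ((\det (J x)) ^+ 2) `^ (- (w / (2 * n + 2)%N%:R)) *
    \sum_t (\prod_(p < k) J x (tnth t p) (tnth s p)) * T' (phi x) t.

Lemma tnth_replace_index k (s : k.-tuple 'I_n) p e q :
  tnth (replace_index s p e) q = if q == p then e else tnth s q.
Proof. by rewrite tnth_mktuple. Qed.

Lemma big_tuple_cons k (F : k.+1.-tuple 'I_n -> R) :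
  \sum_t F t = \sum_(r : 'I_n) \sum_(u : k.-tuple 'I_n) F [tuple of r :: u].
Proof.
rewrite pair_big /= (reindex (fun ru : 'I_n * k.-tuple 'I_n => [tuple of ru.1 :: ru.2])) //=.
exists (fun t => (thead t, [tuple of behead t])) => [[r u] _|t _] /=.
  by congr (_, _); apply: val_inj.
by rewrite -tuple_eta.
Qed.

(** Exchanging the entry at place [p] of the tuple with the extra index is an involution of the set
    of summation. *)
Lemma replace_index_swap k p (F : k.-tuple 'I_n -> 'I_n -> R) :
  \sum_t \sum_s F t s = \sum_u \sum_e F (replace_index u p e) (tnth u p).
Proof.
rewrite !pair_big /=.
pose h (z : k.-tuple 'I_n * 'I_n) := (replace_index z.1 p z.2, tnth z.1 p).
have hK : involutive h.
  move=> [u e]; rewrite /h /= tnth_replace_index eqxx; congr (_, _).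
  apply: eq_from_tnth => q; rewrite !tnth_replace_index.
  by case: eqVneq => [->|].
rewrite (reindex h); last by exists h => z _; exact: hK.
by apply: eq_bigr => -[u e].
Qed.

Lemma nabla_cons (H : V -> 'M[R]_n) w k (T : components k) x r (u : k.-tuple 'I_n) :
  nabla H w T x [tuple of r :: u] =
  partial r (fun y => T y u) x
  + w / n.+1%:R * (\sum_(d < n) christoffel H x d r d) * T x u
  - \sum_(p < k) \sum_(e < n)
      christoffel H x e r (tnth u p) * T x (replace_index u p e).
Proof.
rewrite /nabla theadE.
by have -> : behead_tuple [tuple of r :: u] = u by exact: val_inj.
Qed.

(** Two cancellations: the derivative of the density factor against the inhomogeneous part of the
    Christoffel trace, and the derivatives of the Jacobian factors against the inhomogeneous parts
    of the Christoffel symbols, one for each index. *)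
Lemma nabla_pullback w k (T T' : components k) x : U x ->
  (forall t, differentiable (fun y => T' y t) (phi x)) ->
  (forall y, U y -> pulls_back w T T' y) ->
  pulls_back w (nabla G w T) (nabla G' w T') x.
Proof.
move=> Ux dT' TT' s; rewrite {1}/nabla.
set a := thead s; set b := behead_tuple s.
pose c := - (w / (2 * n + 2)%N%:R).
pose om y := ((\det (J y)) ^+ 2) `^ c.
pose P y (t : k.-tuple 'I_n) := \prod_(p < k) J y (tnth t p) (tnth b p).
pose Q (t : k.-tuple 'I_n) p := \prod_(q < k | q != p) J x (tnth t q) (tnth b q).
pose tr := \sum_i \sum_j partial a (fun y => J y i j) x * invmx (J x) j i.
have dJ := jacobian_diff Ux.
have [dom omE] := partial_density_factor a c dJ (uJ Ux).
have dP t : differentiable (fun y => P y t) x by apply: df_prod.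
have dT'p t : differentiable (fun y => T' (phi y) t) x.
  exact: (pullback_differentiable Ux (dT' t)).
(* The determinant enters squared, which turns the exponent with denominator [2n+2] into the factor
   [w/(n+1)] of the connection on densities. *)
have c2 : 2 * c = - (w / n.+1%:R).
  have -> : c = - (w / (2 * n.+1%:R)).
    by rewrite /c -natrM mulnS addnC.
  by field; rewrite nat1r pnatr_eq0.
have -> : partial a (fun y => T y b) x =
  - (w / n.+1%:R) * tr * T x b
  + om x * \sum_t ((\sum_p partial a (fun y => J y (tnth t p) (tnth b p)) x * Q t p)
                     * T' (phi x) t
           + P x t * \sum_r J x r a * partial r (fun y => T' y t) (phi x)).
  rewrite (partial_open a oU (g := fun y => om y * \sum_t P y t * T' (phi y) t)) //.
    rewrite partialM //; last by apply: df_sum => t _; apply: dfM.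
    rewrite omE c2 -/tr -/(om x) TT' // -/c -/(om x) -mulrA; congr (_ + _ * _).
    rewrite partial_sum; last by move=> t _; apply: dfM.
    apply: eq_bigr => t _; rewrite partialM // (partial_pullback a Ux (dT' t)).
    by rewrite (partial_prod a (F := fun p y => J y (tnth t p) (tnth b p))).
  by move=> y Uy; rewrite TT'.
rewrite christoffel_trace_pullback // -/tr.
rewrite TT' // -/c -/(om x).
under [\sum_(t : k.-tuple 'I_n) _ * T' _ _]eq_bigr do rewrite -/(P x _).
(* The Christoffel term at place [p] splits into a derivative of the Jacobian factor at that place
   and the pullback of the target Christoffel term. *)
have replE p : \sum_(e < n) christoffel G x e a (tnth b p) * T x (replace_index b p e) =
   om x * \sum_t (dmx a J x (tnth t p) (tnth b p) * Q t p * T' (phi x) t)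
  + om x * \sum_r J x r a * \sum_(u : k.-tuple 'I_n) P x u *
        \sum_e christoffel G' (phi x) e r (tnth u p) * T' (phi x) (replace_index u p e).
  transitivity (om x * \sum_t (\sum_e J x (tnth t p) e * christoffel G x e a (tnth b p))
      * Q t p * T' (phi x) t).
    under eq_bigr do rewrite TT' // -/c -/(om x) mulrCA.
    rewrite -mulr_sumr; congr (_ * _).
    under eq_bigr do rewrite mulr_sumr.
    rewrite exchange_big /=; apply: eq_bigr => t _.
    rewrite !mulr_suml; apply: eq_bigr => e _.
    rewrite (bigD1 p) //= tnth_replace_index eqxx.
    rewrite (eq_bigr (fun q => J x (tnth t q) (tnth b q))); last first.
      by move=> q /negPf qp; rewrite tnth_replace_index qp.
    by rewrite -/(Q t p); ring.
  under eq_bigr do rewrite christoffel_pullback // mulrDl mulrDl.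
  rewrite big_split mulrDr /=; congr (_ + _ * _).
  under eq_bigr => t _.
    rewrite !mulr_suml; under eq_bigr do rewrite !mulr_suml. over.
  rewrite exchange_big /=; apply: eq_bigr => r _.
  rewrite (replace_index_swap p) mulr_sumr; apply: eq_bigr => u _.
  rewrite !mulr_sumr; apply: eq_bigr => e _.
  rewrite tnth_replace_index eqxx /P (bigD1 p) //=.
  have -> : Q (replace_index u p e) p = \prod_(q < k | q != p) J x (tnth u q) (tnth b q).
    by apply: eq_bigr => q /negPf qp; rewrite tnth_replace_index qp.
  ring.
rewrite (eq_bigr _ (fun p _ => replE p)) [X in _ - X]big_split /= -!mulr_sumr.
have -> : \sum_t (\prod_(p < k.+1) J x (tnth t p) (tnth s p)) * nabla G' w T' (phi x) t =
    \sum_r J x r a * \sum_(u : k.-tuple 'I_n) P x u * nabla G' w T' (phi x) [tuple of r :: u].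
  rewrite big_tuple_cons; apply: eq_bigr => r _.
  rewrite mulr_sumr; apply: eq_bigr => u _.
  rewrite big_ord_recl mulrA; congr (_ * _ * _).
  apply: eq_bigr => p _; rewrite tnthS tnth_behead; congr (J x _ (tnth s _)).
  by apply: val_inj; rewrite /= inordK // ltnS.
set g := fun r => \sum_(d < n) christoffel G' (phi x) d r d.
have -> : \sum_r J x r a * (\sum_(u : k.-tuple 'I_n) P x u *
      nabla G' w T' (phi x) [tuple of r :: u]) =
    (\sum_t P x t * \sum_r J x r a * partial r (fun y => T' y t) (phi x))
    + w / n.+1%:R * (\sum_r J x r a * g r) * (\sum_t P x t * T' (phi x) t)
    - \sum_p \sum_r J x r a * (\sum_(u : k.-tuple 'I_n) P x u *
        \sum_e christoffel G' (phi x) e r (tnth u p) * T' (phi x) (replace_index u p e)).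
  have -> : (\sum_t P x t * \sum_r J x r a * partial r (fun y => T' y t) (phi x)) =
      \sum_r J x r a * \sum_t P x t * partial r (fun y => T' y t) (phi x).
    under eq_bigr do rewrite mulr_sumr.
    rewrite exchange_big; apply: eq_bigr => r _; rewrite mulr_sumr.
    by apply: eq_bigr => t _; rewrite mulrCA.
  have -> : w / n.+1%:R * (\sum_r J x r a * g r) * (\sum_t P x t * T' (phi x) t) =
      \sum_r J x r a * (w / n.+1%:R * g r * \sum_t P x t * T' (phi x) t).
    rewrite -mulrA mulr_suml mulr_sumr; apply: eq_bigr => r _.
    by move: (w / _) (J x r a) (g r) (\sum_t _) => *; ring.
  rewrite [X in _ - X]exchange_big /= -big_split -sumrB /=.
  apply: eq_bigr => r _; rewrite -mulr_sumr -mulrDr -mulrBr; congr (_ * _).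
  rewrite exchange_big mulr_sumr -big_split -sumrB /=; apply: eq_bigr => u _.
  rewrite nabla_cons -/(g r) -mulr_sumr mulrBr mulrDr; congr (_ + _ - _).
  by rewrite [RHS]mulrCA.
have -> : \sum_t ((\sum_p partial a (fun y => J y (tnth t p) (tnth b p)) x * Q t p)
      * T' (phi x) t
    + P x t * \sum_r J x r a * partial r (fun y => T' y t) (phi x)) =
  \sum_p \sum_t dmx a J x (tnth t p) (tnth b p) * Q t p * T' (phi x) t
  + \sum_t P x t * \sum_r J x r a * partial r (fun y => T' y t) (phi x).
  rewrite big_split; congr (_ + _); rewrite exchange_big; apply: eq_bigr => t _.
  by rewrite mulr_suml; apply: eq_bigr => p _; rewrite mxE -pdE.
set x1 := \sum_p \sum_t _; set y1 := \sum_p \sum_r _.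
set b1 := \sum_t P x t * \sum_r _; set s1 := \sum_t P x t * T' _ _.
set g1 := \sum_r J x r a * g r.
by move: x1 y1 b1 s1 g1 tr (om x) (w / _) => *; ring.
Qed.

End Pullback.

(** * Curvature and nullity *)

Section Curvature.
Context {R : realType} {n : nat}.
Local Notation V := 'rV[R]_n.
Variables (U : set V) (G : V -> 'M[R]_n).
Hypotheses (oU : open U) (mG : metric_on U G).
Local Notation A := (connection_mx G).

(** The curvature two-form of the connection form, [dA + [A, A]] in the directions [k] and [l]. *)
Definition curvature_mx (H : V -> 'M[R]_n) (k l : 'I_n) (x : V) : 'M[R]_n :=
  dmx k (connection_mx H l) x - dmx l (connection_mx H k) x
  + (connection_mx H k x *m connection_mx H l x
     - connection_mx H l x *m connection_mx H k x).

Lemma curvatureE (H : V -> 'M[R]_n) x i j k l :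
  curvature H x i j k l = curvature_mx H k l x i j.
Proof.
rewrite /curvature /curvature_mx pdE chrE !mxE.
have E (a b : 'I_n) : (fun y => connection_mx H a y i b) = (fun y => chr H y i a b).
  by apply/funext => y; rewrite mxE.
rewrite !E -sumrB; congr (_ + _); apply: eq_bigr => m _; rewrite !mxE; ring.
Qed.

Let dA k x : U x -> mx_diff (A k) x.
Proof. exact: (mx_diff_smooth (smooth_connection_mx oU mG k)). Qed.

(** Differentiating the compatibility equation once more and antisymmetrising: the second
    derivatives of the metric commute, and what is left is skewness of the lowered curvature. *)
Lemma curvature_mx_skew k l x : U x ->
  (curvature_mx G k l x)^T *m G x = - (G x *m curvature_mx G k l x).
Proof.
move=> Ux; have [sG _ _] := mG.
have dG : mx_diff G x by exact: mx_diff_smooth sG Ux.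
have dAt a := mx_diff_tr (dA a Ux).
have dd a b : dmx b (dmx a G) x =
    (dmx b (A a) x)^T *m G x + (A a x)^T *m ((A b x)^T *m G x + G x *m A b x)
    + (((A b x)^T *m G x + G x *m A b x) *m A a x + G x *m dmx b (A a) x).
  rewrite (dmx_open b oU (metric_compatible oU mG a) Ux).
  rewrite dmxD; [|exact: (mx_diffM (dAt a) dG)|exact: (mx_diffM dG (dA a Ux))].
  rewrite (dmxM b (dAt a) dG) (dmxM b dG (dA a Ux)) dmx_tr.
  by rewrite !(metric_compatible oU mG).
have := dmx_comm k l oU sG Ux; rewrite !dd /curvature_mx.
move: (dmx k (A l) x) (dmx l (A k) x) (A k x) (A l x) (G x) => a b c d g.
have trD (p q : 'M[R]_n) : (p + q)^T = p^T + q^T := linearD _ p q.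
have trN (p : 'M[R]_n) : (- p)^T = - p^T := linearN _ p.
rewrite !trD !trN !trmx_mul.
rewrite !(mulmxDl, mulmxDr, mulNmx, mulmxN) !mulmxA.
move: (a^T *m g) (d^T *m c^T *m g) (d^T *m g *m c) (c^T *m g *m d) (g *m c *m d)
  (g *m a) (b^T *m g) (c^T *m d^T *m g) (g *m d *m c) (g *m b).
move=> m1 m2 m3 m4 m5 m6 m7 m8 m9 m10 /matrixP E.
apply/matrixP => i j; have := E i j; rewrite !mxE.
move: (m1 i j) (m2 i j) (m3 i j) (m4 i j) (m5 i j) (m6 i j) (m7 i j) (m8 i j) (m9 i j) (m10 i j).
by move=> *; lra.
Qed.

Lemma curvature_antisym (H : V -> 'M[R]_n) x i j k l :
  curvature H x i j k l = - curvature H x i j l k.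
Proof.
rewrite !curvatureE /curvature_mx !mxE.
by move: (pd _ _ _) (pd _ _ _) (\sum_j0 _) (\sum_j0 _) => a b c d; ring.
Qed.

Lemma curvature_skew x i j k l : U x ->
  \sum_m G x i m * curvature G x m j k l = - \sum_m G x j m * curvature G x m i k l.
Proof.
move=> Ux; have /matrixP /(_ j i) := curvature_mx_skew k l Ux.
rewrite [LHS]mxE [RHS]mxE [X in _ = - X]mxE => E.
transitivity (\sum_m (curvature_mx G k l x)^T j m * G x m i).
  apply: eq_bigr => m _.
  by rewrite [_^T _ _]mxE curvatureE mulrC (metric_on_sym mG _ _ Ux).
by rewrite E; congr (- _); apply: eq_bigr => m _; rewrite curvatureE.
Qed.

Lemma curvature_bianchi x i j k l : U x ->
  curvature G x i j k l + curvature G x i k l j + curvature G x i l j k = 0.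
Proof.
move=> Ux; have cs y (Uy : U y) m a b : chr G y m a b = chr G y m b a.
  by rewrite -chrE; exact: (christoffel_sym oU mG m a b Uy).
have ds m a b c : pd a (fun y => chr G y m b c) x =
    pd a (fun y => chr G y m c b) x.
  by rewrite -pdE; apply: (partial_open a oU) Ux => y Uy; exact: cs.
rewrite /curvature pdE chrE (ds i k l j) (ds i l k j) (ds i j k l).
have sb a b c d : \sum_(m < n) (chr G x i a m * chr G x m b c -
      chr G x i d m * chr G x m a c) =
    \sum_(m < n) chr G x i a m * chr G x m b c -
    \sum_(m < n) chr G x i d m * chr G x m a c by rewrite sumrB.
rewrite !sb.
have ss a b c : \sum_(m < n) chr G x i a m * chr G x m b c =
    \sum_(m < n) chr G x i a m * chr G x m c b.
  by apply: eq_bigr => m _; rewrite (cs x Ux m b c).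
rewrite (ss k l j) (ss l k j) (ss j k l).
set p1 := pd _ _ _; set p2 := pd _ _ _; set p3 := pd _ _ _.
set s1 := \sum_(_ < n) _; set s2 := \sum_(_ < n) _; set s3 := \sum_(_ < n) _.
by move: p1 p2 p3 s1 s2 s3 => *; ring.
Qed.

(** Skewness makes the curvature matrix similar to minus its transpose, so its trace equals its
    opposite. *)
Lemma curvature_trace0 x k l : U x -> \sum_i curvature G x i i k l = 0.
Proof.
move=> Ux; set Q := curvature_mx G k l x.
have [_ uG sG] := mG.
have -> : \sum_i curvature G x i i k l = \tr Q by apply: eq_bigr => i _; rewrite curvatureE.
have : \tr Q = - \tr Q.
  rewrite -{1}mxtrace_tr -[Q^T](mulmxK (uG _ Ux)) (curvature_mx_skew k l Ux).
  by rewrite mulNmx linearN /= mxtrace_mulC mulmxA mulVmx ?uG // mul1mx.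
by move: (\tr Q) => t; lra.
Qed.

Definition christoffel_trace (H : V -> 'M[R]_n) (a : 'I_n) (x : V) : R :=
  \sum_(d < n) christoffel H x d a d.

Lemma smooth_christoffel_trace a : smooth_on U (christoffel_trace G a).
Proof. by apply: smooth_sum => // d _; exact: smooth_christoffel. Qed.

(** The curl of the Christoffel trace is the trace of the curvature, since the quadratic terms
    cancel when the two summation indices are exchanged. This says that the density bundles are
    flat. *)
Lemma christoffel_trace_closed x k l : U x ->
  partial k (christoffel_trace G l) x = partial l (christoffel_trace G k) x.
Proof.
move=> Ux; apply/eqP; rewrite -subr_eq0 -(curvature_trace0 k l Ux); apply/eqP.
have dch i a b : differentiable (fun y => christoffel G y i a b) x.
  exact: smooth_diff (smooth_christoffel oU mG i a b) Ux.
rewrite /curvature !big_split /= sumrN /christoffel_trace !partial_sum //.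
rewrite [X in _ = _ + X](_ : _ = 0) ?addr0 //.
under eq_bigr do rewrite sumrB.
rewrite sumrB; apply/eqP; rewrite subr_eq0; apply/eqP.
rewrite exchange_big; apply: eq_bigr => i _; apply: eq_bigr => j _; exact: mulrC.
Qed.

(** The contracted Bianchi identity: the antisymmetric part is the vanishing trace of the
    curvature. *)
Lemma ricci_sym x j l : U x -> ricci G x j l = ricci G x l j.
Proof.
move=> Ux; apply/eqP; rewrite -subr_eq0 /ricci -sumrB; apply/eqP.
transitivity (- \sum_i curvature G x i i l j); last by rewrite curvature_trace0 ?oppr0.
rewrite -sumrN; apply: eq_bigr => i _.
have := curvature_bianchi i j i l Ux; rewrite (curvature_antisym _ _ _ l j i).
by move: (curvature _ _ _ _ _ _) (curvature _ _ _ _ _ _) (curvature _ _ _ _ _ _) => *; lra.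
Qed.

Lemma schouten_sym x j l : U x -> schouten G x j l = schouten G x l j.
Proof. by move=> Ux; rewrite /schouten ricci_sym. Qed.

End Curvature.

(** * Algebra of the Weyl nullity at a point *)

Section Nullity.
Context {R : realType} {n : nat}.
Local Notation V := 'rV[R]_n.
Variables (U : set V) (G : V -> 'M[R]_n).
Hypotheses (oU : open U) (mG : metric_on U G).

Definition lower (x v : V) (k : 'I_n) : R := \sum_m G x k m * v 0 m.

Definition schouten_contract (x v : V) (k : 'I_n) : R :=
  \sum_j sch G x j k * v 0 j.

Lemma lower0 x v : U x -> (forall k, lower x v k = 0) -> v = 0.
Proof.
move=> Ux v0; have [_ uG _] := mG.
apply: trmx_inj; rewrite trmx0 -[v^T](mulKmx (uG _ Ux)).
have -> : G x *m v^T = 0; last by rewrite mulmx0.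
apply/colP => i; rewrite mxE [RHS]mxE -[RHS](v0 i).
by apply: eq_bigr => m _; rewrite mxE.
Qed.

Lemma sum_delta (F : 'I_n -> R) i : \sum_m (i == m)%:R * F m = F i.
Proof.
rewrite (bigD1 i) //= eqxx mul1r big1 ?addr0 // => m /negPf mi.
by rewrite eq_sym mi mul0r.
Qed.

Let sch_sym x j l : U x -> sch G x j l = sch G x l j.
Proof. by rewrite -schE; exact: schouten_sym. Qed.

(** Multiplication by the metric removes its inverse from the eigenvector condition; the order of
    the indices is restored by symmetry of the Schouten tensor. *)
Lemma schouten_upP x (v : V) b : U x ->
  (forall i, \sum_j schouten_up G x i j * v 0 j = b * v 0 i) <->
  (forall k, schouten_contract x v k = b * lower x v k).
Proof.
move=> Ux; have [_ uG _] := mG.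
pose p := \col_k schouten_contract x v k.
have upE i : \sum_j schouten_up G x i j * v 0 j = (invmx (G x) *m p) i 0.
  rewrite mxE /schouten_up schE; under eq_bigr do rewrite mulr_suml.
  rewrite exchange_big; apply: eq_bigr => k _; rewrite mxE mulr_sumr.
  apply: eq_bigr => j _; rewrite -mulrA; congr (_ * (_ * _)).
  exact: sch_sym.
have lowE k : (G x *m v^T) k 0 = lower x v k.
  by rewrite mxE; apply: eq_bigr => m _; rewrite mxE.
split=> H.
  have E : invmx (G x) *m p = b *: v^T.
    by apply/colP => i; rewrite -upE H !mxE.
  move=> k; have := congr1 (mulmx (G x)) E; rewrite mulKVmx ?uG // -scalemxAr.
  by move=> /colP /(_ k); rewrite mxE [RHS]mxE lowE.
have E : p = G x *m (b *: v^T).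
  by apply/colP => k; rewrite -scalemxAr mxE [RHS]mxE lowE H.
by move=> i; rewrite upE E mulKmx ?uG // !mxE.
Qed.

(** The Riemann tensor with all indices lowered, which has the full set of symmetries. *)
Let F x i j k l := \sum_m G x i m * crv G x m j k l.

Let F_skew x i j k l : U x -> F x i j k l = - F x j i k l.
Proof. by rewrite /F -crvE; exact: curvature_skew. Qed.

Let F_antisym x i j k l : F x i j k l = - F x i j l k.
Proof.
by rewrite /F -sumrN; apply: eq_bigr => m _; rewrite -crvE (curvature_antisym G x m j k l) mulrN.
Qed.

Let F_bianchi x i j k l : U x -> F x i j k l + F x i k l j + F x i l j k = 0.
Proof.
move=> Ux; rewrite /F -!big_split /= big1 // => m _.
by rewrite -!mulrDr -crvE (curvature_bianchi oU mG) // mulr0.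
Qed.

(** A linear combination of the four Bianchi identities obtained by cycling the indices, after
    skewness in each pair has reduced the terms to six unknowns. *)
Let F_pair x i j k l : U x -> F x i j k l = F x k l i j.
Proof.
move=> Ux.
have b1 := F_bianchi i j k l Ux; have b2 := F_bianchi j k l i Ux.
have b3 := F_bianchi k l i j Ux; have b4 := F_bianchi l i j k Ux.
have s a b c d : F x a b c d = - F x b a c d by exact: F_skew.
have t a b c d : F x a b c d = - F x a b d c by exact: F_antisym.
rewrite (t i k l j) in b1; rewrite (s j i k l) (t j k l i) in b2.
rewrite (s k i j l) (s k j l i) (t j k l i) opprK in b3.
rewrite (s l k i j) (s l j k i) (t j l k i) opprK (s l i j k) in b4.
clear s t; move: b1 b2 b3 b4.
move: (F x i j k l) (F x k l i j) (F x i k j l) (F x j l i k) (F x i l j k) (F x j k i l).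
by move=> *; lra.
Qed.

Lemma in_nullityP x (v : V) : in_nullity G x v <-> forall i k l,
  \sum_j crv G x i j k l * v 0 j =
  (i == k)%:R * schouten_contract x v l - (i == l)%:R * schouten_contract x v k.
Proof.
have E i k l : \sum_j weyl G x i j k l * v 0 j = \sum_j crv G x i j k l * v 0 j
    - ((i == k)%:R * schouten_contract x v l - (i == l)%:R * schouten_contract x v k).
  rewrite /schouten_contract !mulr_sumr -!sumrB; apply: eq_bigr => j _.
  by rewrite /weyl crvE schE; ring.
split=> H i k l; first by apply/eqP; rewrite -subr_eq0 -E H.
by rewrite E H subrr.
Qed.

Lemma null_curvature_low x (v : V) i k l : in_nullity G x v ->
  \sum_j F x i j k l * v 0 j =
  G x i k * schouten_contract x v l - G x i l * schouten_contract x v k.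
Proof.
move=> nv; rewrite /F; under eq_bigr do rewrite mulr_suml.
rewrite exchange_big /=.
under eq_bigr => m _.
  under eq_bigr do rewrite -mulrA.
  rewrite -mulr_sumr ((in_nullityP _ _).1 nv) mulrBr !mulrA ![G x i m * _]mulrC -!mulrA.
  rewrite [(m == k)]eq_sym [(m == l)]eq_sym. over.
by rewrite sumrB !(sum_delta (fun m => G x i m * _)).
Qed.

(** The lowered curvature evaluated on two vectors in its first pair. It is skew in [u] and [z], and
    for [u] in the nullity it is known through the Schouten tensor; the two facts together constrain
    eigenvalues. *)
Let quad x (u z : V) k l := \sum_i \sum_j F x i j k l * u 0 j * z 0 i.

Let quad_skew x u z k l : U x -> quad x u z k l = - quad x z u k l.
Proof.
move=> Ux; rewrite /quad [LHS]exchange_big -sumrN; apply: eq_bigr => i _ /=.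
by rewrite -sumrN; apply: eq_bigr => j _; rewrite (F_skew _ _ _ _ Ux); ring.
Qed.

Let quad_null x u z k l : U x -> in_nullity G x u -> quad x u z k l =
  lower x z k * schouten_contract x u l - lower x z l * schouten_contract x u k.
Proof.
move=> Ux nu; rewrite /quad.
under eq_bigr do rewrite -mulr_suml (null_curvature_low _ _ _ nu).
rewrite /lower !mulr_suml -sumrB; apply: eq_bigr => i _.
by rewrite (metric_on_sym mG k i Ux) (metric_on_sym mG l i Ux); ring.
Qed.

(** Taking the same null vector twice, skewness gives zero; hence the contraction of the Schouten
    tensor with [v] is proportional to the lowered [v]. *)
Lemma null_eigenvalue x v : U x -> in_nullity G x v ->
  exists b, forall k, schouten_contract x v k = b * lower x v k.
Proof.
move=> Ux nv.
have prop k l : schouten_contract x v l * lower x v k = schouten_contract x v k * lower x v l.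
  have := quad_null v k l Ux nv; have := quad_skew v v k l Ux.
  by move: (quad _ _ _ _ _) => q *; lra.
have [v0|/existsNP[k /eqP vk]] := pselect (forall k, lower x v k = 0).
  have -> := lower0 Ux v0; exists 0 => k; rewrite mul0r /schouten_contract.
  by rewrite big1 // => j _; rewrite mxE mulr0.
exists (schouten_contract x v k / lower x v k) => l.
by rewrite mulrAC -prop mulfK.
Qed.

(** After lowering the first index, pair symmetry moves [v] from a form index to a vector index of
    the Riemann tensor, where the nullity condition applies; the eigenvalue equation then collects
    everything into a multiple of [v]. *)
Lemma null_weyl x (v : V) b i j l : U x -> in_nullity G x v ->
  (forall k, schouten_contract x v k = b * lower x v k) ->
  \sum_k weyl G x i j k l * v 0 k = - v 0 i * (sch G x j l - b * G x j l).
Proof.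
move=> Ux nv pv; have [_ uG _] := mG.
suff : \col_i (\sum_k weyl G x i j k l * v 0 k) =
    - (sch G x j l - b * G x j l) *: v^T.
  by move=> /colP /(_ i); rewrite !mxE => ->; rewrite mulNr mulrC mulNr.
rewrite -[LHS](mulKmx (uG _ Ux)) -[RHS](mulKmx (uG _ Ux)); congr (_ *m _).
apply/colP => a; rewrite -scalemxAr [RHS]mxE.
have -> : (G x *m v^T) a 0 = lower x v a.
  by rewrite mxE; apply: eq_bigr => m _; rewrite mxE.
rewrite mxE.
transitivity (\sum_k F x a j k l * v 0 k
  + G x a l * schouten_contract x v j - sch G x j l * lower x v a).
  under eq_bigr do rewrite mxE mulr_sumr.
  rewrite exchange_big /= /F /lower /schouten_contract !mulr_sumr -big_split -sumrB /=.
  apply: eq_bigr => k _.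
  rewrite mulr_suml (sch_sym k j Ux).
  have -> : G x a l * (sch G x j k * v 0 k) =
      \sum_m G x a m * ((m == l)%:R * sch G x j k * v 0 k).
    rewrite -[LHS](sum_delta (fun m => G x a m * (sch G x j k * v 0 k))).
    by apply: eq_bigr => m _; rewrite [m == l]eq_sym; ring.
  have -> : sch G x j l * (G x a k * v 0 k) =
      \sum_m G x a m * ((m == k)%:R * sch G x j l * v 0 k).
    rewrite -[LHS](sum_delta (fun m => sch G x j l * (G x a m * v 0 k)) k).
    by apply: eq_bigr => m _; rewrite [m == k]eq_sym; ring.
  by rewrite -big_split -sumrB /=; apply: eq_bigr => m _; rewrite /weyl crvE schE; ring.
have -> : \sum_k F x a j k l * v 0 k = - \sum_k F x l k a j * v 0 k.
  by rewrite -sumrN; apply: eq_bigr => k _; rewrite (F_pair _ _ _ _ Ux) (F_skew _ _ _ _ Ux) mulNr.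
rewrite (null_curvature_low _ _ _ nv) !pv (metric_on_sym mG l a Ux) (metric_on_sym mG l j Ux).
by move: (lower _ _ _) (lower _ _ _) (G x a l) (G x j l) (sch _ _ _ _) => *; ring.
Qed.

(** If two null vectors had different eigenvalues, skewness of [quad] would make them parallel, and
    parallel nonzero vectors share their eigenvalue. So one number serves for the whole nullity. *)
Lemma nullity_eigenvalue_exists x : U x ->
  exists b, forall v, in_nullity G x v ->
    forall k, schouten_contract x v k = b * lower x v k.
Proof.
move=> Ux.
have [all0|/existsNP[v /not_implyP[nv /eqP v0]]] :=
    pselect (forall v, in_nullity G x v -> v = 0).
  exists 0 => v /all0 -> k; rewrite mul0r /schouten_contract.
  by rewrite big1 // => j _; rewrite mxE mulr0.
have [b bv] := null_eigenvalue Ux nv; exists b => w nw.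
have [c cw] := null_eigenvalue Ux nw.
have [<-//|cb] := eqVneq c b; have {}cb : b - c != 0 by rewrite subr_eq0 eq_sym.
(* Skewness yields [b - c] times the difference of the two sides, and [b - c] is nonzero. *)
have par k l : lower x w k * lower x v l = lower x w l * lower x v k.
  have := quad_skew v w k l Ux; rewrite !quad_null // !bv !cw => E.
  apply: (mulfI cb); move: E.
  by move: (lower _ _ _) (lower _ _ _) (lower _ _ _) (lower _ _ _) => *; lra.
have [k vk] : exists k, lower x v k != 0.
  apply: contrapT => /forallNP H; move/eqP: v0; apply; apply: (lower0 Ux) => k.
  by apply/eqP; move/negP: (H k); rewrite negbK.
pose r := lower x w k / lower x v k.
have wv : w = r *: v.
  apply/eqP; rewrite -subr_eq0; apply/eqP; apply: (lower0 Ux) => l.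
  have -> : lower x (w - r *: v) l = lower x w l - r * lower x v l.
    by rewrite /lower mulr_sumr -sumrB; apply: eq_bigr => m _; rewrite !mxE; ring.
  by rewrite /r mulrAC par mulfK ?subrr.
move=> l; rewrite wv.
have -> : schouten_contract x (r *: v) l = r * schouten_contract x v l.
  by rewrite /schouten_contract mulr_sumr; apply: eq_bigr => m _; rewrite !mxE; ring.
have -> : lower x (r *: v) l = r * lower x v l.
  by rewrite /lower mulr_sumr; apply: eq_bigr => m _; rewrite !mxE; ring.
by rewrite bv mulrCA.
Qed.

End Nullity.

(** * Curvature, Schouten tensor and nullity under a change of coordinates *)

Section CurvaturePullback.
Context {R : realType} {n : nat}.
Local Notation V := 'rV[R]_n.
Variables (U U' : set V) (phi : V -> V).
Hypotheses (oU : open U) (oU' : open U').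
Hypothesis sphi : forall e, smooth_on U (fun x => phi x 0 e).
Hypothesis phiU : forall x, U x -> U' (phi x).
Local Notation J := (jacobian_mx phi).
Hypothesis uJ : forall x, U x -> J x \in unitmx.
Variables G G' : V -> 'M[R]_n.
Hypothesis mG : metric_on U G.
Hypothesis mG' : metric_on U' G'.
Hypothesis GE : forall x, U x -> G x = (J x)^T *m G' (phi x) *m J x.

(** The connection form of the target pulled back along [phi] but still in the target frame; [J] is
    the gauge transformation between it and the connection form of the source. *)
Let C (k : 'I_n) (y : V) : 'M[R]_n := \sum_r J y r k *: connection_mx G' r (phi y).

Let JA k y : U y -> J y *m connection_mx G k y = dmx k J y + C k y *m J y.
Proof.
move=> Uy; rewrite (connection_pullback oU oU' sphi phiU uJ mG mG' GE) // mulmx_suml.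
by congr (_ + _); apply: eq_bigr => r _; rewrite scalemxAl.
Qed.

Let dA' r x : U x -> mx_diff (connection_mx G' r) (phi x).
Proof.
by move=> Ux; apply: mx_diff_smooth (phiU Ux); exact: smooth_connection_mx.
Qed.

Let CE k i j y : C k y i j = \sum_r J y r k * chr G' (phi y) i r j.
Proof. by rewrite summxE; apply: eq_bigr => r _; rewrite !mxE. Qed.

Let dterm r i j x : U x -> differentiable (fun y => chr G' (phi y) i r j) x.
Proof.
move=> Ux; apply: (pullback_differentiable (f := fun z => chr G' z i r j) sphi Ux).
by have := dA' r Ux i j; under eq_fun do rewrite mxE.
Qed.

Let dC k x : U x -> mx_diff (C k) x.
Proof.
move=> Ux i j; under eq_fun do rewrite CE.
apply: df_sum => r _; apply: dfM; last exact: dterm.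
exact: (jacobian_diff sphi Ux r k).
Qed.

Let dCE k l x : U x ->
  dmx k (C l) x = \sum_r dmx k J x r l *: connection_mx G' r (phi x)
    + \sum_s \sum_r (J x s k * J x r l) *: dmx s (connection_mx G' r) (phi x).
Proof.
move=> Ux; apply/matrixP => i j; rewrite [LHS]mxE [RHS]mxE -pdE.
have -> : (fun y => C l y i j) = (fun y => \sum_r J y r l * chr G' (phi y) i r j).
  by apply/funext => y; exact: CE.
have dJ r := jacobian_diff sphi Ux r l.
rewrite partial_sum; last by move=> r _; apply: dfM; [exact: dJ|exact: dterm].
rewrite (eq_bigr (fun r => dmx k J x r l * chr G' (phi x) i r j
  + \sum_s J x s k * J x r l * dmx s (connection_mx G' r) (phi x) i j)); last first.
  move=> r _; rewrite partialM; [|exact: dJ|exact: dterm].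
  rewrite [dmx k J x r l]mxE -pdE; congr (_ + _).
  have dr : differentiable (fun z => chr G' z i r j) (phi x).
    by have := dA' r Ux i j; under eq_fun do rewrite mxE.
  rewrite (partial_pullback sphi k Ux dr) mulr_sumr; apply: eq_bigr => s _.
  rewrite [dmx s _ _ i j]mxE -pdE mulrA [J x r l * _]mulrC; congr (_ * partial s _ _).
  by apply/funext => z; rewrite mxE.
rewrite big_split summxE summxE exchange_big; congr (_ + _).
  by apply: eq_bigr => r _; rewrite !mxE.
by apply: eq_bigr => s _; rewrite summxE; apply: eq_bigr => r _; rewrite [RHS]mxE.
Qed.

(** Gauge covariance of curvature. Differentiating [J A = dJ + C J] and antisymmetrising removes the
    second derivatives of [J] and leaves the curvature of [C] times [J]; in the curvature of [C] the
    derivatives of [J] cancel by symmetry, so that it is the pulled back curvature. *)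
Lemma curvature_mx_pullback k l x : U x ->
  J x *m curvature_mx G k l x =
  \sum_s \sum_r (J x s k * J x r l) *: (curvature_mx G' s r (phi x) *m J x).
Proof.
move=> Ux.
have dJ := jacobian_diff sphi Ux.
have dAx a : mx_diff (connection_mx G a) x.
  by apply: mx_diff_smooth Ux; exact: smooth_connection_mx.
have dd a b : dmx a J x *m connection_mx G b x + J x *m dmx a (connection_mx G b) x =
    dmx a (dmx b J) x + (dmx a (C b) x *m J x + C b x *m dmx a J x).
  have sJ i j : smooth_on U (fun y => J y i j) by exact: smooth_jacobian.
  have ddJ : mx_diff (dmx b J) x.
    move=> i j; have -> : (fun y => dmx b J y i j) = partial b (fun y => J y i j).
      by apply/funext => y; rewrite mxE -pdE.
    exact: smooth_diff (smooth_partial _ (sJ i j)) Ux.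
  rewrite -(dmxM a dJ (dAx b)) (dmx_open a oU (@JA b) Ux).
  by rewrite dmxD ?(dmxM a (dC b Ux) dJ) //; exact: mx_diffM (dC b Ux) dJ.
have comm : dmx k (dmx l J) x = dmx l (dmx k J) x.
  by apply: (dmx_comm _ _ oU) Ux => i j; exact: smooth_jacobian.
have key : J x *m curvature_mx G k l x =
    (dmx k (C l) x - dmx l (C k) x + (C k x *m C l x - C l x *m C k x)) *m J x.
  rewrite /curvature_mx mulmxDr !mulmxBr !mulmxA !JA // !mulmxDl.
  rewrite -!(mulmxA _ (J x) (connection_mx G _ x)) !JA // !mulmxDr !mulmxA.
  have := dd k l; have := dd l k; rewrite comm !mulNmx.
  set m1 := dmx l J x *m _; set m2 := J x *m _; set m3 := dmx l (dmx k J) x.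
  set m4 := _ *m J x; set m5 := C k x *m _; set m6 := dmx k J x *m _; set m7 := J x *m _.
  set m8 := _ *m J x; set m9 := C l x *m _; set m10 := C k x *m _ *m _; set m11 := _ *m J x.
  move: m1 m2 m3 m4 m5 m6 m7 m8 m9 m10 m11 => m1 m2 m3 m4 m5 m6 m7 m8 m9 m10 m11.
  move=> /matrixP E1 /matrixP E2; apply/matrixP => i j; have := E1 i j; have := E2 i j.
  rewrite !mxE; move: (m1 i j) (m2 i j) (m3 i j) (m4 i j) (m5 i j) (m6 i j) (m7 i j).
  by move: (m8 i j) (m9 i j) (m10 i j) (m11 i j) => *; lra.
rewrite key; under eq_bigr do rewrite (eq_bigr _ (fun r _ => scalemxAl _ _ _)).
under eq_bigr do rewrite -mulmx_suml.
rewrite -mulmx_suml; congr (_ *m _).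
have CC a b : C a x *m C b x = \sum_s \sum_r (J x s a * J x r b) *:
    (connection_mx G' s (phi x) *m connection_mx G' r (phi x)).
  rewrite /C mulmx_suml; apply: eq_bigr => s _; rewrite mulmx_sumr.
  by apply: eq_bigr => r _; rewrite -scalemxAl -scalemxAr scalerA.
have swap (H : 'I_n -> 'I_n -> 'M[R]_n) :
    \sum_s \sum_r (J x s l * J x r k) *: H s r = \sum_s \sum_r (J x s k * J x r l) *: H r s.
  by rewrite exchange_big; do 2 (apply: eq_bigr => ? _); rewrite mulrC.
rewrite !dCE // !CC.
rewrite (swap (fun s r => dmx s (connection_mx G' r) (phi x))).
rewrite (swap (fun s r => connection_mx G' s (phi x) *m connection_mx G' r (phi x))).
have -> : \sum_r dmx l J x r k *: connection_mx G' r (phi x) =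
    \sum_r dmx k J x r l *: connection_mx G' r (phi x).
  by apply: eq_bigr => r _; rewrite (jacobian_diff_sym oU sphi r l k Ux).
rewrite opprD [X in X + _]addrACA subrr add0r -!sumrB -big_split; apply: eq_bigr => s _ /=.
rewrite -!sumrB -big_split; apply: eq_bigr => r _ /=.
by rewrite -!scalerBr -scalerDr.
Qed.

Lemma curvature_pullback m j k l x : U x ->
  \sum_i J x m i * crv G x i j k l =
  \sum_p \sum_q \sum_r J x p j * J x q k * J x r l * crv G' (phi x) m p q r.
Proof.
move=> Ux; have /matrixP /(_ m j) := curvature_mx_pullback k l Ux.
rewrite [LHS]mxE summxE => E.
transitivity (\sum_i J x m i * curvature_mx G k l x i j).
  by apply: eq_bigr => i _; rewrite -crvE curvatureE.
rewrite E [RHS]exchange_big; apply: eq_bigr => s _ /=.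
rewrite [RHS]exchange_big summxE; apply: eq_bigr => r _ /=.
rewrite [LHS]mxE [X in _ * X = _]mxE mulr_sumr; apply: eq_bigr => p _.
by rewrite -crvE curvatureE; ring.
Qed.

Let jacobian_inv x p m : U x -> \sum_i invmx (J x) i m * J x p i = (p == m)%:R.
Proof.
move=> Ux; have /matrixP /(_ p m) := mulmxV (uJ Ux); rewrite !mxE => <-.
by apply: eq_bigr => i _; rewrite mulrC.
Qed.

Let jacobian_inv' x k m : U x -> \sum_p invmx (J x) k p * J x p m = (k == m)%:R.
Proof. by move=> Ux; have /matrixP /(_ k m) := mulVmx (uJ Ux); rewrite !mxE => <-. Qed.

(** To contract, the identity is inserted as the inverse of [J] times [J], because the
    transformation law of the curvature carries [J] on its upper index. *)
Lemma schouten_pullback j l x : U x ->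
  sch G x j l = \sum_p \sum_r J x p j * J x r l * sch G' (phi x) p r.
Proof.
move=> Ux; rewrite -schE /schouten.
under [RHS]eq_bigr do under eq_bigr do rewrite mulrCA.
under [RHS]eq_bigr do rewrite -mulr_sumr.
rewrite -mulr_sumr; congr (_ * _); rewrite /ricci crvE.
transitivity (\sum_k \sum_m invmx (J x) k m * \sum_i J x m i * crv G x i j k l).
  apply: eq_bigr => k _; under eq_bigr do rewrite mulr_sumr.
  rewrite exchange_big /= -[LHS](sum_delta (fun i => crv G x i j k l) k).
  apply: eq_bigr => i _; rewrite -(jacobian_inv' k i Ux) mulr_suml.
  by apply: eq_bigr => m _; rewrite mulrA.
under eq_bigr do under eq_bigr do rewrite curvature_pullback //.
rewrite exchange_big /=.
transitivity (\sum_m \sum_q (q == m)%:R * \sum_p \sum_r J x p j * J x r l * crv G' (phi x) m p q r).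
  apply: eq_bigr => m _.
  under [RHS]eq_bigr do rewrite -(jacobian_inv _ _ Ux) mulr_suml.
  rewrite [RHS]exchange_big; apply: eq_bigr => k _ /=.
  rewrite exchange_big mulr_sumr; apply: eq_bigr => q _.
  rewrite -mulrA; congr (_ * _); rewrite mulr_sumr; apply: eq_bigr => p _.
  by rewrite mulr_sumr; apply: eq_bigr => r _; ring.
transitivity (\sum_m \sum_p \sum_r J x p j * J x r l * crv G' (phi x) m p m r).
  apply: eq_bigr => m _.
  rewrite -[RHS](sum_delta (fun q => \sum_p \sum_r J x p j * J x r l * crv G' (phi x) m p q r) m).
  by apply: eq_bigr => q _; rewrite eq_sym.
rewrite exchange_big; apply: eq_bigr => p _; rewrite exchange_big; apply: eq_bigr => r _.
by rewrite mulr_sumr.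
Qed.

Definition pushforward (x v : V) : V := \row_p \sum_i J x p i * v 0 i.

Lemma sum_pushforward x v (F : 'I_n -> R) :
  \sum_p F p * pushforward x v 0 p = \sum_j (\sum_p J x p j * F p) * v 0 j.
Proof.
transitivity (\sum_p \sum_j J x p j * F p * v 0 j); last first.
  by rewrite exchange_big; apply: eq_bigr => j _; rewrite mulr_suml.
apply: eq_bigr => p _; rewrite mxE mulr_sumr; apply: eq_bigr => j _.
by rewrite mulrA [F p * _]mulrC.
Qed.

Lemma schouten_contract_pullback x v k : U x -> schouten_contract G x v k =
  \sum_q J x q k * schouten_contract G' (phi x) (pushforward x v) q.
Proof.
move=> Ux; rewrite /schouten_contract.
under [RHS]eq_bigr do rewrite sum_pushforward mulr_sumr.
rewrite exchange_big; apply: eq_bigr => j _ /=; rewrite schouten_pullback //.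
under [RHS]eq_bigr do rewrite mulrA.
rewrite -mulr_suml; congr (_ * _); rewrite exchange_big; apply: eq_bigr => q _.
by rewrite mulr_sumr; apply: eq_bigr => p _; ring.
Qed.

Lemma lower_pullback x v k : U x -> lower G x v k =
  \sum_q J x q k * lower G' (phi x) (pushforward x v) q.
Proof.
move=> Ux; rewrite /lower.
under [RHS]eq_bigr do rewrite sum_pushforward mulr_sumr.
rewrite exchange_big; apply: eq_bigr => j _ /=; rewrite GE //.
under [RHS]eq_bigr do rewrite mulrA.
rewrite -mulr_suml; congr (_ * _); rewrite -mulmxA mxE; apply: eq_bigr => q _.
rewrite [_^T _ _]mxE [(_ *m _) _ _]mxE; congr (_ * _); apply: eq_bigr => p _; exact: mulrC.
Qed.

Lemma eigenvalue_pushforward x v b : U x ->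
  (forall k, schouten_contract G' (phi x) (pushforward x v) k =
             b * lower G' (phi x) (pushforward x v) k) ->
  forall k, schouten_contract G x v k = b * lower G x v k.
Proof.
move=> Ux H k; rewrite schouten_contract_pullback // lower_pullback // mulr_sumr.
by apply: eq_bigr => q _; rewrite H mulrCA.
Qed.

(** For a fixed upper index, let [D] be the matrix of the failure of nullity at the image point.
    Nullity at [x] says that [D] multiplied by [J] on the right and its transpose on the left is
    zero, and [J] is invertible. *)
Lemma in_nullity_pushforward x v : U x ->
  in_nullity G x v -> in_nullity G' (phi x) (pushforward x v).
Proof.
move=> Ux /in_nullityP nv; apply/in_nullityP => m.
pose p' := schouten_contract G' (phi x) (pushforward x v).
pose D := \matrix_(q, r) (\sum_p crv G' (phi x) m p q r * pushforward x v 0 p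
  - ((m == q)%:R * p' r - (m == r)%:R * p' q)).
suff D0 : D = 0.
  move=> q r; have /matrixP /(_ q r) := D0; rewrite !mxE => /eqP.
  by rewrite subr_eq0 => /eqP.
suff JDJ : (J x)^T *m D *m J x = 0.
  have fJ : row_free (J x) by rewrite row_free_unit uJ.
  have JD : (J x)^T *m D = 0 by apply: (row_free_inj fJ); rewrite /= JDJ mul0mx.
  have uJt : (J x)^T \in unitmx by rewrite unitmx_tr uJ.
  by rewrite -[D](mulKmx uJt) JD mulmx0.
apply/matrixP => k l; rewrite [RHS]mxE.
transitivity (\sum_q \sum_r J x q k * J x r l * D q r).
  rewrite mxE exchange_big /=; apply: eq_bigr => r _; rewrite mxE mulr_suml.
  by apply: eq_bigr => q _; rewrite [_^T _ _]mxE; ring.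
transitivity (\sum_i J x m i * (\sum_j crv G x i j k l * v 0 j
   - ((i == k)%:R * schouten_contract G x v l - (i == l)%:R * schouten_contract G x v k)));
  last by rewrite big1 // => i _; rewrite nv subrr mulr0.
transitivity (\sum_q \sum_r J x q k * J x r l * (\sum_p crv G' (phi x) m p q r * pushforward x v 0 p)
  - (J x m k * schouten_contract G x v l - J x m l * schouten_contract G x v k)).
  rewrite !schouten_contract_pullback // -/p'.
  have -> : J x m k * \sum_q J x q l * p' q =
      \sum_q \sum_r J x q k * J x r l * ((m == q)%:R * p' r).
    rewrite -(sum_delta (fun q => J x q k * \sum_r J x r l * p' r) m).
    apply: eq_bigr => q _; rewrite !mulr_sumr; apply: eq_bigr => r _; ring.
  have -> : J x m l * \sum_q J x q k * p' q =
      \sum_q \sum_r J x q k * J x r l * ((m == r)%:R * p' q).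
    rewrite exchange_big -(sum_delta (fun r => J x r l * \sum_q J x q k * p' q) m).
    apply: eq_bigr => r _; rewrite !mulr_sumr; apply: eq_bigr => q _; ring.
  rewrite -!sumrB; apply: eq_bigr => q _; rewrite -!sumrB; apply: eq_bigr => r _.
  by rewrite [D q r]mxE !mulrBr.
under [RHS]eq_bigr do rewrite mulrBr.
rewrite sumrB; congr (_ - _); last first.
  rewrite -(sum_delta (fun i => J x m i * schouten_contract G x v l) k).
  rewrite -(sum_delta (fun i => J x m i * schouten_contract G x v k) l) -sumrB.
  by apply: eq_bigr => i _; rewrite [k == i]eq_sym [l == i]eq_sym; ring.
transitivity (\sum_j (\sum_i J x m i * crv G x i j k l) * v 0 j); last first.
  under eq_bigr do rewrite mulr_suml.
  rewrite exchange_big; apply: eq_bigr => i _; rewrite mulr_sumr.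
  by apply: eq_bigr => j _; rewrite mulrA.
under [RHS]eq_bigr do rewrite curvature_pullback // exchange_big mulr_suml.
rewrite [RHS]exchange_big; apply: eq_bigr => q _ /=.
under [RHS]eq_bigr do rewrite exchange_big mulr_suml.
rewrite [RHS]exchange_big; apply: eq_bigr => r _ /=.
rewrite sum_pushforward mulr_sumr; apply: eq_bigr => j _.
rewrite mulrA mulr_sumr; congr (_ * _); apply: eq_bigr => p _; ring.
Qed.

End CurvaturePullback.

(** * Projective change of metric *)

Section CovariantDerivatives.
Context {R : realType} {n : nat}.
Local Notation V := 'rV[R]_n.
Implicit Types (G : V -> 'M[R]_n) (w : R) (x : V).

(** [nabla0], [nabla1] and [nabla2] are [nabla] in ranks 0, 1 and 2 with the indices as separate
    arguments, so that the change laws become ring identities instead of statements about tuples. *)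
Definition nabla0 G w (f : V -> R) (a : 'I_n) x : R :=
  pd a f x + w / n.+1%:R * christoffel_trace G a x * f x.

Definition nabla1 G w (F : 'I_n -> V -> R) (a b : 'I_n) x : R :=
  pd a (F b) x + w / n.+1%:R * christoffel_trace G a x * F b x
  - \sum_e chr G x e a b * F e x.

Definition nabla2 G w (F : 'I_n -> 'I_n -> V -> R) (a b c : 'I_n) x : R :=
  pd a (F b c) x + w / n.+1%:R * christoffel_trace G a x * F b c x
  - (\sum_e chr G x e a b * F e c x + \sum_e chr G x e a c * F b e x).

Lemma nabla0E G w (T : components 0) x a :
  nabla G w T x [tuple a] = nabla0 G w (fun y => T y [tuple]) a x.
Proof.
have -> : [tuple a] = [tuple of a :: [tuple]] :> 1.-tuple 'I_n by exact: val_inj.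
by rewrite nabla_cons big_ord0 subr0 pdE.
Qed.

Lemma nabla1E G w (T : components 1) x a b :
  nabla G w T x [tuple a; b] = nabla1 G w (fun b y => T y [tuple b]) a b x.
Proof.
have -> : [tuple a; b] = [tuple of a :: [tuple b]] :> 2.-tuple 'I_n by exact: val_inj.
rewrite nabla_cons big_ord1 /nabla1 -/(christoffel_trace G a x) pdE chrE; congr (_ - _).
apply: eq_bigr => e _; congr (_ * T x _).
by apply: eq_from_tnth => q; rewrite tnth_replace_index !ord1.
Qed.

Lemma nabla2E G w (T : components 2) x a b c :
  nabla G w T x [tuple a; b; c] = nabla2 G w (fun b c y => T y [tuple b; c]) a b c x.
Proof.
have -> : [tuple a; b; c] = [tuple of a :: [tuple b; c]] :> 3.-tuple 'I_n by exact: val_inj.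
rewrite nabla_cons 2!big_ord_recl big_ord0 addr0 /nabla2 -/(christoffel_trace G a x) pdE chrE; congr (_ - (_ + _)).
  apply: eq_bigr => e _; congr (_ * T x _).
  apply: eq_from_tnth => q; rewrite tnth_replace_index.
  by case: q => [[|[|]]].
apply: eq_bigr => e _; congr (_ * T x _).
apply: eq_from_tnth => q; rewrite tnth_replace_index.
by case: q => [[|[|]]].
Qed.

Lemma nabla_twiceE G w (T : components 0) x a b :
  nabla G w (nabla G w T) x [tuple a; b] =
  nabla1 G w (nabla0 G w (fun y => T y [tuple])) a b x.
Proof.
rewrite nabla1E; congr (nabla1 _ _ _ _ _ _).
by apply/funext => e; apply/funext => z; exact: nabla0E.
Qed.

Lemma nabla_thriceE G w (T : components 0) x a b c :
  nabla G w (nabla G w (nabla G w T)) x [tuple a; b; c] =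
  nabla2 G w (nabla1 G w (nabla0 G w (fun y => T y [tuple]))) a b c x.
Proof.
rewrite nabla2E; congr (nabla2 _ _ _ _ _ _ _).
apply/funext => d; apply/funext => e; apply/funext => z; exact: nabla_twiceE.
Qed.

Variables (U : set V) (G : V -> 'M[R]_n).
Hypotheses (oU : open U) (mG : metric_on U G).

Let smooth_chr e a b : smooth_on U (fun x => chr G x e a b).
Proof. by rewrite -chrE; exact: smooth_christoffel. Qed.

Lemma smooth_nabla0 w f a : smooth_on U f -> smooth_on U (nabla0 G w f a).
Proof.
move=> sf; rewrite /nabla0 -pdE; apply: (smoothD oU); first exact: smooth_partial.
apply: (smoothM oU) => //; apply: (smoothM oU); first exact: smooth_cst.
exact: smooth_christoffel_trace.
Qed.

Lemma smooth_nabla1 w F a b : (forall b, smooth_on U (F b)) ->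
  smooth_on U (nabla1 G w F a b).
Proof.
move=> sF; apply: (smoothB oU); first exact: smooth_nabla0.
by apply: (smooth_sum oU) => e _; exact: smoothM.
Qed.

Lemma nabla1_open w F F' a b x : (forall b y, U y -> F b y = F' b y) -> U x ->
  nabla1 G w F a b x = nabla1 G w F' a b x.
Proof.
move=> E Ux; rewrite /nabla1 -pdE (partial_open a oU (E b) Ux) E //.
by congr (_ - _); apply: eq_bigr => e _; rewrite E.
Qed.

Lemma nabla2_open w F F' a b c x : (forall b c y, U y -> F b c y = F' b c y) -> U x ->
  nabla2 G w F a b c x = nabla2 G w F' a b c x.
Proof.
move=> E Ux; rewrite /nabla2 -pdE (partial_open a oU (E b c) Ux) E //.
by congr (_ - (_ + _)); apply: eq_bigr => e _; rewrite E.
Qed.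

Lemma nabla1D w F F' a b x : (forall b, differentiable (F b) x) ->
  (forall b, differentiable (F' b) x) ->
  nabla1 G w (fun b y => F b y + F' b y) a b x = nabla1 G w F a b x + nabla1 G w F' a b x.
Proof.
move=> dF dF'; rewrite /nabla1 -pdE partialD // pdE.
under eq_bigr do rewrite mulrDr.
by rewrite big_split /= mulrDr; move: (\sum_i _) (\sum_i _) => *; ring.
Qed.

Lemma nabla2D w F F' a b c x : (forall b c, differentiable (F b c) x) ->
  (forall b c, differentiable (F' b c) x) ->
  nabla2 G w (fun b c y => F b c y + F' b c y) a b c x =
  nabla2 G w F a b c x + nabla2 G w F' a b c x.
Proof.
move=> dF dF'; rewrite /nabla2 -pdE partialD // pdE.
under eq_bigr do rewrite mulrDr.
under [X in _ - (_ + X) = _]eq_bigr do rewrite mulrDr.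
rewrite !big_split /= mulrDr.
by move: (\sum_i _) (\sum_i _) (\sum_i _) (\sum_i _) => *; ring.
Qed.

(** Leibniz rule in which the covector factor has weight 0 and the scalar factor carries the whole
    weight. *)
Lemma nabla1_mul w (F : 'I_n -> V -> R) f a b x : (forall b, differentiable (F b) x) ->
  differentiable f x ->
  nabla1 G w (fun b y => F b y * f y) a b x =
  nabla1 G 0 F a b x * f x + F b x * nabla0 G w f a x.
Proof.
move=> dF df; rewrite /nabla1 /nabla0 -pdE partialM // pdE.
under eq_bigr do rewrite mulrA.
rewrite -mulr_suml mul0r mul0r.
by move: (\sum_i _) (w / _) => *; ring.
Qed.

Lemma nabla2_mul w (F : 'I_n -> 'I_n -> V -> R) f a b c x :
  (forall b c, differentiable (F b c) x) -> differentiable f x ->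
  nabla2 G w (fun b c y => F b c y * f y) a b c x =
  nabla2 G 0 F a b c x * f x + F b c x * nabla0 G w f a x.
Proof.
move=> dF df; rewrite /nabla2 /nabla0 -pdE partialM // pdE.
under eq_bigr do rewrite mulrA.
under [X in _ - (_ + X) = _]eq_bigr do rewrite mulrA.
rewrite -!mulr_suml mul0r mul0r.
by move: (\sum_i _) (\sum_i _) (w / _) => *; ring.
Qed.

Lemma nabla2_tensor w (F F' : 'I_n -> V -> R) a b c x :
  (forall b, differentiable (F b) x) -> (forall b, differentiable (F' b) x) ->
  nabla2 G w (fun b c y => F b y * F' c y) a b c x =
  nabla1 G 0 F a b x * F' c x + F b x * nabla1 G w F' a c x.
Proof.
move=> dF df; rewrite /nabla2 /nabla1 -pdE partialM // pdE.
under eq_bigr do rewrite mulrA.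
under [X in _ - (_ + X) = _]eq_bigr do rewrite mulrCA.
rewrite -mulr_suml -mulr_sumr mul0r mul0r.
by move: (\sum_i _) (\sum_i _) (w / _) => *; ring.
Qed.

Lemma nabla2_swap w (F : 'I_n -> 'I_n -> V -> R) a b c x :
  nabla2 G w (fun b c => F c b) a b c x = nabla2 G w F a c b x.
Proof. by rewrite /nabla2 [X in _ - X]addrC. Qed.

(** The metric is parallel, so the derivative falls on the scalar factor alone. *)
Lemma nabla2_metric (B : V -> R) a b c x : U x -> differentiable B x ->
  nabla2 G 0 (fun b c y => B y * G y b c) a b c x = pd a B x * G x b c.
Proof.
move=> Ux dB; have [sG _ _] := mG.
have dG i j := smooth_diff (sG i j) Ux.
rewrite /nabla2 !mul0r addr0 -pdE partialM // pdE.
have := metric_compatible oU mG a Ux => /matrixP /(_ b c).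
rewrite !mxE => ->.
have -> : \sum_j (connection_mx G a x)^T b j * G x j c = \sum_e chr G x e a b * G x e c.
  by apply: eq_bigr => e _; rewrite !mxE.
have -> : \sum_j G x b j * connection_mx G a x j c = \sum_e chr G x e a c * G x b e.
  by apply: eq_bigr => e _; rewrite !mxE mulrC.
have E1 (S : 'I_n -> R) (F : 'I_n -> R) :
    \sum_e S e * (B x * F e) = B x * \sum_e S e * F e.
  by rewrite mulr_sumr; apply: eq_bigr => e _; exact: mulrCA.
rewrite !E1.
by move: (\sum_e _) (\sum_e _) => *; ring.
Qed.

(** Besides the absence of torsion this needs flatness of the connection on densities, that is
    closedness of the Christoffel trace. *)
Lemma nabla1_nabla0_sym w f a b x : smooth_on U f -> U x ->
  nabla1 G w (nabla0 G w f) a b x = nabla1 G w (nabla0 G w f) b a x.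
Proof.
move=> sf Ux; rewrite /nabla1 -chrE.
have -> : \sum_e christoffel G x e a b * nabla0 G w f e x =
    \sum_e christoffel G x e b a * nabla0 G w f e x.
  by apply: eq_bigr => e _; rewrite (christoffel_sym oU mG _ _ _ Ux).
congr (_ - _).
have st c := smooth_christoffel_trace oU mG c.
have dt c := smooth_diff (st c) Ux.
have df := smooth_diff sf Ux.
have dn c d : pd c (nabla0 G w f d) x = partial c (partial d f) x +
    (w / n.+1%:R * partial c (christoffel_trace G d) x * f x
     + w / n.+1%:R * christoffel_trace G d x * partial c f x).
  rewrite -pdE /nabla0 -pdE partialD; last first.
  - by apply: dfM => //; apply: dfM => //; exact: dfcst.
  - exact: smooth_diff (smooth_partial d sf) Ux.
  congr (_ + _); rewrite partialM //; last by apply: dfM => //; exact: dfcst.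
  by rewrite partialZ.
rewrite !dn (partial_comm oU a b sf Ux) (christoffel_trace_closed oU mG a b Ux) pdE /nabla0.
by move: (w / _) (pd b (pd a f) x) (pd b (christoffel_trace G a) x) => *; ring.
Qed.

End CovariantDerivatives.

(** * Projective change of curvature and of covariant derivatives, and the invariance of both
    formulas *)

Section ProjectiveChange.
Context {R : realType} {n : nat}.
Hypothesis n_ge2 : (2 <= n)%N.
Local Notation V := 'rV[R]_n.
Variables (U : set V) (G H : V -> 'M[R]_n).
Hypotheses (oU : open U) (mG : metric_on U G) (mH : metric_on U H).

(** The form Y of the overview. The trace of [delta^k_i Y_j + delta^k_j Y_i] over [k] and one lower
    index is [n+1] times Y, whence the factor. *)
Definition projective_form (i : 'I_n) (x : V) : R :=
  n.+1%:R^-1 * (christoffel_trace H i x - christoffel_trace G i x).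
Local Notation ups := projective_form.

Hypothesis GH : forall x k i j, U x ->
  christoffel H x k i j = christoffel G x k i j
    + ((k == i)%:R * ups j x + (k == j)%:R * ups i x).

Lemma smooth_projective_form i : smooth_on U (ups i).
Proof.
apply: (smoothM oU); first exact: smooth_cst.
by apply: (smoothB oU); exact: smooth_christoffel_trace.
Qed.

Lemma christoffel_traceH i x : christoffel_trace H i x =
  christoffel_trace G i x + n.+1%:R * ups i x.
Proof. by rewrite /projective_form mulVKf ?pnatr_eq0 // addrC subrK. Qed.

Lemma projective_form_closed i j x : U x -> pd i (ups j) x = pd j (ups i) x.
Proof.
move=> Ux; rewrite -pdE /projective_form.
have d (K : V -> 'M[R]_n) : metric_on U K -> forall k, differentiable (christoffel_trace K k) x.
  by move=> mK k; exact: smooth_diff (smooth_christoffel_trace oU mK k) Ux.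
rewrite !partialZ; [|by apply: dfD; [exact: d|apply: dfN; exact: d]..].
rewrite !partialD ?partialN; [|exact: d|exact: d|exact: d|by apply: dfN; exact: d|exact: d|
  by apply: dfN; exact: d].
by rewrite (christoffel_trace_closed oU mG i j Ux) (christoffel_trace_closed oU mH i j Ux).
Qed.

Definition projective_hessian (j k : 'I_n) (x : V) : R :=
  nabla1 G 0 ups j k x - ups j x * ups k x.
Local Notation Phi := projective_hessian.

Lemma projective_hessianE j k x : Phi j k x =
  pd j (ups k) x - \sum_m chr G x m j k * ups m x - ups j x * ups k x.
Proof. by rewrite /projective_hessian /nabla1 !mul0r addr0. Qed.

Lemma projective_hessian_sym j k x : U x -> Phi j k x = Phi k j x.
Proof.
move=> Ux; rewrite !projective_hessianE (projective_form_closed _ _ Ux).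
rewrite [ups j x * _]mulrC; congr (_ - _ - _); apply: eq_bigr => m _.
by rewrite -chrE (christoffel_sym oU mG _ _ _ Ux).
Qed.

Let chH x k i j : U x -> chr H x k i j = chr G x k i j
    + ((k == i)%:R * ups j x + (k == j)%:R * ups i x).
Proof. by rewrite -chrE; exact: GH. Qed.

Lemma curvature_projective_change x i j k l : U x ->
  crv H x i j k l = crv G x i j k l + (i == l)%:R * Phi k j x - (i == k)%:R * Phi l j x.
Proof.
move=> Ux.
have dch a b c : differentiable (fun y => christoffel G y a b c) x.
  exact: smooth_diff (smooth_christoffel oU mG a b c) Ux.
have dups a : differentiable (ups a) x := smooth_diff (smooth_projective_form a) Ux.
have pch a b c d : pd a (fun y => chr H y b c d) x = pd a (fun y => chr G y b c d) x
    + ((b == c)%:R * pd a (ups d) x + (b == d)%:R * pd a (ups c) x).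
  rewrite -chrE -!pdE (partial_open a oU (fun y => @GH y b c d) Ux).
  rewrite partialD //; last by apply: dfD; apply: dfM => //; exact: dfcst.
  rewrite partialD; [|by apply: dfM => //; exact: dfcst..].
  by rewrite (partialZ a _ (dups d)) (partialZ a _ (dups c)).
(* The part quadratic in the Christoffel symbols, with the Kronecker symbols summed out. The terms
   symmetric in the two directions cancel in the curvature. *)
have quad a b : \sum_(m < n) chr H x i a m * chr H x m b j =
    \sum_(m < n) chr G x i a m * chr G x m b j
    + (chr G x i a b * ups j x + chr G x i a j * ups b x)
    + ((i == a)%:R * (\sum_m chr G x m b j * ups m x) + ups a x * chr G x i b j)
    + ((i == a)%:R * (ups b x * ups j x) *+ 2 + (i == b)%:R * (ups a x * ups j x)
       + (i == j)%:R * (ups a x * ups b x)).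
  under eq_bigr do rewrite !chH //.
  transitivity (\sum_(m < n) (chr G x i a m * chr G x m b j
     + ((b == m)%:R * (chr G x i a m * ups j x) + (j == m)%:R * (chr G x i a m * ups b x))
     + ((i == a)%:R * (chr G x m b j * ups m x) + (i == m)%:R * (ups a x * chr G x m b j))
     + ((b == m)%:R * ((i == a)%:R * (ups m x * ups j x))
        + (j == m)%:R * ((i == a)%:R * (ups m x * ups b x))
        + ((i == m)%:R * (((m == b)%:R * ups j x + (m == j)%:R * ups b x) * ups a x))))).
    apply: eq_bigr => m _; rewrite [b == m]eq_sym [j == m]eq_sym.
    move: (ups m x) (ups a x) (ups b x) (ups j x) (chr G x i a m) (chr G x m b j).
    by move: (m == b)%:R (m == j)%:R => *; ring.
  rewrite !big_split /= !sum_delta -mulr_sumr.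
  clear pch dch dups.
  by move: (\sum_m _) (\sum_m _) (ups a x) (ups b x) (ups j x) => *; ring.
rewrite -crvE /curvature !sumrB chrE pdE !pch !quad.
rewrite !projective_hessianE (projective_form_closed k l Ux).
have -> : chr G x i k l = chr G x i l k.
  by rewrite -chrE (christoffel_sym oU mG _ _ _ Ux).
set s1 := \sum_m _; set s2 := \sum_m _; set s3 := \sum_m _; set s4 := \sum_m _.
by move: s1 s2 s3 s4 (ups j x) (ups k x) (ups l x) => *; ring.
Qed.

(** Contraction of the curvature change gives [1 - n] times [Phi]; the normalisation of the Schouten
    tensor divides by [n - 1], which is nonzero since [n] is at least 2. *)
Lemma schouten_projective_change x j l : U x -> sch H x j l = sch G x j l - Phi j l x.
Proof.
move=> Ux; rewrite -schE /schouten /ricci crvE.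
under eq_bigr do rewrite curvature_projective_change //.
rewrite sumrB big_split /= mulrBr mulrDr -addrA; congr (_ + _).
have -> : \sum_(a < n) (a == l)%:R * Phi a j x = Phi l j x.
  rewrite -[RHS](sum_delta (fun a => Phi a j x) l).
  by apply: eq_bigr => a _; rewrite eq_sym.
have -> : \sum_(a < n) (a == a)%:R * Phi l j x = n%:R * Phi l j x.
  by under eq_bigr do rewrite eqxx mul1r; rewrite sumr_const card_ord mulr_natl.
rewrite (projective_hessian_sym l j Ux); have n1 : (n%:R - 1 : R) != 0.
  by rewrite subr_eq0 (eqr_nat R n 1) gtn_eqF.
by field.
Qed.

Lemma weyl_projective_change x i j k l : U x -> weyl H x i j k l = weyl G x i j k l.
Proof.
move=> Ux; rewrite /weyl crvE schE curvature_projective_change //.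
rewrite !schouten_projective_change // (projective_hessian_sym k j Ux).
by rewrite (projective_hessian_sym l j Ux); ring.
Qed.

Lemma in_nullity_projective_change x v : U x -> in_nullity G x v -> in_nullity H x v.
Proof.
move=> Ux nv i k l; rewrite -[RHS](nv i k l).
by apply: eq_bigr => j _; rewrite weyl_projective_change.
Qed.

(* The nonzero vector [v] recovers [P - B g] from the Weyl tensor
   ([null_weyl]), and the Weyl tensor does not see the projective change. *)
Lemma eigenvalue_projective_change x (v : V) b b' j l : U x -> v != 0 -> in_nullity G x v ->
  (forall k, schouten_contract G x v k = b * lower G x v k) ->
  (forall k, schouten_contract H x v k = b' * lower H x v k) ->
  Phi j l x = b * G x j l - b' * H x j l.
Proof.
move=> Ux v0 nG eG eH; have nH := in_nullity_projective_change Ux nG.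
have [i vi] : exists i, v 0 i != 0 by apply/rV0Pn.
have := null_weyl oU mH i j l Ux nH eH.
under eq_bigr do rewrite weyl_projective_change //.
rewrite (null_weyl oU mG i j l Ux nG eG) schouten_projective_change //.
by rewrite !mulNr => /oppr_inj /(mulfI vi); move: (sch _ _ _ _) (Phi _ _ _) => *; lra.
Qed.

Let tracew w i x : w / n.+1%:R * christoffel_trace H i x =
  w / n.+1%:R * christoffel_trace G i x + w * ups i x.
Proof.
rewrite christoffel_traceH mulrDr; congr (_ + _); field.
by rewrite nat1r pnatr_eq0.
Qed.

Lemma nabla0_projective_change w f a x :
  nabla0 H w f a x = nabla0 G w f a x + w * ups a x * f x.
Proof. by rewrite /nabla0 tracew; move: (w / _) => *; ring. Qed.

Let sumH (F : 'I_n -> R) a b x : U x -> \sum_e chr H x e a b * F e =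
  \sum_e chr G x e a b * F e + (ups b x * F a + ups a x * F b).
Proof.
move=> Ux; under eq_bigr do rewrite chH // mulrDl mulrDl.
rewrite !big_split /=; congr (_ + (_ + _)).
  rewrite -(sum_delta (fun e => ups b x * F e) a).
  by apply: eq_bigr => e _; rewrite [a == e]eq_sym mulrA.
rewrite -(sum_delta (fun e => ups a x * F e) b).
by apply: eq_bigr => e _; rewrite [b == e]eq_sym mulrA.
Qed.

(** The weight contributes [w] times the form in the new index; each covariant index subtracts this
    form once and also the term in which the two indices have changed places. *)
Lemma nabla1_projective_change w F a b x : U x ->
  nabla1 H w F a b x = nabla1 G w F a b x
    + (w - 1) * ups a x * F b x - ups b x * F a x.
Proof.
move=> Ux; rewrite /nabla1 tracew sumH //.
by move: (w / _) (\sum_e _) (ups a x) (ups b x) => *; ring.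
Qed.

Lemma nabla2_projective_change w F a b c x : U x ->
  nabla2 H w F a b c x = nabla2 G w F a b c x
    + (w - 2) * ups a x * F b c x - ups b x * F a c x - ups c x * F b a x.
Proof.
move=> Ux; rewrite /nabla2 tracew sumH // sumH //.
by move: (w / _) (\sum_e _) (\sum_e _) (ups a x) (ups b x) (ups c x) => *; ring.
Qed.

Variables BG BH : V -> R.
Hypotheses (sBG : smooth_on U BG) (sBH : smooth_on U BH).
Hypothesis PhiE : forall x j l, U x -> Phi j l x = BG x * G x j l - BH x * H x j l.

(** In weight 1 the coefficient [w - 1] vanishes, and the first-order term of the Leibniz rule is
    cancelled by the exchanged-index term. What is added to the Hessian is [Phi] times [f], and
    [PhiE] absorbs it. *)
Lemma hessian_invariant f a b x : smooth_on U f -> U x ->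
  nabla1 H 1 (nabla0 H 1 f) a b x + BH x * H x a b * f x =
  nabla1 G 1 (nabla0 G 1 f) a b x + BG x * G x a b * f x.
Proof.
move=> sf Ux.
have df := smooth_diff sf Ux.
have du c : differentiable (ups c) x := smooth_diff (smooth_projective_form c) Ux.
have dn c : differentiable (nabla0 G 1 f c) x.
  exact: smooth_diff (smooth_nabla0 oU mG 1 c sf) Ux.
rewrite nabla1_projective_change // !nabla0_projective_change.
have -> : nabla1 G 1 (nabla0 H 1 f) a b x =
    nabla1 G 1 (fun c y => nabla0 G 1 f c y + ups c y * f y) a b x.
  apply: (@nabla1_open R n U G oU) => // c y _.
  by rewrite nabla0_projective_change mul1r.
rewrite nabla1D // => [|c]; last exact: dfM.
rewrite nabla1_mul //.
have -> : BH x * H x a b = BG x * G x a b - (nabla1 G 0 ups a b x - ups a x * ups b x).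
  by rewrite -/(Phi a b x) PhiE //; ring.
by move: (nabla1 _ _ _ _ _ _) (nabla1 _ _ _ _ _ _) (nabla0 _ _ _ _ _) (nabla0 _ _ _ _ _) => *; ring.
Qed.

(** [K] is the covariant derivative of the projective form, rewritten by [PhiE]. Therefore no
    derivative of that form remains, and even its second derivative becomes algebraic, because each
    metric is parallel for its own connection. *)
Lemma third_derivative_projective_change f a b c x : smooth_on U f -> U x ->
  let T1 := nabla0 G 2 f in let T2 := nabla1 G 2 T1 in
  let K i j := BG x * G x i j - BH x * H x i j + ups i x * ups j x in
  nabla2 H 2 (nabla1 H 2 (nabla0 H 2 f)) a b c x =
  nabla2 G 2 T2 a b c x
  + K a b * T1 c x + K a c * T1 b x + 2 * K b c * T1 a x
  + 2 * f x * (pd a BG x * G x b c - pd a BH x * H x b c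
     - 2 * BH x * ups a x * H x b c - BH x * ups b x * H x a c - BH x * ups c x * H x b a
     + K a b * ups c x + ups b x * K a c)
  + ups b x * T2 a c x + ups c x * T2 a b x
  - ups b x * (T2 a c x + ups a x * T1 c x + ups c x * T1 a x + 2 * K a c * f x)
  - ups c x * (T2 b a x + ups b x * T1 a x + ups a x * T1 b x + 2 * K b a * f x).
Proof.
move=> sf Ux T1 T2 K.
have sT1 i : smooth_on U (T1 i) by exact: smooth_nabla0.
have sT2 i j : smooth_on U (T2 i j) by exact: smooth_nabla1.
have sU i : smooth_on U (ups i) := smooth_projective_form i.
pose L := nabla1 G 0 ups.
have sL i j : smooth_on U (L i j) by exact: smooth_nabla1.
have LE i j y : U y -> L i j y = BG y * G y i j + (- BH y) * H y i j + ups i y * ups j y.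
  by move=> Uy; rewrite mulNr -PhiE // /projective_hessian -/(L i j y) subrK.
have d g : smooth_on U g -> differentiable g x by move=> /smooth_diff; exact.
(* In weight 2 the changed Hessian keeps first-order terms. It is written as nested binary sums,
   with [2 L f] as [L f + L f], so that additivity and the Leibniz rules apply summand by summand.
   It holds on all of [U], as it is differentiated next. *)
have T2' i j y : U y -> nabla1 H 2 (nabla0 H 2 f) i j y =
    T2 i j y + (ups i y * T1 j y + (ups j y * T1 i y + (L i j y * f y + L i j y * f y))).
  move=> Uy; have dy g : smooth_on U g -> differentiable g y.
    by move=> /smooth_diff; exact.
  rewrite nabla1_projective_change // !nabla0_projective_change.
  have -> : nabla1 G 2 (nabla0 H 2 f) i j y =
      nabla1 G 2 (fun k z => T1 k z + (ups k z * f z + ups k z * f z)) i j y.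
    apply: (@nabla1_open R n U G oU) => // k z _.
    by rewrite nabla0_projective_change -/(T1 k z); ring.
  have -> : nabla1 G 2 (fun k z => T1 k z + (ups k z * f z + ups k z * f z)) i j y =
      T2 i j y + (L i j y * f y + ups j y * T1 i y + (L i j y * f y + ups j y * T1 i y)).
    have dUf k : differentiable (fun z => ups k z * f z) y by apply: dfM; exact: dy.
    rewrite nabla1D; [|by move=> k; exact: dy|by move=> k; exact: dfD].
    congr (_ + _); rewrite nabla1D // nabla1_mul //; last exact: dy.
    by move=> k; exact: dy.
  rewrite -/(T1 i y) -/(T1 j y).
  by move: (L i j y) (T2 i j y) (T1 i y) (T1 j y) (ups i y) (ups j y) => *; ring.
rewrite nabla2_projective_change // !T2' //.
have dLf i j : differentiable (fun y => L i j y * f y) x by apply: dfM; exact: d.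
have dLf2 i j : differentiable (fun y => L i j y * f y + L i j y * f y) x by exact: dfD.
have dUT i j : differentiable (fun y => ups i y * T1 j y) x by apply: dfM; exact: d.
have dU i : differentiable (ups i) x by exact: d.
have dT1 i : differentiable (T1 i) x by exact: d.
have dL i j : differentiable (L i j) x by exact: d.
have -> : nabla2 G 2 (nabla1 H 2 (nabla0 H 2 f)) a b c x =
    nabla2 G 2 T2 a b c x + (L a b x * T1 c x + ups b x * T2 a c x
    + (L a c x * T1 b x + ups c x * T2 a b x
    + (nabla2 G 0 L a b c x * f x + L b c x * T1 a x
       + (nabla2 G 0 L a b c x * f x + L b c x * T1 a x)))).
  transitivity (nabla2 G 2 (fun i j y =>
    T2 i j y + (ups i y * T1 j y + (ups j y * T1 i y + (L i j y * f y + L i j y * f y)))) a b c x).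
    exact: (@nabla2_open R n U G oU).
  rewrite nabla2D; [|by move=> i j; exact: d|by move=> i j; do 2 apply: dfD => //].
  congr (_ + _); rewrite nabla2D; [|by []|by move=> i j; exact: dfD].
  congr (_ + _); first by rewrite nabla2_tensor.
  rewrite nabla2D; [|by move=> i j; exact: dUT|by []].
  congr (_ + _).
    by rewrite (nabla2_swap G 2 (fun i j y => ups i y * T1 j y)) nabla2_tensor.
  by rewrite nabla2D // nabla2_mul //; exact: d.
have dG i j : differentiable (fun y => G y i j) x by case: mG => sG _ _; exact: smooth_diff Ux.
have dH i j : differentiable (fun y => H y i j) x by case: mH => sH _ _; exact: smooth_diff Ux.
have dBG := d _ sBG; have dBH := d _ sBH.
have dNG i j : differentiable (fun y => BG y * G y i j) x by exact: dfM.
have dNH i j : differentiable (fun y => (- BH y) * H y i j) x by apply: dfM => //; exact: dfN.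
have dUU i j : differentiable (fun y => ups i y * ups j y) x by exact: dfM.
have -> : nabla2 G 0 L a b c x = pd a BG x * G x b c - pd a BH x * H x b c
    - 2 * BH x * ups a x * H x b c - BH x * ups b x * H x a c - BH x * ups c x * H x b a
    + (L a b x * ups c x + ups b x * L a c x).
  transitivity (nabla2 G 0 (fun i j y =>
      (BG y * G y i j + (- BH y) * H y i j) + ups i y * ups j y) a b c x).
    by apply: (@nabla2_open R n U G oU) => // i j y Uy; exact: LE.
  rewrite nabla2D //; last by move=> i j; exact: dfD.
  congr (_ + _); last by rewrite nabla2_tensor.
  rewrite nabla2D // (nabla2_metric oU mG) //.
  (* The metric [H] is not parallel for the connection of [G]; its derivative is read off from its
     vanishing for the connection of [H] by the change law in weight 0. *)
  have := nabla2_projective_change 0 (fun i j y => (- BH y) * H y i j) a b c Ux.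
  rewrite (nabla2_metric oU mH) //; last exact: dfN.
  rewrite -pdE partialN // pdE.
  move: (nabla2 _ _ _ _ _ _ _) (pd a BH x) (pd a BG x) (ups a x) (ups b x) (ups c x).
  move: (BG x) (BH x) (G x b c) (H x b c) (H x a c) (H x b a).
  by move=> Bg Bh g1 h1 h2 h3 N pH pG u1 u2 u3 E; lra.
rewrite !LE // /K -/(T1 a x) -/(T1 b x) -/(T1 c x).
move: (nabla2 _ _ _ _ _ _ _) (T2 a b x) (T2 a c x) (T2 b a x) (T1 a x) (T1 b x) (T1 c x).
by move: (ups a x) (ups b x) (ups c x) (pd a BG x) (pd a BH x) => *; ring.
Qed.

Definition third_order_operator (K : V -> 'M[R]_n) (B f : V -> R) (a b c : 'I_n) (x : V) : R :=
  sym3 (fun i j k => nabla2 K 2 (nabla1 K 2 (nabla0 K 2 f)) i j k x) a b c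
  + 4 * B x * sym3 (fun i j k => K x i j * nabla0 K 2 f k x) a b c
  + 2 * sym3 (fun i j k => K x i j * pd k B x) a b c * f x.

(** By symmetry of the Hessian the second-order terms cancel. With [N = BG G - BH H] the first-order
    terms reduce to [N_ab], [N_ac] and twice [N_bc] times first derivatives, whose symmetrisation
    accounts for the coefficient 4. The zeroth-order terms give twice the derivatives of [BG] and
    [BH], and a remaining [-8 BH] term that is cancelled by the change of [nabla0] in the term with
    coefficient 4. *)
Lemma third_order_invariant f a b c x : smooth_on U f -> U x ->
  third_order_operator H BH f a b c x = third_order_operator G BG f a b c x.
Proof.
move=> sf Ux; rewrite /third_order_operator /sym3 !third_derivative_projective_change //.
rewrite !nabla0_projective_change.
have sG i j : G x i j = G x j i by exact: (metric_on_sym mG i j Ux).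
have sH i j : H x i j = H x j i by exact: (metric_on_sym mH i j Ux).
have sT i j : nabla1 G 2 (nabla0 G 2 f) i j x = nabla1 G 2 (nabla0 G 2 f) j i x.
  exact: (nabla1_nabla0_sym oU mG).
rewrite (sG b a) (sG c a) (sG c b) (sH b a) (sH c a) (sH c b) (sT b a) (sT c a) (sT c b).
set t1 := nabla1 _ _ _ a b x; set t2 := nabla1 _ _ _ a c x; set t3 := nabla1 _ _ _ b c x.
set s1 := nabla0 _ _ _ a x; set s2 := nabla0 _ _ _ b x; set s3 := nabla0 _ _ _ c x.
set r1 := nabla2 _ _ _ a b c x; set r2 := nabla2 _ _ _ a c b x.
set r3 := nabla2 _ _ _ b a c x; set r4 := nabla2 _ _ _ b c a x.
set r5 := nabla2 _ _ _ c a b x; set r6 := nabla2 _ _ _ c b a x.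
clear sG sH sT.
move: t1 t2 t3 s1 s2 s3 r1 r2 r3 r4 r5 r6 (ups a x) (ups b x) (ups c x).
move: (G x a b) (G x a c) (G x b c) (H x a b) (H x a c) (H x b c) (BG x) (BH x) (f x).
move: (pd a BG x) (pd b BG x) (pd c BG x) (pd a BH x) (pd b BH x) (pd c BH x) => *.
by field.
Qed.

End ProjectiveChange.

(** * Existence of geodesics *)

Section BoundedLipschitz.
Context {R : realType} {K : finType}.
Implicit Types (h : (K -> R) -> R).

(** Boundedness is carried along because it makes the class stable under products, as the geodesic
    equation is cubic in Christoffel symbols and velocities. *)
Definition bounded_lipschitz h : Prop := exists L M : R, [/\ 0 <= L, 0 <= M,
  forall y, `|h y| <= M &
  forall y z C, (forall j, `|y j - z j| <= C) -> `|h y - h z| <= L * C].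

Lemma bounded_lipschitz_cst a : bounded_lipschitz (fun=> a).
Proof.
exists 0, `|a|; split => // y z C _; by rewrite subrr normr0 mul0r.
Qed.

Lemma bounded_lipschitzD h h' : bounded_lipschitz h -> bounded_lipschitz h' ->
  bounded_lipschitz (fun y => h y + h' y).
Proof.
move=> [L [M [L0 M0 bM lL]]] [L' [M' [L'0 M'0 bM' lL']]].
exists (L + L'), (M + M'); split; [exact: addr_ge0|exact: addr_ge0| |].
  by move=> y; apply: le_trans (ler_normD _ _) _; exact: lerD.
move=> y z C yz; rewrite opprD addrACA mulrDl.
by apply: le_trans (ler_normD _ _) _; apply: lerD; [exact: lL|exact: lL'].
Qed.

Lemma bounded_lipschitzN h : bounded_lipschitz h -> bounded_lipschitz (fun y => - h y).
Proof.
move=> [L [M [L0 M0 bM lL]]]; exists L, M; split => //.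
  by move=> y; rewrite normrN.
by move=> y z C yz; rewrite -opprD normrN; exact: lL.
Qed.

Lemma bounded_lipschitzM h h' : bounded_lipschitz h -> bounded_lipschitz h' ->
  bounded_lipschitz (fun y => h y * h' y).
Proof.
move=> [L [M [L0 M0 bM lL]]] [L' [M' [L'0 M'0 bM' lL']]].
exists (L * M' + M * L'), (M * M'); split.
- by rewrite addr_ge0 ?mulr_ge0.
- exact: mulr_ge0.
- by move=> y; rewrite normrM ler_pM.
move=> y z C yz.
have -> : h y * h' y - h z * h' z = (h y - h z) * h' y + h z * (h' y - h' z) by ring.
apply: le_trans (ler_normD _ _) _; rewrite !normrM mulrDl; apply: lerD.
  by rewrite mulrAC ler_pM //; exact: lL.
by rewrite -mulrA ler_pM //; exact: lL'.
Qed.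

Lemma bounded_lipschitz_sum (I : Type) (r : seq I) (H : I -> (K -> R) -> R) :
  (forall i, bounded_lipschitz (H i)) ->
  bounded_lipschitz (fun y => \sum_(i <- r) H i y).
Proof.
move=> bH; elim: r => [|i r IH].
  by under eq_fun do rewrite big_nil; exact: bounded_lipschitz_cst.
by under eq_fun do rewrite big_cons; exact: bounded_lipschitzD.
Qed.

Lemma picard_bounded_lipschitz (F : (K -> R) -> K -> R) (y0 : K -> R) :
  (forall i, bounded_lipschitz (F^~ i)) ->
  exists2 T : R, 0 < T & exists y : R -> K -> R,
  [/\ y 0 = y0, coord_continuous_path y &
      forall t : R, `|t| < T -> forall i, is_derive t 1 (y^~ i) (F (y t) i)].
Proof.
move=> /choice[L HL].
have L0 i : 0 <= L i by have [M []] := HL i.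
(* The sum dominates every constant, and the summand 1 makes the common constant strictly
   positive. *)
apply: (@picard R K F (1 + \sum_i L i)).
  by apply: ltr_wpDr => //; apply: sumr_ge0 => i _.
move=> y z C yz i; have [M [_ _ _ /(_ _ _ _ yz) H]] := HL i.
have C0 : 0 <= C by exact: le_trans (normr_ge0 _) (yz i).
apply: le_trans H _; apply: ler_wpM2r => //.
rewrite (bigD1 i) //= addrCA lerDl addr_ge0 // sumr_ge0 // => j _.
Qed.

End BoundedLipschitz.

Section Clamp.
Context {R : realType}.
Variables (a r : R).
Hypothesis r0 : 0 <= r.

Definition clamp (t : R) := Order.max (a - r) (Order.min t (a + r)).

Lemma clamp_dist (t : R) : `|clamp t - a| <= r.
Proof.
rewrite ler_norml /clamp lerBrDr lerBlDr addrC [r + a]addrC le_max lexx /=.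
rewrite ge_max ge_min lexx orbT andbT.
by move: r0; lra.
Qed.

Lemma clampK t : `|t - a| <= r -> clamp t = t.
Proof.
rewrite ler_norml => /andP[t1 t2]; rewrite /clamp min_l ?max_r //; lra.
Qed.

Lemma clamp_lipschitz s t : `|clamp s - clamp t| <= `|s - t|.
Proof.
have H (m p q : R) : `|Order.max m p - Order.max m q| <= `|p - q|.
  rewrite ler_norml; case: (leP m p) => mp; case: (leP m q) => mq;
   by have := ler_norm (p - q); have := ler_norm (- (p - q)); rewrite normrN;
      have := normr_ge0 (p - q); move: (`|p - q|) => N *; apply/andP; split; lra.
have H' (m p q : R) : `|Order.min p m - Order.min q m| <= `|p - q|.
  rewrite ler_norml; case: (leP p m) => mp; case: (leP q m) => mq;
   by have := ler_norm (p - q); have := ler_norm (- (p - q)); rewrite normrN;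
      have := normr_ge0 (p - q); move: (`|p - q|) => N *; apply/andP; split; lra.
exact: le_trans (H _ _ _) (H' _ _ _).
Qed.

End Clamp.

(** * Local Lipschitz bounds and local solution of the geodesic equation *)

Section LocalLipschitz.
Context {R : realType} {n : nat}.
Local Notation V := 'rV[R]_n.

(** On a small box around [x] all the functions and their first partial derivatives are bounded by
    one [M]; a box is convex, so the mean value theorem on a segment gives the Lipschitz constant
    [n%:R * M] for the maximum norm. *)
Lemma smooth_locally_lipschitz (U : set V) (I : finType) (f : I -> V -> R) x :
  open U -> (forall i, smooth_on U (f i)) -> U x ->
  exists r M : R, [/\ 0 < r, 0 <= M,
    forall y : V, (forall e, `|y 0 e - x 0 e| <= r) -> U y /\ forall i, `|f i y| <= M &
    forall i (y z : V) C, (forall e, `|y 0 e - x 0 e| <= r) ->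
      (forall e, `|z 0 e - x 0 e| <= r) ->
      (forall e, `|y 0 e - z 0 e| <= C) -> `|f i y - f i z| <= n%:R * M * C].
Proof.
move=> oU sf Ux.
(* One family for the functions ([None]) and for their partial derivatives ([Some e]), so that a
   single bound covers both. *)
pose N (o : option 'I_n) i y := if o is Some e then partial e (f i) y else f i y.
have cN o i : {for x, continuous (N o i)}.
  apply: differentiable_continuous; case: o => [e|] /=; last exact: smooth_diff Ux.
  exact: smooth_diff (smooth_partial e (sf i)) Ux.
pose M := 1 + \sum_(p : option 'I_n * I) `|N p.1 p.2 x|.
have near1 : \forall y \near x, forall p : option 'I_n * I, `|N p.1 p.2 y| <= M.
  apply: (@filter_forall _ _ (fun (p : option 'I_n * I) y => `|N p.1 p.2 y| <= M) (nbhs x) _).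
  move=> p; have := cN p.1 p.2 => /cvgrPdist_lt /(_ 1 ltr01); apply: filterS => y.
  move=> Hy; have : `|N p.1 p.2 y| < 1 + `|N p.1 p.2 x|.
    by have := lerB_dist (N p.1 p.2 y) (N p.1 p.2 x); rewrite distrC; move: Hy; lra.
  move/ltW => H; apply: le_trans H _; rewrite lerD2l (bigD1 p) //= lerDl.
  exact: sumr_ge0.
have near2 : \forall y \near x, U y by exact: open_nbhs_nbhs.
have near3 := filterI near2 near1.
have [r r0 Hr] := (nbhs_ballP _ _).1 (near3 _).
have r2 : 0 < r / 2 by rewrite divr_gt0.
have box (y : V) : (forall e, `|y 0 e - x 0 e| <= r / 2) ->
    U y /\ forall p : option 'I_n * I, `|N p.1 p.2 y| <= M.
  move=> yx; apply: Hr; rewrite mx_norm_ball /ball_ /= [ltLHS]/Num.Def.normr /= mx_normrE.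
  apply: (@le_lt_trans _ _ (r / 2)); last by rewrite ltr_pdivrMr // ltr_pMr // ltr1n.
  apply: bigmax_le; first exact: ltW.
  by move=> [i j] _ /=; rewrite !mxE !ord1 distrC; exact: yx.
exists (r / 2), M; split => //.
- by rewrite addr_ge0 // sumr_ge0.
- by move=> y /box[Uy H]; split => // i; exact: (H (None, i)).
move=> i y z C yx zx yz.
have seg (s : R) e : 0 <= s <= 1 -> `|(z + s *: (y - z)) 0 e - x 0 e| <= r / 2.
  move=> /andP[s0 s1]; rewrite !mxE.
  have -> : z 0 e + s * (y 0 e - z 0 e) - x 0 e =
      s * (y 0 e - x 0 e) + (1 - s) * (z 0 e - x 0 e) by ring.
  apply: le_trans (ler_normD _ _) _; rewrite !normrM (ger0_norm s0).
  have s1' : 0 <= 1 - s by rewrite subr_ge0.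
  rewrite (ger0_norm s1').
  have := ler_wpM2l s0 (yx e); have := ler_wpM2l s1' (zx e); lra.
have df (s : R) : 0 <= s <= 1 -> differentiable (f i) (z + s *: (y - z)).
  move=> s01; apply: (smooth_diff (sf i)).
  by have [] := box _ (fun e => seg s e s01).
have [s s01] := mvt_line df.
have s01' : 0 <= s <= 1 by case/andP: s01 => ? ?; rewrite !ltW.
rewrite subrKC (diff_row_sum _ (df _ s01')) => ->.
apply: le_trans (ler_norm_sum _ _ _) _.
have -> : n%:R * M * C = \sum_(e < n) M * C.
  by rewrite sumr_const card_ord -mulrA mulr_natl.
apply: ler_sum => e _; rewrite normrM mulrC; apply: ler_pM => //; last first.
  by rewrite !mxE; exact: yz.
by have [_ H] := box _ (fun e => seg s e s01'); exact: (H (Some e, i)).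
Qed.

End LocalLipschitz.

Section GeodesicEquation.
Context {R : realType} {n : nat}.
Local Notation V := 'rV[R]_n.

Lemma bounded_lipschitz_clamp (K : finType) (k : K) (a r : R) : 0 <= r ->
  bounded_lipschitz (fun y : K -> R => clamp a r (y k)).
Proof.
move=> r0; exists 1, (`|a| + r); split => //; first by rewrite addr_ge0.
  move=> y; have := clamp_dist a r0 (y k); have := lerB_dist (clamp a r (y k)) a.
  by move: `|_| `|_ - _| `|a| => *; lra.
move=> y z C yz; rewrite mul1r; apply: le_trans (yz k); exact: clamp_lipschitz.
Qed.

(** The equation is defined on [U] only and is quadratic in the velocity. Truncating positions to a
    box around [x] and velocities to a box around [v] produces a bounded Lipschitz field everywhere,
    and for short times its solution does not leave the boxes. *)
Lemma geodesic_ode (U : set V) (G : V -> 'M[R]_n) (x v : V) :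
  open U -> metric_on U G -> U x ->
  exists2 T : R, 0 < T & exists u w : R -> 'I_n -> R,
  [/\ forall i, u 0 i = x 0 i, forall i, w 0 i = v 0 i &
    forall t : R, `|t| < T ->
    [/\ U (\row_i u t i), forall i, is_derive t 1 (u^~ i) (w t i) &
      forall k, is_derive t 1 (w^~ k)
        (- \sum_i \sum_j chr G (\row_i u t i) k i j * w t i * w t j)]].
Proof.
move=> oU mG Ux.
pose I := ('I_n * 'I_n * 'I_n)%type.
have sf (p : I) : smooth_on U (fun y => chr G y p.1.1 p.1.2 p.2).
  by rewrite -chrE; exact: smooth_christoffel.
have [r [M [r0 M0 bM lM]]] := smooth_locally_lipschitz oU sf Ux.
(* Coordinates of the first-order system: positions on the left, velocities on the right. *)
pose K := ('I_n + 'I_n)%type.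
pose pos (y : K -> R) : V := \row_i clamp (x 0 i) r (y (inl i)).
pose vel (y : K -> R) i := clamp (v 0 i) 1 (y (inr i)).
pose F (y : K -> R) (o : K) := match o with
  | inl i => vel y i
  | inr k => - \sum_i \sum_j chr G (pos y) k i j * vel y i * vel y j
  end.
pose y0 (o : K) := match o with inl i => x 0 i | inr i => v 0 i end.
have posx y e : `|pos y 0 e - x 0 e| <= r.
  by rewrite mxE; apply: clamp_dist; exact: ltW.
have blv i : bounded_lipschitz (vel^~ i) by exact: bounded_lipschitz_clamp.
have blc k i j : bounded_lipschitz (fun y => chr G (pos y) k i j).
  exists (n%:R * M), M; split => //; first by rewrite mulr_ge0.
    by move=> y; have [_ /(_ (k, i, j))] := bM _ (posx y).
  move=> y z C yz; apply: (lM (k, i, j) (pos y) (pos z)) => // e.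
  by rewrite !mxE; apply: le_trans (yz (inl e)); exact: clamp_lipschitz.
have blF o : bounded_lipschitz (F^~ o).
  case: o => [i|k] /=; first exact: blv.
  apply: bounded_lipschitzN; apply: bounded_lipschitz_sum => i.
  apply: bounded_lipschitz_sum => j; apply: bounded_lipschitzM => //.
  exact: bounded_lipschitzM.
have [T T0 [y [yy0 cy dy]]] := picard_bounded_lipschitz y0 blF.
(* The radius of the position box is [r] and that of the velocity box is 1; below both of them no
   truncation takes place. *)
have near0 : \forall t \near (0 : R), forall o, `|y 0 o - y t o| < Order.min r 1.
  apply: (@filter_forall _ _ (fun o t => `|y 0 o - y t o| < Order.min r 1) (nbhs (0:R)) _).
  move=> o; have := cy o 0 => /cvgrPdist_lt; apply.
  by rewrite lt_min r0 ltr01.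
have [e e0 He] := (nbhs_ballP _ _).1 near0.
exists (Order.min e T); first by rewrite lt_min e0 T0.
exists (fun t i => y t (inl i)), (fun t i => y t (inr i)); split.
- by move=> i; rewrite yy0.
- by move=> i; rewrite yy0.
move=> t; rewrite lt_min => /andP[te tT].
have close o : `|y t o - y0 o| < Order.min r 1.
  by rewrite distrC -yy0; apply: He; rewrite -ball_normE /= sub0r normrN.
have posE : pos (y t) = \row_i y t (inl i).
  apply/rowP => i; rewrite !mxE clampK //; apply: ltW.
  by have := close (inl i); rewrite lt_min => /andP[].
have velE i : vel (y t) i = y t (inr i).
  by rewrite /vel clampK //; apply: ltW; have := close (inr i); rewrite lt_min => /andP[].
split.
- by rewrite -posE; have [] := bM _ (posx (y t)).
- by move=> i; have := dy t tT (inl i); rewrite /F velE.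
- move=> k; have := dy t tT (inr k); rewrite /F posE.
  by under eq_bigr do under eq_bigr do rewrite !velE.
Qed.

End GeodesicEquation.

(** * Symmetric bilinear maps whose values on the diagonal are proportional to the argument *)

Section Parallelism.
Context {R : realType} {n : nat}.
Variable D : 'I_n -> 'I_n -> 'I_n -> R.
Hypothesis symD : forall k i j, D k i j = D k j i.
Hypothesis parD : forall v : 'I_n -> R, exists l, forall k,
  \sum_i \sum_j D k i j * v i * v j = l * v k.

Lemma sum2_delta k i : \sum_a \sum_b D k a b * (a == i)%:R * (b == i)%:R = D k i i.
Proof.
rewrite (bigD1 i) //= [X in _ + X]big1 ?addr0; last first.
  by move=> a /negPf ai; rewrite big1 // => b _; rewrite ai mulr0 mul0r.
rewrite (bigD1 i) //= [X in _ + X]big1 ?addr0; first by rewrite eqxx !mulr1.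
by move=> b /negPf bi; rewrite bi mulr0.
Qed.

Lemma parallel_diag k i : k != i -> D k i i = 0.
Proof.
move=> /negPf ki; have [l /(_ k)] := parD (fun a => (a == i)%:R).
by rewrite sum2_delta ki mulr0.
Qed.

Lemma parallel_pair i j (s : R) : i != j -> exists l, forall k,
  D k i i + 2 * s * D k i j + s ^+ 2 * D k j j = l * ((k == i)%:R + s * (k == j)%:R).
Proof.
move=> ij; have [l H] := parD (fun a => (a == i)%:R + s * (a == j)%:R).
exists l => k; rewrite -H.
pose d (a b : 'I_n) : R := (a == b)%:R.
transitivity (\sum_a \sum_b (d a i * (d b i * D k a b + s * (d b j * D k a b))
   + s * (d a j * (d b i * D k a b + s * (d b j * D k a b))))); last first.
  by apply: eq_bigr => a _; apply: eq_bigr => b _; rewrite /d; ring.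
have S m (F : 'I_n -> R) : \sum_a d a m * F a = F m.
  rewrite -[RHS](sum_delta F m); apply: eq_bigr => a _; by rewrite /d eq_sym.
have E : forall a, \sum_b (d a i * (d b i * D k a b + s * (d b j * D k a b))
   + s * (d a j * (d b i * D k a b + s * (d b j * D k a b)))) =
   d a i * (D k a i + s * D k a j) + s * (d a j * (D k a i + s * D k a j)).
  move=> a; rewrite big_split /= -!mulr_sumr !big_split /= -!mulr_sumr.
  by rewrite !(S _ (fun b => D k a b)).
rewrite (eq_bigr _ (fun a _ => E a)) big_split /= -!mulr_sumr.
rewrite (S i (fun a => D k a i + s * D k a j)) (S j (fun a => D k a i + s * D k a j)).
by rewrite (symD k j i); ring.
Qed.

(** Testing on basis vectors [e_i] and on [e_i + e_j], [e_i - e_j] suffices: the two signs eliminate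
    the unknown proportionality factors and determine all the coefficients. *)
Lemma parallel_form :
  exists mu : 'I_n -> R, forall k i j,
    D k i j = (k == i)%:R * mu j + (k == j)%:R * mu i.
Proof.
(* On [e_i] the required formula reads [D i i i = 2 * mu i]. *)
exists (fun i => D i i i / 2) => k i j.
have [->|ij] := eqVneq i j.
  case: (boolP (k == j)) => [/eqP ->|kj]; first by rewrite /= mulr1n; field.
  by rewrite parallel_diag // mulr0n !mul0r addr0.
have ji : j != i by rewrite eq_sym.
have [l1 H1] := parallel_pair 1 ij; have [l2 H2] := parallel_pair (-1) ij.
have dii := parallel_diag ij; have djj := parallel_diag ji.
case: (boolP (k == i)) => [/eqP ki|ki].
  rewrite ki (negPf ij) /= mulr0n mulr1n mul0r addr0.
  have := H1 i; have := H1 j; have := H2 i; have := H2 j.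
  rewrite !eqxx (negPf ij) (negPf ji) dii djj.
  by move: (D j i j) (D i i j) (D i i i) (D j j j) => *; lra.
case: (boolP (k == j)) => [/eqP kj|kj].
  rewrite kj /= mulr0n mulr1n mul0r add0r.
  have := H1 i; have := H1 j; have := H2 i; have := H2 j.
  rewrite !eqxx (negPf ij) (negPf ji) dii djj.
  by move: (D j i j) (D i i j) (D i i i) (D j j j) => *; lra.
have := H1 k; rewrite (negPf ki) (negPf kj) (parallel_diag ki) (parallel_diag kj) /= !mul0r.
by move: (D k i j) => *; lra.
Qed.

End Parallelism.

Section Coordinate.
Context {R : realType} {n : nat}.
Local Notation V := 'rV[R]_n.

Lemma partial_coord (i j : 'I_n) (x : V) :
  partial j (fun y : V => y 0 i) x = (i == j)%:R.
Proof.
have dc : differentiable (fun y : V => y 0 i) x by exact: differentiable_coord.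
rewrite (partialE j dc) (@diff_coords R n V id x i) //.
by rewrite (diff_val (is_diff_def := is_diff_id x)) mxE eqxx.
Qed.

End Coordinate.

(** * Metrics on a manifold *)

Section Charts.
Context {R : realType} {n : nat}.
Variable M : manifold R n.
Local Notation V := 'rV[R]_n.
Implicit Types (c d : chart M) (x : V).

Lemma chart_imageP c x :
  chart_image c x -> chart_dom c (chart_inv c x) /\ chart_map c (chart_inv c x) = x.
Proof. by move=> [p cp <-]; rewrite chart_mapK. Qed.

Lemma open_chart_image c : open (chart_image c).
Proof. exact: chart_image_open. Qed.

Lemma overlapP c d x : overlap c d x <-> chart_image c x /\ chart_dom d (chart_inv c x).
Proof.
split=> [[p [cp dp] <-]|[cx dx]].
  by rewrite chart_mapK //; split => //; exists p.
have [h1 h2] := chart_imageP cx.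
by exists (chart_inv c x).
Qed.

Lemma overlap_open c d : open (overlap c d).
Proof.
rewrite openE => x /overlapP[cx dx]; rewrite /interior.
have n1 : \forall y \near x, chart_image c y.
  by apply: open_nbhs_nbhs; split => //; exact: open_chart_image.
have n2 : \forall y \near x, chart_dom d (chart_inv c y).
  apply: (chart_inv_continuous cx); apply: open_nbhs_nbhs; split => //.
  exact: chart_dom_open.
apply: (filterS2 _ _ n1 n2) => y cy dy; exact/overlapP.
Qed.

Lemma transition_overlap c d x : overlap c d x -> overlap d c (transition c d x).
Proof.
move=> [p [cp dp] <-]; rewrite /transition chart_mapK //.
by exists p.
Qed.

Lemma overlap_image c d x : overlap c d x -> chart_image c x.
Proof. by move=> /overlapP[]. Qed.

Lemma transition_image c d x : overlap c d x -> chart_image d (transition c d x).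
Proof. by move=> /transition_overlap /overlap_image. Qed.

Lemma transitionK c d x : overlap c d x -> transition d c (transition c d x) = x.
Proof. by move=> [p [cp dp] <-]; rewrite /transition !chart_mapK. Qed.

Lemma transition_inv c d x : overlap c d x ->
  chart_inv d (transition c d x) = chart_inv c x.
Proof. by move=> [p [cp dp] <-]; rewrite /transition !chart_mapK. Qed.

Lemma transition_smooth c d i : smooth_on (overlap c d) (fun x => transition c d x 0 i).
Proof. exact: chart_transition_smooth. Qed.

(** The two transition maps compose to the identity on the open overlap; differentiating there makes
    the two Jacobians inverse to each other. *)
Lemma transition_jacobian_unit c d x : overlap c d x ->
  jacobian_mx (transition c d) x \in unitmx.
Proof.
move=> ox; have ox' := transition_overlap ox.
have H : jacobian_mx (transition d c) (transition c d x) *m jacobian_mx (transition c d) x = 1%:M.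
  apply/matrixP => i j; rewrite !mxE -(partial_coord i j x).
  have ds e : differentiable (fun y => transition c d y 0 e) x.
    exact: smooth_diff (@transition_smooth c d e) ox.
  rewrite -(partial_open j (@overlap_open c d) (f := fun y => transition d c (transition c d y) 0 i)) //.
    rewrite (partial_comp (f := fun z => transition d c z 0 i) j ds); last first.
      exact: smooth_diff (@transition_smooth d c i) ox'.
    by apply: eq_bigr => e _; rewrite !mxE mulrC.
  by move=> y oy; rewrite transitionK.
by have [] := mulmx1_unit H.
Qed.

Lemma big_tuple0 (F : 0.-tuple 'I_n -> R) : \sum_t F t = F [tuple].
Proof. by rewrite (bigD1 [tuple]) //= big1 ?addr0 // => t /eqP[]; rewrite tuple0. Qed.

Lemma metric_matrix_on (g : metric M) c : metric_on (chart_image c) (metric_matrix g c).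
Proof.
split=> [i j|x cx|x cx].
- under eq_fun do rewrite mxE; exact: tensor_smooth.
- exact: metric_nondegenerate.
- apply/matrixP => i j; rewrite !mxE; apply: tensor_sym => //.
  by apply/seq.permP => a /=; rewrite addnCA.
Qed.

Lemma metric_matrix_transition (g : metric M) c d x : overlap c d x ->
  metric_matrix g c x = (jacobian_mx (transition c d) x)^T
    *m metric_matrix g d (transition c d x) *m jacobian_mx (transition c d) x.
Proof.
move=> ox; apply/matrixP => i j.
rewrite mxE (tensor_transition g [tuple i; j] ox) mul0r oppr0 powRr0 mul1r.
rewrite big_tuple_cons [RHS]mxE exchange_big /=.
rewrite big_tuple_cons; apply: eq_bigr => q _; rewrite big_tuple0.
rewrite [X in _ = X * _]mxE mulr_suml; apply: eq_bigr => p _.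
rewrite !big_ord_recl big_ord0 mulr1 [X in _ = X * _ * _]mxE [tensor_matrix _ _ _ _ _]mxE.
rewrite !(tnth_nth i) /= mulrAC; congr (_ * _ * _).
Qed.

Lemma metric_on_sub (U U' : set V) (G : V -> 'M[R]_n) :
  (forall x, U' x -> U x) -> metric_on U G -> metric_on U' G.
Proof.
move=> sub [s u t]; split => [i j s' x /sub|x /sub|x /sub]; [exact: s|exact: u|exact: t].
Qed.

End Charts.

(** * Curves in coordinates and geodesics on the manifold *)

Section Curves.
Context {R : realType} {n : nat}.
Local Notation V := 'rV[R]_n.

Lemma is_derive_row_comp (f : V -> R) (u : R -> 'I_n -> R) (w : 'I_n -> R) (t : R) :
  differentiable f (\row_i u t i) -> (forall i, is_derive t 1 (u^~ i) (w i)) ->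
  is_derive t 1 (fun s => f (\row_i u s i)) (\sum_e w e * partial e f (\row_i u t i)).
Proof.
move=> df du; pose r (s : R) : V := \row_i u s i.
have rE e : (fun s => r s 0 e) = u^~ e by apply/funext => s; rewrite mxE.
have dr : differentiable r t.
  apply: differentiable_row => e; rewrite rE; apply/derivable1_diffP.
  by have [] := du e.
have dfr : differentiable (fun s => f (r s)) t.
  exact: (@differentiable_comp _ _ _ _ r f).
apply: DeriveDef; first exact/derivable1_diffP.
rewrite (deriveE _ dfr) (@diff_comp _ _ _ _ r f) //= diff_row_sum //.
apply: eq_bigr => e _; congr (_ * _).
have dc := differentiable_coords e dr.
rewrite -diff_coords // -deriveE // rE.
by have [_ ->] := du e.
Qed.

Lemma is_derive_fun_sum (h : 'I_n -> R -> R) (t : R) (dh : 'I_n -> R) :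
  (forall i, is_derive t 1 (h i) (dh i)) ->
  is_derive t 1 (fun s => \sum_i h i s) (\sum_i dh i).
Proof.
move=> H; have -> : (fun s => \sum_i h i s) = \sum_i h i.
  by apply/funext => s; rewrite fct_sumE.
exact: is_derive_sum.
Qed.

Lemma is_derive_fun_mul (f h : R -> R) (t df dh : R) :
  is_derive t 1 f df -> is_derive t 1 h dh ->
  is_derive t 1 (fun s => f s * h s) (df * h t + f t * dh).
Proof.
move=> Hf Hh; have H : is_derive t 1 (fun s => f s * h s) (f t *: dh + h t *: df).
  exact: is_deriveM.
apply: (is_derive_eq H); by rewrite /GRing.scale /= addrC [h t * _]mulrC.
Qed.

Lemma row_path_continuous (u : R -> 'I_n -> R) (w : 'I_n -> R) (t : R) :
  (forall i, is_derive t 1 (u^~ i) (w i)) ->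
  {for t, continuous (fun s => \row_i u s i : V)}.
Proof.
move=> du; apply: differentiable_continuous; apply: differentiable_row => e.
have -> : (fun s => (\row_i u s i : V) 0 e) = u^~ e by apply/funext => s; rewrite mxE.
by apply/derivable1_diffP; have [] := du e.
Qed.

End Curves.

Section Geodesics.
Context {R : realType} {n : nat}.
Variable M : manifold R n.
Local Notation V := 'rV[R]_n.

(** The equation is solved in the chart [c]; in any other chart the second derivative of the curve
    acquires second derivatives of the transition map, which are the inhomogeneous part of the law
    of the Christoffel symbols. *)
Lemma geodesic_through (g : metric M) (c : chart M) (x v : V) : chart_image c x ->
  exists2 T : R, 0 < T & exists u w : R -> 'I_n -> R,
  [/\ geodesic g [set t | `|t| < T] (fun t => chart_inv c (\row_i u t i)),
    forall i, u 0 i = x 0 i, forall i, w 0 i = v 0 i &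
    forall t : R, `|t| < T ->
    [/\ chart_image c (\row_i u t i), forall i, is_derive t 1 (u^~ i) (w t i) &
      forall k, is_derive t 1 (w^~ k) (- \sum_i \sum_j
        christoffel (metric_matrix g c) (\row_i u t i) k i j * w t i * w t j)]].
Proof.
move=> cx; have mG := metric_matrix_on g c.
have [T T0 [u [w [u0 w0 ode]]]] := geodesic_ode v (@open_chart_image _ _ M c) mG cx.
exists T => //; exists u, w; rewrite chrE; split => //.
have itv : [set t : R | `|t| < T] = `](- T), T[%classic.
  by apply/seteqP; split => t /=; rewrite in_itv /= ltr_norml.
split.
- by rewrite itv; exact: interval_open.
- by rewrite itv; exact: interval_is_interval.
move=> t tT; have [ct du dw] := ode t tT.
have cr := row_path_continuous du.
split.
  by apply: continuous_comp; [exact: cr|exact: chart_inv_continuous].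
move=> d dt; have ot : overlap c d (\row_i u t i) by apply/overlapP.
have near_ov : \forall s \near t, overlap c d (\row_i u s i) /\ `|s| < T.
  have n1 : \forall s \near t, `|s| < T.
    by have := @norm_continuous R R t => /cvgr_lt; apply.
  have n2 : \forall s \near t, overlap c d (\row_i u s i).
    by apply: cr; apply: open_nbhs_nbhs; split => //; exact: overlap_open.
  by apply: filterS2 n2 n1.
pose phi := transition c d; pose J := jacobian_mx phi.
have sphi e : smooth_on (overlap c d) (fun y => phi y 0 e) by exact: transition_smooth.
have oO := @overlap_open _ _ M c d.
(* Position [U] and velocity [W] of the curve in the chart [d]; the acceleration [W'] below follows
   from the product rule and the equation in [c]. *)
pose U k s := phi (\row_i u s i) 0 k.
pose W k s := \sum_e w s e * J (\row_i u s i) k e.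
have dU k s : overlap c d (\row_i u s i) -> `|s| < T -> is_derive s 1 (U k) (W k s).
  move=> os sT; have [_ dus _] := ode s sT.
  apply: (is_derive_eq (is_derive_row_comp (smooth_diff (sphi k) os) dus)).
  by apply: eq_bigr => e _; rewrite mxE.
pose x_t : V := \row_i u t i.
pose W' k := \sum_e ((- \sum_i \sum_j christoffel (metric_matrix g c) x_t e i j * w t i * w t j)
    * J x_t k e + w t e * (\sum_f w t f * partial f (fun y => J y k e) x_t)).
have dW k : is_derive t 1 (W k) (W' k).
  apply: is_derive_fun_sum => e; apply: is_derive_fun_mul; first by rewrite chrE; exact: dw.
  apply: (is_derive_row_comp (f := fun y => J y k e)) => //.
  exact: (jacobian_diff sphi ot).
have dUW k : {near t, derive1 (U k) =1 W k}.
  apply: filterS near_ov => s [os sT].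
  by rewrite derive1E; have [_ ->] := dU k s os sT.
have dUt k := dU k t ot tT.
have d2 k : is_derive t 1 (derive1 (U k)) (W' k).
  by apply: near_eq_is_derive (dW k); apply: filterS (dUW k) => s ->.
move=> /= k; split; first by have [] := dUt k.
  by have [] := d2 k.
rewrite -/(U k); have -> : derive1 (derive1 (U k)) t = W' k.
  by rewrite derive1E; have [_ ->] := d2 k.
have D1 i : derive1 (fun s => chart_map d (chart_inv c (\row_i u s i)) 0 i) t = W i t.
  by rewrite derive1E; have [_ ->] := dUt i.
under eq_bigr do under eq_bigr do rewrite !D1.
rewrite -/(transition c d x_t) -/phi.
have sub y : overlap c d y -> chart_image c y by exact: overlap_image.
have mG1 := metric_on_sub sub mG.
have mH := metric_matrix_on g d.
have law i j : \sum_e J x_t k e * christoffel (metric_matrix g c) x_t e i j =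
    dmx i J x_t k j + \sum_r \sum_s christoffel (metric_matrix g d) (phi x_t) k r s
      * J x_t r i * J x_t s j.
  apply: (christoffel_pullback oO (@open_chart_image _ _ M d) sphi _ _ mG1 mH _ _ _ _ ot).
  - by move=> y; exact: transition_image.
  - by move=> y; exact: transition_jacobian_unit.
  - by move=> y; exact: metric_matrix_transition.
rewrite chrE in law *.
have E1 : \sum_e (- \sum_i \sum_j chr (metric_matrix g c) x_t e i j * w t i * w t j) * J x_t k e =
    - \sum_i \sum_j (\sum_e J x_t k e * chr (metric_matrix g c) x_t e i j) * (w t i * w t j).
  under eq_bigr do rewrite mulNr mulr_suml.
  rewrite sumrN exchange_big; congr (- _); apply: eq_bigr => i _ /=.
  under eq_bigr do rewrite mulr_suml.
  rewrite exchange_big; apply: eq_bigr => j _ /=; rewrite mulr_suml.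
  by apply: eq_bigr => e _; move: (chr _ _ _ _ _) => z; ring.
have E2 : \sum_e w t e * (\sum_f w t f * partial f (fun y => J y k e) x_t) =
    \sum_i \sum_j dmx i J x_t k j * (w t i * w t j).
  under eq_bigr do rewrite mulr_sumr.
  rewrite exchange_big; apply: eq_bigr => i _ /=; apply: eq_bigr => j _.
  by rewrite [dmx _ _ _ _ _]mxE pdE; move: (pd _ _ _) => z; ring.
have E3 : \sum_i \sum_j (\sum_r \sum_s chr (metric_matrix g d) (phi x_t) k r s
      * J x_t r i * J x_t s j) * (w t i * w t j) =
    \sum_r \sum_s chr (metric_matrix g d) (phi x_t) k r s * W r t * W s t.
  under eq_bigr do under eq_bigr do rewrite mulr_suml.
  under eq_bigr do rewrite exchange_big /=.
  rewrite exchange_big; apply: eq_bigr => r _ /=.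
  under eq_bigr do under eq_bigr do rewrite mulr_suml.
  under eq_bigr do rewrite exchange_big /=.
  rewrite exchange_big; apply: eq_bigr => s _ /=.
  rewrite /W -mulrA mulr_suml mulr_sumr; apply: eq_bigr => i _.
  rewrite !mulr_sumr; apply: eq_bigr => j _.
  by move: (chr _ _ _ _ _) => z; rewrite -/x_t; ring.
rewrite /W' big_split /= chrE E1 E2 -E3 -addrA addrC; apply/eqP.
rewrite subr_eq0 -big_split; apply/eqP; apply: eq_bigr => i _ /=.
by rewrite -big_split; apply: eq_bigr => j _; rewrite law mulrDl.
Qed.

End Geodesics.

(** * From common geodesics to Christoffel symbols *)

Section ProjectiveEquivalence.
Context {R : realType} {n : nat}.
Variable M : manifold R n.
Local Notation V := 'rV[R]_n.
Implicit Types g h : metric M.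

Lemma projectively_equivalent_refl g : projectively_equivalent g g.
Proof.
have H : geodesics_reparametrise g g.
  move=> I gam geo; exists I, id; split => //.
  have [oI iI _] := geo; split => //.
  - by rewrite image_id.
  - move=> t It; rewrite derive1_id; split; first exact: oner_neq0.
    have d1 : derive1n 1 (id : R -> R) = (fun=> 1).
      by apply/funext => s; rewrite derive1n1 derive1_id.
    case=> [|k]; first by rewrite derive1n0; exact: derivable_id.
    have dk : exists a : R, derive1n k.+1 (id : R -> R) = (fun=> a).
      elim: k => [|k [a IH]]; first by exists 1.
      exists 0; rewrite derive1nS IH; apply/funext => s.
      exact: derive1_cst.
    by have [a ->] := dk; exact: derivable_cst.
by split.
Qed.

(** The geodesic of [g] through [x] with velocity [v] is, after a reparametrisation, a geodesic of
    [h]. Comparing the two equations at [x], the difference of the Christoffel terms is balanced by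
    the part of the second derivative that is tangent to the curve. *)
Lemma geodesic_equation_parallel g h c (x v : V) :
  geodesics_reparametrise g h -> chart_image c x ->
  exists l : R, forall k, \sum_i \sum_j
    (christoffel (metric_matrix h c) x k i j - christoffel (metric_matrix g c) x k i j)
    * v 0 i * v 0 j = l * v 0 k.
Proof.
move=> gh cx.
have [T T0 [u [w [geo u0 w0 ode]]]] := geodesic_through g v cx.
have [J [phi [[oJ _ JI dphi] [_ _ geoh]]]] := gh _ _ geo.
(* The reparametrisation is onto, so some parameter is sent to 0, where the curve passes through [x]
   with velocity [v]. *)
have [s0 Js0 phi0] : exists2 s0, J s0 & phi s0 = 0.
  have : [set t : R | `|t| < T] 0 by rewrite /= normr0.
  by rewrite -JI => -[s Js <-]; exists s.
have ins s : J s -> `|phi s| < T.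
  by move=> Js; have : [set t : R | `|t| < T] (phi s) by rewrite -JI; exists s.
have d1 s : J s -> is_derive s 1 phi (derive1 phi s).
  by move=> Js; rewrite derive1E; have [_ /(_ 0%N)] := dphi s Js; rewrite derive1n0 => /derivableP.
have d2 s : J s -> is_derive s 1 (derive1 phi) (derive1 (derive1 phi) s).
  by move=> Js; rewrite [derive1 (derive1 _) _]derive1E; have [_ /(_ 1%N)] := dphi s Js; rewrite derive1n1 => /derivableP.
set p := derive1 phi s0; set q := derive1 (derive1 phi) s0.
have p0 : p != 0 by have [] := dphi s0 Js0.
have u0E : \row_i u 0 i = x by apply/rowP => i; rewrite mxE.
have [_ geo0] := geoh s0 Js0.
have cgam : chart_dom c (chart_inv c (\row_i u (phi s0) i)).
  by rewrite phi0 u0E; have [] := chart_imageP cx.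
have {geo0} eqn := geo0 c cgam.
pose W i s := chart_map c (chart_inv c (\row_j u (phi s) j)) 0 i.
have WE i s : J s -> W i s = u (phi s) i.
  move=> Js; have [cu _ _] := ode _ (ins s Js).
  by rewrite /W /=; have [_ ->] := chart_imageP cu; rewrite mxE.
have nJ s : J s -> \forall r \near s, J r by move=> Js; exact: open_nbhs_nbhs.
have dcomp (f : R -> R) (a b s : R) : is_derive s 1 phi a -> is_derive (phi s) 1 f b ->
    is_derive s 1 (f \o phi) (b * a).
  move=> [da ea] [db eb]; have := derive1_comp da db; rewrite !derive1E ea eb => E.
  apply: DeriveDef; last exact: E.
  apply/derivable1_diffP; apply: differentiable_comp; exact/derivable1_diffP.
have dW i s : J s -> is_derive s 1 (W i) (w (phi s) i * derive1 phi s).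
  move=> Js; have [_ du _] := ode _ (ins s Js).
  apply: near_eq_is_derive (dcomp _ _ _ _ (d1 s Js) (du i)).
  by apply: filterS (nJ s Js) => r Jr; rewrite WE.
have dW1 i s : J s -> derive1 (W i) s = w (phi s) i * derive1 phi s.
  by move=> Js; rewrite derive1E; have [_ ->] := dW i s Js.
have T0' : `|0 : R| < T by rewrite normr0.
have [_ _ dw0] := ode 0 T0'.
have d2W k : derive1 (derive1 (W k)) s0 =
    (- \sum_i \sum_j christoffel (metric_matrix g c) x k i j * v 0 i * v 0 j) * p * p + v 0 k * q.
  have dw : is_derive (phi s0) 1 (w^~ k)
    (- \sum_i \sum_j christoffel (metric_matrix g c) x k i j * v 0 i * v 0 j).
    rewrite phi0; have := dw0 k; rewrite u0E.
    by under eq_bigr do under eq_bigr do rewrite !w0.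
  have := is_derive_fun_mul (dcomp _ _ _ _ (d1 s0 Js0) dw) (d2 s0 Js0).
  rewrite /= phi0 w0 -/p -/q => H.
  rewrite derive1E.
  have H' : is_derive s0 1 (derive1 (W k))
     ((- \sum_i \sum_j christoffel (metric_matrix g c) x k i j * v 0 i * v 0 j) * p * p + v 0 k * q).
    by apply: near_eq_is_derive H; apply: filterS (nJ s0 Js0) => r Jr; rewrite dW1.
  by have [_ ->] := H'.
have cmap : chart_map c (chart_inv c (\row_i u (phi s0) i)) = x.
  by rewrite phi0 u0E; have [] := chart_imageP cx.
(* By the chain rule the second derivative of [u] along [phi] is [p ^+ 2] times that of [u] plus [q]
   times [v]; dividing the equation of [h] by [p ^+ 2] leaves this factor. *)
exists (- q / p ^+ 2) => k.
have : derive1 (derive1 (W k)) s0 + \sum_i \sum_j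
    christoffel (metric_matrix h c) x k i j * derive1 (W i) s0 * derive1 (W j) s0 = 0.
  by have [_ _] := eqn k; rewrite /= cmap.
rewrite d2W.
have dW0 i : derive1 (W i) s0 = v 0 i * p by rewrite dW1 // phi0 w0.
rewrite chrE.
have -> : \sum_i \sum_j chr (metric_matrix h c) x k i j * derive1 (W i) s0 * derive1 (W j) s0 =
   p ^+ 2 * \sum_i \sum_j chr (metric_matrix h c) x k i j * v 0 i * v 0 j.
  rewrite mulr_sumr; apply: eq_bigr => i _; rewrite mulr_sumr; apply: eq_bigr => j _.
  by rewrite !dW0; move: (chr _ _ _ _ _) => z; ring.
have -> : \sum_i \sum_j (chr (metric_matrix h c) x k i j - chr (metric_matrix g c) x k i j)
     * v 0 i * v 0 j = \sum_i \sum_j chr (metric_matrix h c) x k i j * v 0 i * v 0 j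
   - \sum_i \sum_j chr (metric_matrix g c) x k i j * v 0 i * v 0 j.
  by rewrite -sumrB; apply: eq_bigr => i _; rewrite -sumrB; apply: eq_bigr => j _; rewrite !mulrBl.
move: (\sum_i _) (\sum_i _) => A B E.
have p2 : p ^+ 2 != 0 by rewrite expf_neq0.
apply: (mulfI p2); rewrite mulrAC mulrA mulrCA mulfV // mulr1.
clearbody p q; move: E; lra.
Qed.

(** The difference of the Christoffel symbols satisfies the hypotheses of [parallel_form], and its
    trace identifies the form found there with [projective_form]. *)
Lemma projective_christoffel g h c x k i j :
  geodesics_reparametrise g h -> chart_image c x ->
  christoffel (metric_matrix h c) x k i j = christoffel (metric_matrix g c) x k i j
    + ((k == i)%:R * projective_form (metric_matrix g c) (metric_matrix h c) j x
       + (k == j)%:R * projective_form (metric_matrix g c) (metric_matrix h c) i x).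
Proof.
move=> gh cx.
pose D k i j := christoffel (metric_matrix h c) x k i j - christoffel (metric_matrix g c) x k i j.
have oc := @open_chart_image _ _ M c.
have symD k' i' j' : D k' i' j' = D k' j' i'.
  rewrite /D (christoffel_sym oc (metric_matrix_on g c) _ _ _ cx).
  by rewrite (christoffel_sym oc (metric_matrix_on h c) _ _ _ cx).
have parD (v : 'I_n -> R) : exists l, forall k, \sum_i \sum_j D k i j * v i * v j = l * v k.
  have [l Hl] := geodesic_equation_parallel (\row_i v i) gh cx; exists l => k'.
  have := Hl k'; rewrite mxE => <-.
  by apply: eq_bigr => a _; apply: eq_bigr => b _; rewrite !mxE.
have [mu muE] := parallel_form symD parD.
have muP a : projective_form (metric_matrix g c) (metric_matrix h c) a x = mu a.
  rewrite /projective_form /christoffel_trace -sumrB.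
  have -> : \sum_(d < n) (christoffel (metric_matrix h c) x d a d
      - christoffel (metric_matrix g c) x d a d) = n.+1%:R * mu a.
    rewrite (eq_bigr (fun d => (d == a)%:R * mu d + mu a)); last first.
      by move=> d _; rewrite -/(D d a d) muE eqxx mul1r.
    rewrite big_split /= sumr_const card_ord -[n.+1]add1n natrD mulrDl mul1r mulr_natl.
    congr (_ + _); rewrite -[RHS](sum_delta mu a).
    by apply: eq_bigr => d _; rewrite eq_sym.
  by rewrite mulKf // pnatr_eq0.
by rewrite !muP -muE /D addrC subrK.
Qed.

End ProjectiveEquivalence.

(** * The function B as a chart-independent eigenvalue *)

Section NullityEigenvalue.
Context {R : realType} {n : nat}.
Variable M : manifold R n.
Local Notation V := 'rV[R]_n.
Implicit Types g h : metric M.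

Lemma chart_eigenvalue_transition g c d x b : overlap c d x ->
  (forall v, in_nullity (metric_matrix g d) (transition c d x) v ->
     forall k, schouten_contract (metric_matrix g d) (transition c d x) v k =
       b * lower (metric_matrix g d) (transition c d x) v k) ->
  forall v, in_nullity (metric_matrix g c) x v ->
    forall k, schouten_contract (metric_matrix g c) x v k = b * lower (metric_matrix g c) x v k.
Proof.
move=> ox H v nv.
have sub y : overlap c d y -> chart_image c y by exact: overlap_image.
have oO := @overlap_open _ _ M c d; have oI := @open_chart_image _ _ M d.
have mG := metric_on_sub sub (metric_matrix_on g c); have mG' := metric_matrix_on g d.
have sphi e := @transition_smooth _ _ M c d e.
have ti y : overlap c d y -> chart_image d (transition c d y) by exact: transition_image.
have uJ y : overlap c d y -> jacobian_mx (transition c d) y \in unitmx.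
  exact: transition_jacobian_unit.
have GE y (oy : overlap c d y) := metric_matrix_transition g oy.
apply: (eigenvalue_pushforward oO oI sphi ti uJ mG mG' GE ox).
by apply: H; apply: (in_nullity_pushforward oO oI sphi ti uJ mG mG' GE ox).
Qed.

(** The point is that the set from which [nullity_eigenvalue] selects is nonempty, although its
    condition ranges over all charts around the point. *)
Lemma nullity_eigenvalue_chart g c x v : chart_image c x ->
  in_nullity (metric_matrix g c) x v ->
  forall k, schouten_contract (metric_matrix g c) x v k =
    nullity_eigenvalue g (chart_inv c x) * lower (metric_matrix g c) x v k.
Proof.
move=> cx; have [cp cpx] := chart_imageP cx; set p := chart_inv c x in cp cpx *.
pose S := [set b : R | forall d : chart M, chart_dom d p ->
    forall v, in_nullity (metric_matrix g d) (chart_map d p) v ->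
    forall i, \sum_(j < n) schouten_up (metric_matrix g d) (chart_map d p) i j * v 0 j
      = b * v 0 i].
suff [b Sb] : S !=set0.
  have Sg : S (nullity_eigenvalue g p) by rewrite /nullity_eigenvalue; exact: (xgetI 0 Sb).
  move=> nv; apply/(schouten_upP (@open_chart_image _ _ M c) (metric_matrix_on g c) _ _ cx).
  by have := Sg c cp v; rewrite cpx; apply.
(* An eigenvalue found in one chart [d] serves in every chart [e], since nullity vectors are pushed
   forward from [e] to [d]. *)
have [d dp] := chart_cover p.
have dx : chart_image d (chart_map d p) by exists p.
have [b Hb] := nullity_eigenvalue_exists (@open_chart_image _ _ M d) (metric_matrix_on g d) dx.
exists b => e ep u nu.
have ex : chart_image e (chart_map e p) by exists p.
apply/(schouten_upP (@open_chart_image _ _ M e) (metric_matrix_on g e) _ _ ex).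
have oed : overlap e d (chart_map e p) by exists p.
apply: (chart_eigenvalue_transition oed) nu.
by rewrite /transition chart_mapK.
Qed.

Lemma hessian_eigenvalue (n_ge2 : (2 <= n)%N) g h c x (v : V) j l :
  geodesics_reparametrise g h -> chart_image c x -> v != 0 ->
  in_nullity (metric_matrix g c) x v ->
  projective_hessian (metric_matrix g c) (metric_matrix h c) j l x =
  nullity_eigenvalue g (chart_inv c x) * metric_matrix g c x j l
  - nullity_eigenvalue h (chart_inv c x) * metric_matrix h c x j l.
Proof.
move=> gh cx v0 nv.
have oc := @open_chart_image _ _ M c.
have mG := metric_matrix_on g c; have mH := metric_matrix_on h c.
have GH y k i j' (cy : chart_image c y) := projective_christoffel k i j' gh cy.
apply: (eigenvalue_projective_change n_ge2 oc mG mH GH j l cx v0 nv).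
  exact: nullity_eigenvalue_chart.
apply: nullity_eigenvalue_chart => //.
exact: (in_nullity_projective_change n_ge2 oc mG mH GH cx nv).
Qed.

End NullityEigenvalue.

(** * Linear differential operators *)

Section DifferentialOperators.
Context {R : realType} {n : nat}.
Local Notation V := 'rV[R]_n.
Variables (D : Type) (sec : D -> V -> R) (U : set V).
Hypothesis oU : open U.
Hypothesis ssec : forall s, smooth_on U (sec s).

(** The coefficients are indexed by lists of arbitrary length, so that a differentiation can put an
    index in front without a change of type. [D] stands for the densities and [sec] for their local
    components. *)
Definition local_operator (N : nat) (P : D -> V -> R) : Prop :=
  exists A : seq 'I_n -> V -> R, (forall s, smooth_on U (A s)) /\
  forall sigma x, U x -> P sigma x =
    \sum_(j < N.+1) \sum_(s : j.-tuple 'I_n) A s x * iter_partial s (sec sigma) x.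

Lemma smooth_iter_partial f s : smooth_on U f -> smooth_on U (iter_partial s f).
Proof. by move=> sf; elim: s => //= i s; exact: smooth_partial. Qed.

Lemma local_operator_ext N P Q : (forall sigma x, U x -> P sigma x = Q sigma x) ->
  local_operator N P -> local_operator N Q.
Proof. by move=> PQ [A [sA PA]]; exists A; split => // s x Ux; rewrite -PQ ?PA. Qed.

Lemma local_operator_id : local_operator 0 sec.
Proof.
exists (fun s => if s is [::] then fun=> 1 else fun=> 0); split.
  by case=> [|i s]; exact: smooth_cst.
by move=> sigma x Ux; rewrite big_ord1 big_tuple0 mul1r.
Qed.

Lemma local_operatorD N P Q : local_operator N P -> local_operator N Q ->
  local_operator N (fun sigma x => P sigma x + Q sigma x).
Proof.
move=> [A [sA PA]] [B [sB QB]]; exists (fun s x => A s x + B s x); split.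
  by move=> s; exact: smoothD.
move=> sigma x Ux; rewrite PA // QB // -big_split; apply: eq_bigr => j _ /=.
by rewrite -big_split; apply: eq_bigr => s _ /=; rewrite mulrDl.
Qed.

Lemma local_operatorM N P f : smooth_on U f -> local_operator N P ->
  local_operator N (fun sigma x => f x * P sigma x).
Proof.
move=> sf [A [sA PA]]; exists (fun s x => f x * A s x); split.
  by move=> s; exact: smoothM.
move=> sigma x Ux; rewrite PA // mulr_sumr; apply: eq_bigr => j _ /=.
by rewrite mulr_sumr; apply: eq_bigr => s _ /=; rewrite mulrA.
Qed.

Lemma local_operatorB N P Q : local_operator N P -> local_operator N Q ->
  local_operator N (fun sigma x => P sigma x - Q sigma x).
Proof.
move=> lP lQ; apply: (@local_operator_ext N (fun sigma x => P sigma x + -1 * Q sigma x)).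
  by move=> sigma x _; rewrite mulN1r.
by apply: local_operatorD => //; apply: local_operatorM => //; exact: smooth_cst.
Qed.

Lemma local_operator_sum N (I : finType) (P : I -> D -> V -> R) :
  (forall i, local_operator N (P i)) ->
  local_operator N (fun sigma x => \sum_i P i sigma x).
Proof.
move=> /choice[A HA]; exists (fun s x => \sum_i A i s x); split.
  by move=> s; apply: (smooth_sum oU) => i _; have [] := HA i.
move=> sigma x Ux.
under eq_bigr => i _ do rewrite (HA i).2 //.
rewrite exchange_big; apply: eq_bigr => j _ /=.
by rewrite exchange_big; apply: eq_bigr => s _ /=; rewrite mulr_suml.
Qed.

Lemma local_operator_widen N P : local_operator N P -> local_operator N.+1 P.
Proof.
(* The coefficients of lists longer than [N] are arbitrary in the hypothesis and must be reset to
   zero before the order is raised. *)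
move=> [A [sA PA]]; exists (fun s => if (size s <= N)%N then A s else fun=> 0); split.
  by move=> s; case: ifP => _ //; exact: smooth_cst.
move=> sigma x Ux; rewrite PA // [RHS]big_ord_recr /= [X in _ + X]big1 ?addr0.
  by apply: eq_bigr => j _; apply: eq_bigr => s _; rewrite size_tuple -ltnS ltn_ord.
by move=> s _; rewrite size_tuple ltnn mul0r.
Qed.

(** Leibniz rule: the derivative falls either on a coefficient, which keeps the order, or on the
    section, where it prepends the index [a]. *)
Lemma local_operator_partial N P a : local_operator N P ->
  local_operator N.+1 (fun sigma x => pd a (P sigma) x).
Proof.
move=> [A [sA PA]].
(* [B] collects the differentiated coefficients, cut off at the old order; [C] moves the coefficient
   of [s'] to the list [a :: s']. *)
pose B s x : R := if (size s <= N)%N then partial a (A s) x else 0.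
pose C s x : R := if s is b :: s' then (a == b)%:R * A s' x else 0.
exists (fun s x => B s x + C s x); split.
  move=> s; apply: (smoothD oU).
    rewrite /B; case: (size s <= N)%N; last exact: smooth_cst.
    exact: smooth_partial.
  case: s => [|b s]; first exact: smooth_cst.
  by apply: (smoothM oU) => //; exact: smooth_cst.
move=> sigma x Ux.
have sit s : smooth_on U (iter_partial s (sec sigma)) by exact: smooth_iter_partial.
have dA s : differentiable (A s) x := smooth_diff (sA s) Ux.
have dit s : differentiable (iter_partial s (sec sigma)) x := smooth_diff (sit s) Ux.
rewrite -pdE (partial_open a oU (PA sigma) Ux).
rewrite partial_sum; last by move=> j _; apply: df_sum => s _; exact: dfM.
transitivity (\sum_(j < N.+1) \sum_(s : j.-tuple 'I_n) partial a (A s) x * iter_partial s (sec sigma) x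
  + \sum_(j < N.+1) \sum_(s : j.-tuple 'I_n) A s x * iter_partial (a :: s) (sec sigma) x).
  rewrite -big_split; apply: eq_bigr => j _ /=.
  rewrite partial_sum -?big_split; last by move=> s _; exact: dfM.
  by apply: eq_bigr => s _ /=; rewrite partialM.
transitivity (\sum_(j < N.+2) \sum_(s : j.-tuple 'I_n) B s x * iter_partial s (sec sigma) x
  + \sum_(j < N.+2) \sum_(s : j.-tuple 'I_n) C s x * iter_partial s (sec sigma) x); last first.
  rewrite -big_split; apply: eq_bigr => j _ /=; rewrite -big_split.
  by apply: eq_bigr => s _ /=; rewrite mulrDl.
congr (_ + _).
  rewrite [RHS]big_ord_recr /= [X in _ = _ + X]big1 ?addr0; last first.
    by move=> s _; rewrite /B size_tuple ltnn mul0r.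
  apply: eq_bigr => j _; apply: eq_bigr => s _.
  by rewrite /B size_tuple -ltnS ltn_ord.
rewrite [RHS]big_ord_recl big_tuple0 mul0r add0r.
transitivity (\sum_(j < N.+1) \sum_(s : j.+1.-tuple 'I_n) C s x * iter_partial s (sec sigma) x);
  last by [].
apply: eq_bigr => j _; rewrite big_tuple_cons /=.
rewrite -(sum_delta (fun b => \sum_(s : j.-tuple 'I_n) A s x * iter_partial (b :: s) (sec sigma) x) a).
by apply: eq_bigr => b _; rewrite mulr_sumr; apply: eq_bigr => s _; rewrite mulrA.
Qed.

Variable G : V -> 'M[R]_n.
Hypothesis mG : metric_on U G.

Lemma local_operator_nabla0 N w P a : local_operator N P ->
  local_operator N.+1 (fun sigma => nabla0 G w (P sigma) a).
Proof.
move=> lP; apply: local_operatorD; first exact: local_operator_partial.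
apply: local_operator_widen.
apply: (@local_operatorM N P (fun x => w / n.+1%:R * christoffel_trace G a x)) => //.
by apply: (smoothM oU); [exact: smooth_cst|exact: smooth_christoffel_trace].
Qed.

Let smooth_chr e a b : smooth_on U (fun x => chr G x e a b).
Proof. by rewrite -chrE; exact: smooth_christoffel. Qed.

Lemma local_operator_nabla1 N w (P : 'I_n -> D -> V -> R) a b :
  (forall c, local_operator N (P c)) ->
  local_operator N.+1 (fun sigma => nabla1 G w (fun c => P c sigma) a b).
Proof.
move=> lP; apply: local_operatorB; first exact: local_operator_nabla0.
apply: local_operator_widen; apply: local_operator_sum => e.
exact: (@local_operatorM N (P e) (fun x => chr G x e a b)).
Qed.

Lemma local_operator_nabla2 N w (P : 'I_n -> 'I_n -> D -> V -> R) a b c :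
  (forall d e, local_operator N (P d e)) ->
  local_operator N.+1 (fun sigma => nabla2 G w (fun d e => P d e sigma) a b c).
Proof.
move=> lP; apply: local_operatorB; first exact: local_operator_nabla0.
apply: local_operator_widen; apply: local_operatorD; apply: local_operator_sum => e.
  exact: (@local_operatorM N (P e c) (fun x => chr G x e a b)).
exact: (@local_operatorM N (P b e) (fun x => chr G x e a c)).
Qed.

End DifferentialOperators.

Section Tuples.
Variables (T : Type).

Lemma tuple2_eta (s : 2.-tuple T) : s = [tuple tnth s ord0; tnth s (inord 1)].
Proof.
apply: eq_from_tnth => -[[|[|//]] lt]; congr (tnth s _); apply: val_inj => //=.
by rewrite inordK.
Qed.

Lemma tuple3_eta (s : 3.-tuple T) :
  s = [tuple tnth s ord0; tnth s (inord 1); tnth s (inord 2)].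
Proof.
by apply: eq_from_tnth => -[[|[|[|//]]] lt]; congr (tnth s _); apply: val_inj => //=;
  rewrite inordK.
Qed.

End Tuples.

(** * Symmetrisation over three indices and its compatibility with pullback *)

Section Symmetrisation.
Context {R : realType} {n : nat}.

Lemma perm_eq_pair (T : eqType) (a b c d : T) : perm_eq [:: a; b] [:: c; d] ->
  (a = c /\ b = d) \/ (a = d /\ b = c).
Proof.
move=> H; have : a \in [:: c; d] by rewrite -(perm_mem H) mem_head.
rewrite !inE => /orP[/eqP ac|/eqP ad]; [left|right]; split => //.
  move: H; rewrite ac perm_cons => /perm_small_eq => /(_ isT) [].
  by [].
have : perm_eq [:: a; b] [:: d; c].
  by apply: perm_trans H _; apply/seq.permP => p /=; rewrite addnCA.
by rewrite ad perm_cons => /perm_small_eq => /(_ isT) [].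
Qed.

Lemma sym3_ext (F F' : 'I_n -> 'I_n -> 'I_n -> R) a b c :
  (forall i j k, F i j k = F' i j k) -> sym3 F a b c = sym3 F' a b c.
Proof. by move=> E; rewrite /sym3 !E. Qed.

Lemma sym3_swap12 (F : 'I_n -> 'I_n -> 'I_n -> R) a b c : sym3 F a b c = sym3 F b a c.
Proof. by rewrite /sym3; congr (_ * _); ring. Qed.

Lemma sym3_swap23 (F : 'I_n -> 'I_n -> 'I_n -> R) a b c : sym3 F a b c = sym3 F a c b.
Proof. by rewrite /sym3; congr (_ * _); ring. Qed.

(** Two adjacent transpositions generate all permutations; the cases are the place of [a] among [d],
    [e] and [f]. *)
Lemma sym3_perm (F : 'I_n -> 'I_n -> 'I_n -> R) a b c d e f :
  perm_eq [:: a; b; c] [:: d; e; f] -> sym3 F a b c = sym3 F d e f.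
Proof.
move=> H; have : a \in [:: d; e; f] by rewrite -(perm_mem H) mem_head.
rewrite !inE => /or3P[] /eqP E; rewrite E in H *.
- by move: H; rewrite perm_cons => /perm_eq_pair[[-> ->]|[-> ->]] //; exact: sym3_swap23.
- have : perm_eq [:: e; b; c] [:: e; d; f].
    by apply: perm_trans H _; apply/seq.permP => p /=; rewrite addnCA.
  rewrite perm_cons => /perm_eq_pair[[-> ->]|[-> ->]]; first exact: sym3_swap12.
  by rewrite sym3_swap23 sym3_swap12.
- have : perm_eq [:: f; b; c] [:: f; d; e].
    by apply: perm_trans H _; apply/seq.permP => p /=; ring.
  rewrite perm_cons => /perm_eq_pair[[-> ->]|[-> ->]].
    by rewrite sym3_swap12 sym3_swap23.
  by rewrite sym3_swap23 sym3_swap12 sym3_swap23.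
Qed.

Variables (J : 'I_n -> 'I_n -> R) (om : R).

(** The transformation law in rank 3 with three separate sums, for which a permutation of the
    indices is an exchange of sums. *)
Definition pulls_back3 (F F' : 'I_n -> 'I_n -> 'I_n -> R) : Prop := forall i j k,
  F i j k = om * \sum_a \sum_b \sum_c J a i * J b j * J c k * F' a b c.

Lemma pulls_back3_swap12 F F' : pulls_back3 F F' ->
  pulls_back3 (fun i j k => F j i k) (fun i j k => F' j i k).
Proof.
move=> H i j k; rewrite H exchange_big; congr (_ * _).
apply: eq_bigr => a _; apply: eq_bigr => b _; apply: eq_bigr => c _.
by rewrite [J b j * _]mulrC.
Qed.

Lemma pulls_back3_swap23 F F' : pulls_back3 F F' ->
  pulls_back3 (fun i j k => F i k j) (fun i j k => F' i k j).
Proof.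
move=> H i j k; rewrite H; congr (_ * _); apply: eq_bigr => a _.
rewrite exchange_big; apply: eq_bigr => b _; apply: eq_bigr => c _.
by rewrite [_ * J c k * _]mulrAC.
Qed.

Lemma pulls_back3D F F' H H' : pulls_back3 F F' -> pulls_back3 H H' ->
  pulls_back3 (fun i j k => F i j k + H i j k) (fun i j k => F' i j k + H' i j k).
Proof.
move=> pF pH i j k; rewrite pF pH -mulrDr; congr (_ * _).
rewrite -big_split; apply: eq_bigr => a _; rewrite -big_split; apply: eq_bigr => b _.
by rewrite -big_split; apply: eq_bigr => c _ /=; rewrite mulrDr.
Qed.

Lemma pulls_back3_sym3 F F' : pulls_back3 F F' -> pulls_back3 (sym3 F) (sym3 F').
Proof.
move=> pF; have p23 := pulls_back3_swap23 pF; have p12 := pulls_back3_swap12 pF.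
have pbca := pulls_back3_swap12 p23; have pcab := pulls_back3_swap23 p12.
have pcba := pulls_back3_swap23 pbca.
have S := pulls_back3D (pulls_back3D (pulls_back3D (pulls_back3D (pulls_back3D pF p23) p12)
  pbca) pcab) pcba.
move=> i j k; rewrite /sym3 S mulrCA; congr (_ * _); rewrite mulr_sumr.
apply: eq_bigr => a _; rewrite mulr_sumr; apply: eq_bigr => b _; rewrite mulr_sumr.
by apply: eq_bigr => c _; rewrite [RHS]mulrCA.
Qed.

End Symmetrisation.

(** * Sums, scalar multiples and products with the metric under pullback *)

Section PullbackAlgebra.
Context {R : realType} {n : nat}.
Local Notation V := 'rV[R]_n.
Variables (phi : V -> V) (w : R).
Local Notation J := (jacobian_mx phi).

Lemma pulls_backD k (T S T' S' : @components R n k) x :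
  pulls_back phi w T T' x -> pulls_back phi w S S' x ->
  pulls_back phi w (fun y s => T y s + S y s) (fun y s => T' y s + S' y s) x.
Proof.
move=> pT pS s; rewrite pT pS -mulrDr -big_split; congr (_ * _).
by apply: eq_bigr => t _ /=; rewrite mulrDr.
Qed.

Lemma pulls_backM k (T T' : @components R n k) (f f' : V -> R) x :
  f x = f' (phi x) -> pulls_back phi w T T' x ->
  pulls_back phi w (fun y s => f y * T y s) (fun y s => f' y * T' y s) x.
Proof.
move=> ff pT s; rewrite pT ff mulrCA; congr (_ * _); rewrite mulr_sumr.
by apply: eq_bigr => t _; rewrite mulrCA.
Qed.

(** The tensor product with the metric, which occupies the first two indices. *)
Definition metric_product (G : V -> 'M[R]_n) k (T : @components R n k) : components k.+2 :=
  fun x s => let s' : k.+1.-tuple 'I_n := behead_tuple s in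
    G x (thead s) (thead s') * T x (behead_tuple s').

Lemma metric_productE G k (T : @components R n k) x a b (u : k.-tuple 'I_n) :
  metric_product G T x [tuple of a :: [tuple of b :: u]] = G x a b * T x u.
Proof. by rewrite /metric_product !theadE; congr (_ * T x _); exact: val_inj. Qed.

Lemma pulls_back_metric_product (G G' : V -> 'M[R]_n) k (T T' : @components R n k) x :
  G x = (J x)^T *m G' (phi x) *m J x -> pulls_back phi w T T' x ->
  pulls_back phi w (metric_product G T) (metric_product G' T') x.
Proof.
move=> GE pT s; case/tupleP: s => a s; case/tupleP: s => b u.
rewrite metric_productE pT mulrCA; congr (_ * _).
have -> : G x a b = \sum_p \sum_q J x p a * J x q b * G' (phi x) p q.
  rewrite GE mxE exchange_big; apply: eq_bigr => q _; rewrite mxE mulr_suml.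
  by apply: eq_bigr => p _; rewrite [_^T _ _]mxE; ring.
rewrite big_tuple_cons mulr_suml; apply: eq_bigr => p _.
rewrite big_tuple_cons mulr_suml; apply: eq_bigr => q _.
rewrite mulr_sumr; apply: eq_bigr => t _.
rewrite metric_productE 2!big_ord_recl !tnth0 !tnthS.
under [in RHS]eq_bigr do rewrite !tnthS.
by move: (\prod_(_ < k) _) => z; ring.
Qed.

Lemma pulls_back3P (T T' : @components R n 3) x : pulls_back phi w T T' x <->
  pulls_back3 (J x) (((\det (J x)) ^+ 2) `^ (- (w / (2 * n + 2)%N%:R)))
    (fun i j k => T x [tuple i; j; k]) (fun i j k => T' (phi x) [tuple i; j; k]).
Proof.
have E i j k : \sum_t \prod_(p < 3) J x (tnth t p) (tnth [tuple i; j; k] p) * T' (phi x) t =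
    \sum_a \sum_b \sum_c J x a i * J x b j * J x c k * T' (phi x) [tuple a; b; c].
  rewrite big_tuple_cons; apply: eq_bigr => a _; rewrite big_tuple_cons.
  apply: eq_bigr => b _; rewrite big_tuple_cons; apply: eq_bigr => c _.
  rewrite big_tuple0 !big_ord_recl big_ord0 mulr1 !(tnth_nth i) /= !mulrA.
  by congr (_ * T' _ _); exact: val_inj.
split=> H; first by move=> i j k; rewrite H E.
by move=> s; rewrite [s]tuple3_eta H E.
Qed.

End PullbackAlgebra.

(** * The two operators on the manifold, built from one metric *)

Section TensorsOnManifold.
Context {R : realType} {n : nat}.
Variable M : manifold R n.
Local Notation V := 'rV[R]_n.
Implicit Types (g h : metric M) (c d : chart M).

Lemma smooth_nabla (U : set V) (G : V -> 'M[R]_n) w k (T : @components R n k) s :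
  open U -> metric_on U G -> (forall t, smooth_on U (fun x => T x t)) ->
  smooth_on U (fun x => nabla G w T x s).
Proof.
move=> oU mG sT; rewrite /nabla; apply: (smoothB oU).
  apply: (smoothD oU); first exact: smooth_partial.
  apply: (smoothM oU) => //; apply: (smoothM oU); first exact: smooth_cst.
  by apply: (smooth_sum oU) => e _; exact: smooth_christoffel.
apply: (smooth_sum oU) => p _; apply: (smooth_sum oU) => e _.
by apply: (smoothM oU) => //; exact: smooth_christoffel.
Qed.

Lemma nabla_transition g w k (T : chart M -> @components R n k) :
  (forall c s, smooth_on (chart_image c) (fun x => T c x s)) ->
  (forall c d x, overlap c d x -> pulls_back (transition c d) w (T c) (T d) x) ->
  forall c d x, overlap c d x ->
  pulls_back (transition c d) w (nabla (metric_matrix g c) w (T c))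
    (nabla (metric_matrix g d) w (T d)) x.
Proof.
move=> sT pT c d x ox.
have sub y : overlap c d y -> chart_image c y by exact: overlap_image.
have oO := @overlap_open _ _ M c d; have oI := @open_chart_image _ _ M d.
have mG := metric_on_sub sub (metric_matrix_on g c); have mG' := metric_matrix_on g d.
have sphi e := @transition_smooth _ _ M c d e.
have ti y : overlap c d y -> chart_image d (transition c d y) by exact: transition_image.
have uJ y : overlap c d y -> jacobian_mx (transition c d) y \in unitmx.
  exact: transition_jacobian_unit.
have GE y (oy : overlap c d y) := metric_matrix_transition g oy.
apply: (nabla_pullback oO oI sphi ti uJ mG mG' GE ox) => [t|y oy]; last exact: pT.
exact: smooth_diff (sT d t) (ti _ ox).
Qed.

Lemma smooth_metric_product g c k (T : @components R n k) s :
  (forall t, smooth_on (chart_image c) (fun x => T x t)) ->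
  smooth_on (chart_image c) (fun x => metric_product (metric_matrix g c) T x s).
Proof.
move=> sT; have [sG _ _] := metric_matrix_on g c.
by apply: (smoothM (@open_chart_image _ _ M c)).
Qed.

Variables (g : metric M) (B : M -> R).
Hypothesis sB : smooth_function B.
Let Bc c (x : V) := B (chart_inv c x).

Let Bc_transition c d x : overlap c d x -> Bc c x = Bc d (transition c d x).
Proof. by move=> ox; rewrite /Bc transition_inv. Qed.

Let sBc c : smooth_on (chart_image c) (Bc c).
Proof. exact: sB. Qed.

Let oc c := @open_chart_image _ _ M c.

Definition hessian_components (sigma : density M 1) c : components 2 := fun x s =>
  nabla (metric_matrix g c) 1 (nabla (metric_matrix g c) 1 (sigma c)) x s
  + metric_product (metric_matrix g c) (fun y t => Bc c y * sigma c y t) x s.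

Lemma hessian_componentsE sigma c x a b : hessian_components sigma c x [tuple a; b] =
  nabla1 (metric_matrix g c) 1
    (nabla0 (metric_matrix g c) 1 (fun y => sigma c y [tuple])) a b x
  + Bc c x * metric_matrix g c x a b * sigma c x [tuple].
Proof.
rewrite /hessian_components nabla_twiceE.
have -> : [tuple a; b] = [tuple of a :: [tuple of b :: [tuple]]] :> 2.-tuple 'I_n.
  exact: val_inj.
by rewrite metric_productE mulrCA mulrA.
Qed.

Lemma hessian_components_smooth sigma c s :
  smooth_on (chart_image c) (fun x => hessian_components sigma c x s).
Proof.
have ss t : smooth_on (chart_image c) (fun x => sigma c x t) by exact: tensor_smooth.
rewrite /hessian_components; apply: (smoothD (@oc c)).
  apply: (smooth_nabla _ _ (@oc c) (metric_matrix_on g c)) => t.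
  exact: (smooth_nabla _ _ (@oc c) (metric_matrix_on g c)).
apply: smooth_metric_product => t; exact: (smoothM (@oc c)).
Qed.

Lemma hessian_components_sym sigma c x (s t : 2.-tuple 'I_n) : chart_image c x ->
  perm_eq s t -> hessian_components sigma c x s = hessian_components sigma c x t.
Proof.
move=> cx; rewrite [s]tuple2_eta [t]tuple2_eta => /perm_eq_pair[[-> ->]|[-> ->]] //.
have mG := metric_matrix_on g c.
rewrite !hessian_componentsE (metric_on_sym mG _ _ cx); congr (_ + _).
by apply: (nabla1_nabla0_sym (@oc c) mG) => //; exact: tensor_smooth.
Qed.

Lemma hessian_components_transition sigma c d x : overlap c d x ->
  pulls_back (transition c d) 1 (hessian_components sigma c) (hessian_components sigma d) x.
Proof.
move=> ox; have ps c' d' y : overlap c' d' y ->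
    pulls_back (transition c' d') 1 (sigma c') (sigma d') y.
  by move=> oy s; exact: (tensor_transition sigma s oy).
apply: pulls_backD.
  apply: (@nabla_transition g 1 1 (fun c => nabla (metric_matrix g c) 1 (sigma c))) => //.
    move=> e s; apply: (smooth_nabla _ _ (@oc e) (metric_matrix_on g e)) => t.
    exact: tensor_smooth.
  apply: (@nabla_transition g 1 0 (fun c => sigma c)) => //.
  by move=> e s; exact: tensor_smooth.
apply: pulls_back_metric_product; first exact: metric_matrix_transition.
by apply: pulls_backM; [exact: Bc_transition|exact: ps].
Qed.

Definition hessian_operator (sigma : density M 1) : sym_tensor M 2 1 :=
  SymTensor (hessian_components_smooth sigma) (@hessian_components_sym sigma)
    (fun c d x s ox => @hessian_components_transition sigma c d x ox s).

(** The covector that multiplies the metric in S. [B] is differentiated as a scalar of weight 0,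
    with components that ignore the empty tuple, so that the transformation law of [nabla] covers
    it. *)
Definition gradient_components (tau : density M 2) c : components 1 := fun x s =>
  4 * Bc c x * nabla (metric_matrix g c) 2 (tau c) x s
  + 2 * (nabla (metric_matrix g c) 0 (fun y _ => Bc c y) x s * tau c x [tuple]).

(** S before symmetrisation. It is already a tensor, so smoothness and the transformation law are
    shown here and carried through the symmetrisation. *)
Definition third_order_components (tau : density M 2) c : components 3 := fun x s =>
  nabla (metric_matrix g c) 2 (nabla (metric_matrix g c) 2
    (nabla (metric_matrix g c) 2 (tau c))) x s
  + metric_product (metric_matrix g c) (gradient_components tau c) x s.

Lemma third_order_componentsE tau c x i j k :
  third_order_components tau c x [tuple i; j; k] =
  nabla2 (metric_matrix g c) 2 (nabla1 (metric_matrix g c) 2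
    (nabla0 (metric_matrix g c) 2 (fun y => tau c y [tuple]))) i j k x
  + metric_matrix g c x i j *
   (4 * Bc c x * nabla0 (metric_matrix g c) 2 (fun y => tau c y [tuple]) k x
    + 2 * (pd k (Bc c) x * tau c x [tuple])).
Proof.
rewrite /third_order_components nabla_thriceE.
have -> : [tuple i; j; k] = [tuple of i :: [tuple of j :: [tuple k]]] :> 3.-tuple 'I_n.
  exact: val_inj.
rewrite metric_productE /gradient_components !nabla0E; congr (_ + _ * (_ + _ * (_ * _))).
by rewrite /nabla0 !mul0r addr0.
Qed.

Lemma third_order_componentsP tau c x i j k :
  sym3 (fun i j k => third_order_components tau c x [tuple i; j; k]) i j k =
  third_order_operator (metric_matrix g c) (Bc c) (fun y => tau c y [tuple]) i j k x.
Proof.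
rewrite (sym3_ext _ _ _ (third_order_componentsE tau c x)) /third_order_operator /sym3.
set r1 := nabla2 _ _ _ i j k x; set r2 := nabla2 _ _ _ i k j x.
set r3 := nabla2 _ _ _ j i k x; set r4 := nabla2 _ _ _ j k i x.
set r5 := nabla2 _ _ _ k i j x; set r6 := nabla2 _ _ _ k j i x.
set s1 := nabla0 _ _ _ i x; set s2 := nabla0 _ _ _ j x; set s3 := nabla0 _ _ _ k x.
set d1 := pd i _ x; set d2 := pd j _ x; set d3 := pd k _ x.
move: r1 r2 r3 r4 r5 r6 s1 s2 s3 d1 d2 d3 (Bc c x) (tau c x [tuple]).
move: (metric_matrix g c x i j) (metric_matrix g c x i k) (metric_matrix g c x j i).
move: (metric_matrix g c x j k) (metric_matrix g c x k i) (metric_matrix g c x k j) => *.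
by field.
Qed.

Lemma third_order_components_smooth tau c s :
  smooth_on (chart_image c) (fun x => third_order_components tau c x s).
Proof.
have st t : smooth_on (chart_image c) (fun x => tau c x t) by exact: tensor_smooth.
have sn k (T : components k) w t : (forall t, smooth_on (chart_image c) (fun x => T x t)) ->
    smooth_on (chart_image c) (fun x => nabla (metric_matrix g c) w T x t).
  exact: (smooth_nabla _ _ (@oc c) (metric_matrix_on g c)).
rewrite /third_order_components; apply: (smoothD (@oc c)); first by do 3 apply: (sn) => ?.
apply: smooth_metric_product => t; rewrite /gradient_components; apply: (smoothD (@oc c)).
  apply: (smoothM (@oc c)); last exact: sn.
  by apply: (smoothM (@oc c)) => //; exact: smooth_cst.
apply: (smoothM (@oc c)); first exact: smooth_cst.
by apply: (smoothM (@oc c)) => //; apply: sn.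
Qed.

Lemma third_order_components_transition tau c d x : overlap c d x ->
  pulls_back (transition c d) 2 (third_order_components tau c) (third_order_components tau d) x.
Proof.
move=> ox; have ps c' d' y : overlap c' d' y ->
    pulls_back (transition c' d') 2 (tau c') (tau d') y.
  by move=> oy s; exact: (tensor_transition tau s oy).
have sn k (T : chart M -> components k) : (forall e t, smooth_on (chart_image e) (fun x => T e x t)) ->
    forall e t, smooth_on (chart_image e) (fun x => nabla (metric_matrix g e) 2 (T e) x t).
  by move=> sT e t; exact: (smooth_nabla _ _ (@oc e) (metric_matrix_on g e)).
have s0 e t : smooth_on (chart_image e) (fun x => tau e x t) by exact: tensor_smooth.
have s1 := sn _ (fun e => tau e) s0.
have s2 := sn _ (fun e => nabla (metric_matrix g e) 2 (tau e)) s1.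
have p1 := nabla_transition g s0 ps.
have p2 := nabla_transition g s1 p1.
have p3 := nabla_transition g s2 p2.
apply: pulls_backD; first exact: p3.
apply: pulls_back_metric_product; first exact: metric_matrix_transition.
apply: pulls_backD.
  by apply: pulls_backM; [rewrite (Bc_transition ox)|exact: p1].
apply: (pulls_backM (f := fun=> 2) (f' := fun=> 2)) => // s.
have pB c' d' y : overlap c' d' y ->
    pulls_back (transition c' d') 0 (fun y (_ : 0.-tuple 'I_n) => Bc c' y)
      (fun y (_ : 0.-tuple 'I_n) => Bc d' y) y.
  move=> oy t; rewrite mul0r oppr0 powRr0 mul1r big_tuple0 big_ord0 mul1r.
  exact: Bc_transition.
have sB0 e (t : 0.-tuple 'I_n) : smooth_on (chart_image e) (fun y => Bc e y) by exact: sBc.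
have := nabla_transition g sB0 pB ox s; rewrite mul0r oppr0 powRr0 mul1r => ->.
have := ps c d x ox [tuple]; rewrite big_tuple0 big_ord0 mul1r => ->.
rewrite mulrCA; congr (_ * _); rewrite mulr_suml.
by apply: eq_bigr => t _; rewrite mulrA.
Qed.

Definition third_order_sym_components (tau : density M 2) c : components 3 := fun x s =>
  sym3 (fun i j k => third_order_components tau c x [tuple i; j; k])
    (tnth s ord0) (tnth s (inord 1)) (tnth s (inord 2)).

Lemma third_order_sym_componentsE tau c x i j k :
  third_order_sym_components tau c x [tuple i; j; k] =
  sym3 (fun i j k => third_order_components tau c x [tuple i; j; k]) i j k.
Proof.
by rewrite /third_order_sym_components !(tnth_nth i) /= !inordK.
Qed.

Lemma third_order_sym_smooth tau c s :
  smooth_on (chart_image c) (fun x => third_order_sym_components tau c x s).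
Proof.
have st i j k := @third_order_components_smooth tau c [tuple i; j; k].
rewrite /third_order_sym_components /sym3; apply: (smoothM (@oc c)); first exact: smooth_cst.
by do 5 (apply: (smoothD (@oc c)) => //).
Qed.

Lemma third_order_sym_sym tau c x (s t : 3.-tuple 'I_n) : chart_image c x ->
  perm_eq s t -> third_order_sym_components tau c x s = third_order_sym_components tau c x t.
Proof.
move=> _ st; apply: sym3_perm.
rewrite -[X in perm_eq X]/(tval [tuple tnth s ord0; tnth s (inord 1); tnth s (inord 2)]).
rewrite -[X in perm_eq _ X]/(tval [tuple tnth t ord0; tnth t (inord 1); tnth t (inord 2)]).
by rewrite -!tuple3_eta.
Qed.

Lemma third_order_sym_transition tau c d x : overlap c d x ->
  pulls_back (transition c d) 2 (third_order_sym_components tau c)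
    (third_order_sym_components tau d) x.
Proof.
move=> ox; have /pulls_back3P/pulls_back3_sym3 H := third_order_components_transition tau ox.
apply/pulls_back3P => i j k; rewrite third_order_sym_componentsE H; congr (_ * _).
apply: eq_bigr => a _; apply: eq_bigr => b _; apply: eq_bigr => e _.
by rewrite third_order_sym_componentsE.
Qed.

Definition third_order_tensor (tau : density M 2) : sym_tensor M 3 2 :=
  SymTensor (third_order_sym_smooth tau) (@third_order_sym_sym tau)
    (fun c d x s ox => @third_order_sym_transition tau c d x ox s).

Lemma linear_differential_operatorP w w' k (D : density M w -> sym_tensor M k w') (N : nat) :
  (forall c t, local_operator (fun (sigma : density M w) y => sigma c y [tuple])
     (chart_image c) N (fun sigma x => D sigma c x t)) ->
  linear_differential_operator D.
Proof.
move=> H; exists N => c; have /choice[A HA] := H c.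
exists (fun j s t => A t s); split.
  by move=> j s t; have [] := HA t.
by move=> sigma x t cx; have [_ ->] := HA t.
Qed.

Lemma hessian_operator_differential : linear_differential_operator hessian_operator.
Proof.
apply: (@linear_differential_operatorP _ _ _ _ 2) => c t.
have mG := metric_matrix_on g c; have [sG _ _] := mG.
pose sec (sigma : density M 1) y := sigma c y [tuple].
have ss s : smooth_on (chart_image c) (sec s) by exact: tensor_smooth.
apply: (@local_operator_ext _ _ _ sec _ 2 (fun sigma x =>
  nabla1 (metric_matrix g c) 1 (nabla0 (metric_matrix g c) 1 (sec sigma))
    (tnth t ord0) (tnth t (inord 1)) x
  + Bc c x * metric_matrix g c x (tnth t ord0) (tnth t (inord 1)) * sec sigma x)).
  by move=> sigma x cx; rewrite /= -hessian_componentsE -tuple2_eta.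
have l0 := local_operator_id sec (@oc c).
apply: local_operatorD => //.
  apply: (local_operator_nabla1 (@oc c) ss mG) => e.
  exact: (local_operator_nabla0 (@oc c) ss mG).
apply: (local_operatorM (@oc c) (f := fun x => Bc c x *
  metric_matrix g c x (tnth t ord0) (tnth t (inord 1)))) => //.
  exact: (smoothM (@oc c)).
by do 2 apply: local_operator_widen => //.
Qed.

Lemma third_order_tensor_differential : linear_differential_operator third_order_tensor.
Proof.
apply: (@linear_differential_operatorP _ _ _ _ 3) => c t.
have mG := metric_matrix_on g c; have [sG _ _] := mG.
pose sec (sigma : density M 2) y := sigma c y [tuple].
have ss s : smooth_on (chart_image c) (sec s) by exact: tensor_smooth.
have l0 := local_operator_id sec (@oc c).
have l1 e : local_operator sec (chart_image c) 1
    (fun sigma => nabla0 (metric_matrix g c) 2 (sec sigma) e).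
  exact: (local_operator_nabla0 (@oc c) ss mG).
have lT i j k : local_operator sec (chart_image c) 3
    (fun sigma x => third_order_components sigma c x [tuple i; j; k]).
  apply: (@local_operator_ext _ _ _ sec _ 3 (fun sigma x =>
    nabla2 (metric_matrix g c) 2 (nabla1 (metric_matrix g c) 2
      (nabla0 (metric_matrix g c) 2 (sec sigma))) i j k x
    + (metric_matrix g c x i j * (4 * Bc c x) * nabla0 (metric_matrix g c) 2 (sec sigma) k x
      + metric_matrix g c x i j * (2 * pd k (Bc c) x) * sec sigma x))).
    by move=> sigma x cx; rewrite third_order_componentsE /sec !mulrDr !mulrA.
  apply: local_operatorD => //.
    apply: (local_operator_nabla2 (@oc c) ss mG 2 i j k (P := fun a b sigma =>
      nabla1 (metric_matrix g c) 2 (nabla0 (metric_matrix g c) 2 (sec sigma)) a b)) => a b.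
    exact: (local_operator_nabla1 (@oc c) ss mG).
  apply: local_operatorD => //.
    do 2 apply: (local_operator_widen (@oc c)).
    apply: (local_operatorM (@oc c) (f := fun x => metric_matrix g c x i j * (4 * Bc c x))) => //.
    by apply: (smoothM (@oc c)) => //; apply: (smoothM (@oc c)) => //; exact: smooth_cst.
  do 3 apply: (local_operator_widen (@oc c)).
  apply: (local_operatorM (@oc c) (f := fun x => metric_matrix g c x i j * (2 * pd k (Bc c) x))) => //.
  apply: (smoothM (@oc c)) => //; apply: (smoothM (@oc c)); first exact: smooth_cst.
  by rewrite -pdE; exact: smooth_partial.
apply: (local_operatorM (@oc c) (f := fun=> 6^-1)); first exact: smooth_cst.
by do 5 apply: local_operatorD => //.
Qed.

End TensorsOnManifold.

Theorem proposition3p11 (R : realType) (n : nat) (n_ge2 : (2 <= n)%N)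
  (M : manifold R n) (m : set (metric M))
  (m_projective : metric_projective_structure m)
  (m_nullity : has_weyl_nullity m)
  (B_smooth : forall g, m g -> smooth_function (nullity_eigenvalue g)) :
  (exists E : density M 1 -> sym_tensor M 2 1,
     linear_differential_operator E /\
     forall g, m g -> forall (sigma : density M 1) (c : chart M) x,
     chart_image c x -> forall a b : 'I_n,
     let G := metric_matrix g c in
     let B := fun y => nullity_eigenvalue g (chart_inv c y) in
     E sigma c x [tuple a; b] =
       nabla G 1 (nabla G 1 (sigma c)) x [tuple a; b]
       + B x * G x a b * sigma c x [tuple])
  /\
  (exists S : density M 2 -> sym_tensor M 3 2,
     linear_differential_operator S /\
     forall g, m g -> forall (tau : density M 2) (c : chart M) x,
     chart_image c x -> forall a b d : 'I_n,
     let G := metric_matrix g c in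
     let B := fun y => nullity_eigenvalue g (chart_inv c y) in
     S tau c x [tuple a; b; d] =
       sym3 (fun i j k =>
         nabla G 2 (nabla G 2 (nabla G 2 (tau c))) x [tuple i; j; k]) a b d
       + 4 * B x * sym3 (fun i j k =>
           G x i j * nabla G 2 (tau c) x [tuple k]) a b d
       + 2 * sym3 (fun i j k => G x i j * partial k B x) a b d
         * tau c x [tuple]).
Proof.
(* The representative [g0] of the class defines both operators; every other metric of the class is
   compared with it, chart by chart. *)
have [g0 mE] := m_projective.
have mg0 : m g0 by rewrite mE; exact: projectively_equivalent_refl.
have sB0 := B_smooth g0 mg0.
have Phi g (mg : m g) c x j l (cx : chart_image c x) :
    projective_hessian (metric_matrix g0 c) (metric_matrix g c) j l x =
    nullity_eigenvalue g0 (chart_inv c x) * metric_matrix g0 c x j l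
    - nullity_eigenvalue g (chart_inv c x) * metric_matrix g c x j l.
  have [cp cpx] := chart_imageP cx.
  (* This is where the nonzero nullity vector enters: at each point it turns the invariance of the
     Weyl tensor into the formula for [Phi]. *)
  have [v [v0 nv]] := m_nullity g0 mg0 _ c cp; rewrite cpx in nv.
  have pe : projectively_equivalent g0 g by move: mg; rewrite mE.
  exact: (hessian_eigenvalue n_ge2 j l pe.1 cx v0 nv).
have GH g (mg : m g) c x k i j (cx : chart_image c x) :
    christoffel (metric_matrix g c) x k i j = christoffel (metric_matrix g0 c) x k i j
    + ((k == i)%:R * projective_form (metric_matrix g0 c) (metric_matrix g c) j x
       + (k == j)%:R * projective_form (metric_matrix g0 c) (metric_matrix g c) i x).
  have pe : projectively_equivalent g0 g by move: mg; rewrite mE.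
  exact: (projective_christoffel k i j pe.1 cx).
split.
- exists (hessian_operator g0 sB0); split; first exact: hessian_operator_differential.
  move=> g mg sigma c x cx a b G B.
  rewrite [LHS]hessian_componentsE nabla_twiceE.
  have ss : smooth_on (chart_image c) (fun y => sigma c y [tuple]) by exact: tensor_smooth.
  have oc := @open_chart_image _ _ M c.
  have PhiE y j l (cy : chart_image c y) := Phi g mg c y j l cy.
  have GHc y k i j (cy : chart_image c y) := GH g mg c y k i j cy.
  exact: esym (hessian_invariant oc (metric_matrix_on g0 c) (metric_matrix_on g c) GHc PhiE a b ss cx).
- exists (third_order_tensor g0 sB0); split; first exact: third_order_tensor_differential.
  move=> g mg tau c x cx a b d G B.
  have ss : smooth_on (chart_image c) (fun y => tau c y [tuple]) by exact: tensor_smooth.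
  have oc := @open_chart_image _ _ M c.
  have PhiE y j l (cy : chart_image c y) := Phi g mg c y j l cy.
  have GHc y k i j (cy : chart_image c y) := GH g mg c y k i j cy.
  have inv := third_order_invariant oc (metric_matrix_on g0 c) (metric_matrix_on g c) GHc
    (sB0 c) (B_smooth g mg c) PhiE a b d ss cx.
  transitivity (third_order_operator G B (fun y => tau c y [tuple]) a b d x); last first.
    rewrite /third_order_operator -pdE; congr (_ + _ * _ + _).
      apply: sym3_ext => i j k; exact: esym (nabla_thriceE _ _ _ _ _ _ _).
    apply: sym3_ext => i j k; congr (_ * _); exact: esym (nabla0E _ _ _ _ _).
  rewrite inv [LHS]third_order_sym_componentsE; exact: third_order_componentsP.
Qed.
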